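(* Let $\mu,\nu\in\mathcal{P}_c(\mathbb{H}^n)$. Then $$\max\left\{\int_{\mathbb{H}^n}u\,d(\mu-\nu):\ u\in HW^{1,\infty}(\mathbb{H}^n),\ \|\nabla_Hu\|_\infty\le1\right\}=\inf\left\{\|\mathbf{w}\|_{\mathcal{M}(\mathbb{H}^n,H\mathbb{H}^n)}:\ \mathbf{w}\in\mathcal{M}_c(\mathbb{H}^n,H\mathbb{H}^n),\ \mathrm{div}_H\mathbf{w}=\mu-\nu\right\}.$$
   Context: Let $n\ge 1$. $\mathbb{H}^n$ is $\mathbb{R}^{2n+1}$ with the horizontal vector fields $X_j=\partial_{x_j}-\frac{x_{n+j}}{2}\partial_{x_{2n+1}}$, $X_{n+j}=\partial_{x_{n+j}}+\frac{x_j}{2}\partial_{x_{2n+1}}$ ($j=1,\dots,n$). $H_x\mathbb{H}^n=\mathrm{span}\{X_1(x),\dots,X_{2n}(x)\}$ carries the norm $|\cdot|_H$ making $X_1,\dots,X_{2n}$ orthonormal; $H\mathbb{H}^n$ is the horizontal bundle. $\nabla_H\varphi=\sum_{i=1}^{2n}X_i\varphi\,X_i$ (distributional). $HW^{1,\infty}(\mathbb{H}^n)=\{u\in L^\infty(\mathbb{H}^n):\nabla_Hu\in L^\infty(\mathbb{H}^n,H\mathbb{H}^n)\}$; its elements are identified with their continuous representatives, so that $\int u\,d(\mu-\nu)$ makes sense. $\|\nabla_Hu\|_\infty$ is the essential supremum of $|\nabla_Hu|_H$. $\mathcal{P}_c(\mathbb{H}^n)$ is the set of compactly supported Borel probability measures.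 $\mathcal{M}(\mathbb{H}^n,H\mathbb{H}^n)$ is the dual of $C_0(\mathbb{H}^n,H\mathbb{H}^n)$ (completion of the compactly supported continuous horizontal vector fields for $\|\phi\|_\infty=\sup_x|\phi(x)|_H$), with dual norm; its elements are identified with $\mathbb{R}^{2n}$-valued finite Radon measures via $\int\phi\cdot d\mathbf{w}=\sum_i\int\phi_i\,d\mathbf{w}_i$ for $\phi=\sum_i\phi_iX_i$. $\mathcal{M}_c$ denotes the compactly supported ones. For $\mathbf{w}\in\mathcal{M}_c(\mathbb{H}^n,H\mathbb{H}^n)$, $\langle\mathrm{div}_H\mathbf{w},\varphi\rangle=-\int\nabla_H\varphi\cdot d\mathbf{w}$ for all $\varphi\in C^\infty(\mathbb{H}^n)$. *)

(* Defs.v *)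
From HB Require Import structures.
From mathcomp Require Import all_boot all_order all_algebra.
From mathcomp Require Import all_classical all_reals all_analysis.
From mathcomp Require Import measurable_realfun ess_sup_inf lra.

Set Implicit Arguments.
Unset Strict Implicit.
Unset Printing Implicit Defensive.

Import Order.TTheory GRing.Theory Num.Theory.
Import numFieldNormedType.Exports.

Local Open Scope classical_set_scope.
Local Open Scope ring_scope.

(* Borel sigma-algebra of the space of matrices. *)
HB.instance Definition _ (R : realType) (m n : nat) :=
  @isMeasurable.Build (sigma_display (@open 'M[R]_(m, n))) 'M[R]_(m, n)
    <<s @open 'M[R]_(m, n) >>
    (@sigma_algebra0 _ setT _) (@sigma_algebraC _ _)
    (@sigma_algebra_bigcup _ setT _).

Section row_measurability.
Context {R : realType}.

Lemma open_measurable_mx (m n : nat) (A : set 'M[R]_(m, n)) :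
  open A -> measurable A.
Proof. by move=> oA; exact: sub_sigma_algebra. Qed.

Lemma measurable_coord (m : nat) (i : 'I_m) :
  measurable_fun [set: 'rV[R]_m] (fun v : 'rV[R]_m => v ord0 i).
Proof.
apply: (measurability _ (RGenOpens.measurableE R)).
move=> _ [_ [a [b ->] <-]]; rewrite setTI; apply: open_measurable_mx.
have /continuousP := @coord_continuous R 1 m ord0 i.
by apply; exact: interval_open.
Qed.

Lemma measurable_rowP d (T : measurableType d) (m : nat) (f : T -> 'rV[R]_m) :
  (forall i, measurable_fun setT (fun x => f x ord0 i)) ->
  measurable_fun setT f.
Proof.
move=> mf.
apply: (@measurability _ _ T 'rV[R]_m setT f (@open 'rV[R]_m)) => //.
move=> _ [U oU <-]; rewrite setTI.
pose box (q : 'rV[rat]_m * rat) : set 'rV[R]_m :=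
  [set v | forall i, ball (ratr (q.1 ord0 i) : R) (ratr q.2) (v ord0 i)].
pose B k := if unpickle k is Some q then
  if `[< box q `<=` U >] then f @^-1` box q else set0 else set0.
have -> : f @^-1` U = \bigcup_k B k.
  apply/seteqP; split=> [x Ux|x [k _]]; last first.
    rewrite /B; case: unpickle => [q|//].
    by case: asboolP => // bU bx; exact: bU.
  have /nbhs_ballP[e /= e0 eU] : nbhs (f x) U by exact: open_nbhs_nbhs.
  have [r /= r0 re] : exists2 r : rat, 0 < ratr r :> R & ratr r + ratr r < e.
    have n0 : (`]0, e / 2[%classic : set R) !=set0.
      by exists (e / 4); rewrite /= in_itv /=; apply/andP; split; lra.
    have [y [yi [r _ ry]]] := dense_rat n0 (@interval_open R (BRight 0) (BLeft (e/2)) isT isT).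
    by move: yi; rewrite -ry /= in_itv /= => /andP[r0 r2]; exists r => //; lra.
  have qP i : exists q : rat, ball (ratr q : R) (ratr r) (f x ord0 i).
    have n0 : ball (f x ord0 i) (ratr r) !=set0.
      by exists (f x ord0 i); exact: ballxx.
    have [y [yb [q _ qy]]] := dense_rat n0 (ball_open _ _).
    by exists q; rewrite qy; exact: ball_sym.
  pose q := (\row_i sval (cid (qP i)), r).
  have bx : box q (f x).
    by move=> i /=; rewrite mxE; exact: svalP (cid (qP i)).
  exists (pickle q) => //; rewrite /B pickleK asboolT// => v bv.
  apply: eU; split=> // i j; rewrite ord1.
  apply: (le_ball (ltW re)).
  exact: (ball_triangle (ball_sym (bx j)) (bv j)).
apply: bigcup_measurable => k _; rewrite /B.
case: unpickle => [q|]; last exact: measurable0.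
case: ifP => _; last exact: measurable0.
have -> : f @^-1` box q = \bigcap_(i : 'I_m)
    ((fun x => f x ord0 i) @^-1` ball (ratr (q.1 ord0 i) : R) (ratr q.2)).
  by apply/seteqP; split=> x bx i; [move=> _|]; exact: bx.
apply: fin_bigcap_measurable; first exact: finite_finset.
move=> i _; rewrite -[X in measurable X]setTI; apply: mf => //.
exact: measurable_ball.
Qed.

End row_measurability.

Section lebesgue_rV.
Context {R : realType}.

Definition cons_row (m : nat) (p : measurableTypeR R * 'rV[R]_m) :
    'rV[R]_m.+1 :=
  \row_i (if unlift ord0 i is Some j then p.2 ord0 j else p.1).

Definition uncons_row (m : nat) (v : 'rV[R]_m.+1) :
    measurableTypeR R * 'rV[R]_m :=
  (v ord0 ord0, \row_j v ord0 (lift ord0 j)).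

Lemma cons_rowK (m : nat) : cancel (@cons_row m) (@uncons_row m).
Proof.
move=> [x v]; rewrite /uncons_row /cons_row mxE unlift_none /=; congr pair.
by apply/rowP => j; rewrite !mxE liftK.
Qed.

Lemma measurable_cons_row (m : nat) : measurable_fun setT (@cons_row m).
Proof.
apply: measurable_rowP => i; rewrite /cons_row.
under eq_fun do rewrite mxE.
case: unlift => [j|]; last exact: measurable_fst.
exact: measurableT_comp (measurable_coord j) measurable_snd.
Qed.

Lemma measurable_uncons_row (m : nat) : measurable_fun setT (@uncons_row m).
Proof.
apply: measurable_fun_pair; first exact: measurable_coord.
apply: measurable_rowP => j; under eq_fun do rewrite mxE.
exact: measurable_coord.
Qed.

Section step.
Variables (m : nat) (mu : {sigma_finite_measure set 'rV[R]_m -> \bar R}).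

Definition lebesgue_cons : set 'rV[R]_m.+1 -> \bar R :=
  pushforward (@lebesgue_measure R \x mu)%E (@cons_row m).

Let mpreimage (A : set 'rV[R]_m.+1) :
  measurable A -> measurable (@cons_row m @^-1` A).
Proof.
by move=> mA; rewrite -[X in measurable X]setTI; exact: measurable_cons_row.
Qed.

Let lebesgue_cons0 : lebesgue_cons set0 = 0%E.
Proof. by rewrite /lebesgue_cons /pushforward preimage_set0 measure0. Qed.

Let lebesgue_cons_ge0 A : (0 <= lebesgue_cons A)%E.
Proof. by rewrite /lebesgue_cons /pushforward; exact: measure_ge0. Qed.

Let lebesgue_cons_sigma_additive : semi_sigma_additive lebesgue_cons.
Proof.
move=> F mF tF mUF; rewrite /lebesgue_cons /pushforward preimage_bigcup.
apply: measure_semi_sigma_additive.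
- by move=> k; exact: mpreimage.
- apply/trivIsetP => i j _ _ ij; rewrite -preimage_setI.
  by move/trivIsetP : tF => /(_ _ _ _ _ ij) ->//; rewrite preimage_set0.
- by rewrite -preimage_bigcup; exact: mpreimage.
Qed.

HB.instance Definition _ := isMeasure.Build _ _ _ lebesgue_cons
  lebesgue_cons0 lebesgue_cons_ge0 lebesgue_cons_sigma_additive.

Let lebesgue_cons_sigma_finite : sigma_finite setT lebesgue_cons.
Proof.
have /sigma_finiteP[F [TF ndF Foo]] := sigma_finiteT (@lebesgue_measure R).
have /sigma_finiteP[G [TG ndG Goo]] := sigma_finiteT mu.
exists (fun k => @uncons_row m @^-1` (F k `*` G k)).
  rewrite -preimage_bigcup; apply/esym/seteqP; split=> // v _ /=.
  have [k _ Fk] : (\bigcup_k F k) (uncons_row v).1 by rewrite -TF.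
  have [l _ Gl] : (\bigcup_k G k) (uncons_row v).2 by rewrite -TG.
  exists (maxn k l) => //; split.
    by move: Fk; exact/subsetPset/ndF/leq_maxl.
  by move: Gl; exact/subsetPset/ndG/leq_maxr.
move=> k; have [mFk Fkoo] := Foo k; have [mGk Gkoo] := Goo k; split.
  rewrite -[X in measurable X]setTI; apply: measurable_uncons_row => //.
  exact: measurableX.
rewrite /lebesgue_cons /pushforward -comp_preimage.
have -> : @uncons_row m \o @cons_row m = id by exact/funext/cons_rowK.
by rewrite preimage_id product_measure1E// lte_mul_pinfty// ge0_fin_numE.
Qed.

HB.instance Definition _ := Measure_isSigmaFinite.Build _ _ _ lebesgue_cons
  lebesgue_cons_sigma_finite.

End step.

(* Lebesgue measure on R^m, as an iterated product. *)
Fixpoint lebesgue_rV (m : nat) :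
    {sigma_finite_measure set 'rV[R]_m -> \bar R} :=
  if m is m'.+1 then lebesgue_cons (lebesgue_rV m')
  else dirac (0 : 'rV[R]_0).

End lebesgue_rV.

Notation heis R n := 'rV[R]_(n + n + 1).

Section smooth_functions.
Context {R : realType} {m : nat}.

Definition partial (i : 'I_m) (f : 'rV[R]_m -> R) : 'rV[R]_m -> R :=
  fun x => 'D_(delta_mx 0 i) f x.

Fixpoint Ck (k : nat) (f : 'rV[R]_m -> R) : Prop :=
  continuous f /\
  if k is k'.+1 then
    forall i, (forall x, derivable f x (delta_mx 0 i)) /\ Ck k' (partial i f)
  else True.

Definition smooth (f : 'rV[R]_m -> R) : Prop := forall k, Ck k f.

End smooth_functions.

Definition compact_support_fun (T : topologicalType) (V : nmodType)
  (f : T -> V) : Prop := compact (closure [set x | f x != 0]).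

Section charges.
Context {R : realType} {m : nat}.
Notation T := 'rV[R]_m.

(* For a measure mu, the inner condition says that mu U > 0; for a charge it
   says that U is not null for its variation. *)
Definition msupport (mu : set T -> \bar R) : set T :=
  [set x | forall U : set T, open U -> U x ->
     exists A : set T, [/\ measurable A, A `<=` U & mu A != 0%E]].

Definition compactly_supported (mu : set T -> \bar R) : Prop :=
  compact (msupport mu).

Lemma hahnP (nu : {charge set T -> \bar R}) :
  hahn_decomposition nu (sval (cid (Hahn_decomposition nu)))
    (sval (cid (svalP (cid (Hahn_decomposition nu))))).
Proof. exact: svalP. Qed.

(* Does not depend on the chosen Hahn decomposition, see
   Hahn_decomposition_uniq. *)
Definition charge_integral (nu : {charge set T -> \bar R}) (f : T -> R) : R :=
  \int[jordan_pos (hahnP nu)]_x f x - \int[jordan_neg (hahnP nu)]_x f x.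

Definition diff_integral (mu nu : probability T R) (f : T -> R) : R :=
  \int[mu]_x f x - \int[nu]_x f x.

End charges.

Section heisenberg.
Context {R : realType} {n : nat}.

Definition xc (j : 'I_n) : 'I_(n + n + 1) := lshift 1 (lshift n j).
Definition yc (j : 'I_n) : 'I_(n + n + 1) := lshift 1 (rshift n j).
Definition tc : 'I_(n + n + 1) := rshift (n + n) ord0.

Definition hX (i : 'I_(n + n)) (f : heis R n -> R) (x : heis R n) : R :=
  match fintype.split i with
  | inl j => partial (xc j) f x - x 0 (yc j) / 2 * partial tc f x
  | inr j => partial (yc j) f x + x 0 (xc j) / 2 * partial tc f x
  end.

(* A horizontal vector field \sum_i phi_i X_i is represented by its coordinates
   phi : heis R n -> 'rV_(n + n) in the frame X_1, ..., X_2n. As this frame is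
   orthonormal, the horizontal norm is the Euclidean norm of the coordinates. *)
Definition hnorm (v : 'rV[R]_(n + n)) : R := Num.sqrt (\sum_i v 0 i ^+ 2).

Definition hgrad (f : heis R n -> R) : heis R n -> 'rV[R]_(n + n) :=
  fun x => \row_i hX i f x.

(* The fields X_i are divergence free, so - X_i is the formal adjoint of X_i. *)
Definition distributional_hgrad (u : heis R n -> R)
    (g : heis R n -> 'rV[R]_(n + n)) : Prop :=
  forall (i : 'I_(n + n)) (f : heis R n -> R),
    smooth f -> compact_support_fun f ->
    \int[lebesgue_rV (n + n + 1)]_x (u x * hX i f x) =
    - \int[lebesgue_rV (n + n + 1)]_x (g x 0 i * f x).

(* u belongs to HW^{1,oo} and g represents its (a.e. unique) gradient. *)
Definition HW1oo_grad (u : heis R n -> R)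
    (g : heis R n -> 'rV[R]_(n + n)) : Prop :=
  [/\ u \in Lfun (lebesgue_rV (n + n + 1)) +oo%E,
      forall i, (fun x => g x 0 i) \in Lfun (lebesgue_rV (n + n + 1)) +oo%E
    & distributional_hgrad u g].

(* Elements of HW^{1,oo} (continuous representatives) with |grad u| <= 1. *)
Definition HW1oo_ball : set (heis R n -> R) :=
  [set u | continuous u /\
     exists2 g, HW1oo_grad u g &
       (ess_sup (lebesgue_rV (n + n + 1)) (fun x => (hnorm (g x))%:E)
          <= 1%:E)%E].

Definition Cc_fields : set (heis R n -> 'rV[R]_(n + n)) :=
  [set phi : heis R n -> 'rV[R]_(n + n) |
     continuous phi /\ compact_support_fun phi].

(* The completion of Cc_fields for the uniform norm, as a set of functions. *)
Definition C0_fields : set (heis R n -> 'rV[R]_(n + n)) :=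
  [set phi | forall e : R, 0 < e ->
     exists2 psi, Cc_fields psi & forall x, hnorm (phi x - psi x) <= e].

(* Finite Borel measures on R^(2n+1) are Radon. *)
Definition hmeasure : Type := 'I_(n + n) -> {charge set (heis R n) -> \bar R}.

Definition hpairing (w : hmeasure) (phi : heis R n -> 'rV[R]_(n + n)) : R :=
  \sum_i charge_integral (w i) (fun x => phi x 0 i).

Definition hmass (w : hmeasure) : \bar R :=
  ereal_sup [set `|hpairing w phi|%:E |
    phi in [set phi | C0_fields phi /\ forall x, hnorm (phi x) <= 1]].

Definition hmeasure_compact (w : hmeasure) : Prop :=
  forall i, compactly_supported (w i).

Definition hdiv (w : hmeasure) (f : heis R n -> R) : R :=
  - hpairing w (hgrad f).

Definition hdiv_eq (w : hmeasure) (mu nu : probability (heis R n) R) : Prop :=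
  forall f, smooth f -> hdiv w f = diff_integral mu nu f.

End heisenberg.
Arguments hmeasure R n : clear implicits.
Arguments HW1oo_ball R n : clear implicits.

Definition is_max (R : realType) (S : set R) (M : R) : Prop :=
  S M /\ ubound S M.

(* Main.v *)
From HB Require Import structures.
Require Import Defs.
From mathcomp Require Import all_boot all_order all_algebra.
From mathcomp Require Import all_classical all_reals all_analysis.
From mathcomp Require Import measurable_realfun ess_sup_inf ring lra.

Set Implicit Arguments.
Unset Strict Implicit.
Unset Printing Implicit Defensive.

Import Order.TTheory GRing.Theory Num.Theory.
Import numFieldNormedType.Exports.

Local Open Scope classical_set_scope.
Local Open Scope ring_scope.

(* Weak inequality: mollifying a Lipschitz [u] by a group convolution that
   commutes with the left-invariant fields X_i gives smooth v with
   |grad v| <= 1 close to [u], and v, cut off, is a test field for the mass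
   of w.
   Attainment: let p(s) be the infimum of the masses of the compactly supported
   w with div_H w = s. By Hahn-Banach some linear l <= p satisfies
   l(mu - nu) = p(mu - nu). Put u(x) = l(delta_x - delta_0). Spreading a measure
   along a horizontal segment [x, x exp Z] has cost |Z|, so u is 1-Lipschitz along
   horizontal segments, hence continuous because commutators of horizontal
   segments reach the vertical direction (this needs n >= 1). The same transport
   estimate, applied to a discretisation of mu and nu, gives
   \int u d(mu - nu) = l(mu - nu) = p(mu - nu). That a bounded such u has a
   weak horizontal gradient of norm <= 1 follows by minimising a weighted Dirichlet
   energy among its smooth approximants: by the parallelogram identity the
   gradients of a minimising sequence converge almost everywhere. *)

(** * Calculus of C^k functions on R^m *)

(** Convolution alone gives smooth approximants with bounded gradients, but nothing forces those
    gradients to converge. The constraints used here, $|\nabla_H v|\le 1$ everywhere and $|v-u|\le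
    1/(k+1)$ on the box of radius $k$, are stable under midpoints, so near-minimality of a quadratic
    energy makes successive gradients close. Bounded gradients need not be square integrable, hence
    a positive integrable weight in the energy. Consecutive energy gaps of order $4^{-j}$ give
    convergence almost everywhere, without passing to a subsequence. Not every functional is a
    divergence of a compactly supported measure, so $p$ is finite only on a subspace. It is
    therefore handled through the relation [hdiv_cost sigma c], and Hahn-Banach is stated for such a
    relation. The potential delivered by Hahn-Banach may be unbounded, whereas $HW^{1,\infty}$ asks
    for bounded functions. Truncating at its maximum on a box carrying $\mu$ and $\nu$ keeps the
    Lipschitz bound and both integrals. *)

Section directional_derivative.
Context {R : realType} {V : normedModType R}.
Implicit Types (f : V -> R) (x v w : V).

Lemma is_derive_line f x v (s d : R) :
  is_derive s (1 : R) (fun s : R => f (x + s *: v)) d <-> is_derive (x + s *: v) v f d.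
Proof.
have E : (fun h : R => h^-1 *: (((fun s : R => f (x + s *: v)) \o shift s) (h *: 1)
      - f (x + s *: v))) =
    (fun h : R => h^-1 *: ((f \o shift (x + s *: v)) (h *: v) - f (x + s *: v))).
  apply/funext => h /=; congr (_ *: (f _ - _)).
  by rewrite [h *: 1]mulr1 scalerDl addrCA addrA.
by split=> -[]; rewrite /derivable/derive => dv dE; split;
  rewrite /derivable /derive ?E // -E.
Qed.

Lemma is_deriveZv f x v (a d : R) : is_derive x v f d -> is_derive x (a *: v) f (a * d).
Proof.
move=> fd.
have h0 : x = x + 0 *: v by rewrite scale0r addr0.
have h1 : x = x + 0 *: (a *: v) by rewrite scale0r addr0.
rewrite [X in is_derive X]h1; apply/is_derive_line.
have g1 : is_derive (a * (0 : R)) (1 : R) (fun s : R => f (x + s *: v)) d.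
  by apply/is_derive_line; rewrite mulr0 scale0r addr0.
have g2 : is_derive (0 : R) (1 : R) (fun s : R => a * s) a.
  have := @is_deriveZ R R R id a 0 1 1 _ => /(_ _)/is_derive_eq; apply.
  by rewrite /GRing.scale /= mulr1.
have := @is_derive1_comp R _ _ _ _ _ g1 g2.
rewrite mulrC; congr (is_derive _ _ _ _).
by apply/funext => s /=; rewrite scalerA mulrC.
Qed.

Lemma MVT_line f x v : (forall y, derivable f y v) ->
  exists2 c, 0 <= c <= 1 & f (x + v) - f x = 'D_v f (x + c *: v).
Proof.
move=> fv.
have D (s : R) : is_derive s (1:R) (fun s : R => f (x + s *: v)) ('D_v f (x + s *: v)).
  by apply/is_derive_line; exact: derivableP.
have C : {within `[0:R, 1:R], continuous (fun s : R => f (x + s *: v))}.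
  apply: derivable_within_continuous => s _.
  exact: (@ex_derive _ _ _ _ _ _ _ (D s)).
have [c] := @MVT_segment R _ (fun s => 'D_v f (x + s *: v)) _ _ ler01
  (fun s _ => D s) C.
by rewrite scale1r scale0r addr0 subr0 mulr1 in_itv /=; exists c.
Qed.

(** Directional derivatives need not be additive in the direction. Continuity of one of them is
    enough: the mean value theorem turns the increment along [w] into [h] times a value of ['D_w f]
    at a point tending to [x]. *)
Lemma is_deriveDv f v w : (forall y, derivable f y v) ->
  (forall y, derivable f y w) -> continuous ('D_w f) ->
  forall x, is_derive x (v + w) f ('D_v f x + 'D_w f x).
Proof.
move=> fv fw cw x.
suff H : (fun h : R => h^-1 *: ((f \o shift x) (h *: (v + w)) - f x)) @ (0:R)^' -->
    'D_v f x + 'D_w f x.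
  by split; [apply/cvg_ex; eexists; exact: H | apply/cvg_lim].
have /choice[c cP] : forall h : R, exists c : R, `|c| <= `|h| /\
    f (x + h *: v + h *: w) - f (x + h *: v) = h * 'D_w f (x + h *: v + c *: w).
  move=> h; have [|c /andP[c0 c1] E] := @MVT_line f (x + h *: v) (h *: w).
    by move=> y; apply: ex_derive; apply: is_deriveZv; exact: derivableP.
  exists (c * h); rewrite normrM (ger0_norm c0) ler_piMl//; split => //.
  by rewrite E -scalerA; apply: (@derive_val _ _ _ _ _ _ _ _);
     apply: is_deriveZv; exact: derivableP.
have -> : (fun h : R => h^-1 *: ((f \o shift x) (h *: (v + w)) - f x)) =
  (fun h : R => h^-1 *: ((f \o shift x) (h *: v) - f x) +
     h^-1 *: (h *: 'D_w f (x + h *: v + c h *: w))).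
  apply/funext => h /=; rewrite -scalerDr; congr (_ *: _).
  rewrite -[h *: 'D_w f _]/(h * _) -(cP h).2.
  have -> : h *: (v + w) + x = x + h *: v + h *: w.
    by rewrite scalerDr addrC addrA.
  by rewrite (addrC (h *: v) x); ring.
apply: cvgD; first exact: fv.
have c0 : c h @[h --> (0:R)^'] --> (0:R).
  apply/cvgr0Pnorm_le => e e0; near=> h.
  rewrite (le_trans (cP h).1)//; near: h.
  apply: nbhs_dnbhs; apply/nbhs_ballP; exists e => //= h.
  by rewrite /ball /= sub0r normrN => /ltW.
have c1 : (fun h : R => x + h *: v + c h *: w) @ 0^' --> x.
  rewrite -[X in _ --> X](_ : x + (0:R) *: v + (0:R) *: w = x); last first.
    by rewrite !scale0r !addr0.
  apply: cvgD; last by apply: cvgZr_tmp.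
  apply: cvgD; first exact: cvg_cst.
  by apply: cvgZr_tmp; exact: nbhs_dnbhs.
have c2 := cvg_comp _ _ c1 (cw x).
apply: cvg_trans c2; apply: near_eq_cvg; near=> h => /=.
rewrite scalerA mulVf ?scale1r//.
by near: h; exact: nbhs_dnbhs_neq.
Unshelve. all: by end_near. Qed.

End directional_derivative.

Section Ck_theory.
Context {R : realType} {m : nat}.
Implicit Types (f g : 'rV[R]_m -> R) (x v : 'rV[R]_m).

Lemma Ck_continuous k f : Ck k f -> continuous f.
Proof. by case: k => [|k] []. Qed.

Lemma CkW k f : Ck k.+1 f -> Ck k f.
Proof.
elim: k f => [|k IH] f [cf H]; split=> // i.
by have [df Hf] := H i; split=> //; exact: IH.
Qed.

Lemma Ck_le k l f : (l <= k)%N -> Ck k f -> Ck l f.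
Proof.
move=> /subnK <-; elim: (k - l)%N => [//|d IH]; rewrite addSn => /CkW; exact: IH.
Qed.

Lemma smoothP f : smooth f <->
  [/\ continuous f, forall i x, derivable f x (delta_mx 0 i)
    & forall i, smooth (partial i f)].
Proof.
split=> [sf|[cf df sf] [|k]]; last 2 first.
- by split.
- by split=> // i; split=> //; exact: sf.
split; first exact: Ck_continuous (sf 0).
- by move=> i; have [_ /(_ i)[]] := sf 1.
- by move=> i k; have [_ /(_ i)[]] := sf k.+1.
Qed.

Lemma Ck1_is_derive f x v : Ck 1 f ->
  is_derive x v f (\sum_i v 0 i * partial i f x).
Proof.
move=> [cf pf]; rewrite [X in is_derive x X](row_sum_delta v).
elim: (index_enum _) x => [|i s IH] x.
  by rewrite !big_nil; exact: is_derive0.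
rewrite !big_cons.
have di y : is_derive y (v 0 i *: delta_mx 0 i) f (v 0 i * partial i f y).
  by apply: is_deriveZv; apply: derivableP; exact: (pf i).1.
have -> : \sum_(j <- s) v 0 j * partial j f x =
    'D_(\sum_(j <- s) v 0 j *: delta_mx 0 j) f x by rewrite derive_val.
(* The coordinate direction is put second, because it is the one whose derivative is known to be
   continuous. *)
rewrite addrC (addrC (v 0 i * _)) -[v 0 i * _]derive_val.
apply: is_deriveDv => [y|y|]; [exact: (@ex_derive _ _ _ _ _ _ _ (IH y))|exact: (@ex_derive _ _ _ _ _ _ _ (di y))|].
have -> : 'D_(v 0 i *: delta_mx 0 i) f = (fun y => v 0 i * partial i f y).
  by apply/funext => y; rewrite derive_val.
move=> y; apply: (@continuousM _ _ (fun=> v 0 i) (partial i f)).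
  exact: cst_continuous.
exact: (@Ck_continuous 0 (partial i f) (pf i).2).
Qed.

Lemma Ck_cst k (a : R) : Ck k (fun _ : 'rV[R]_m => a).
Proof.
elim: k a => [|k IH] a; split; try exact: cst_continuous; move=> //= i.
split; first by move=> x; exact: (@derivable_cst R _ _ a x).
rewrite (_ : partial i _ = fun=> 0)//.
by apply/funext => x; rewrite /partial derive_cst.
Qed.

Lemma CkD k f g : Ck k f -> Ck k g -> Ck k (f \+ g).
Proof.
elim: k f g => [|k IH] f g [cf pf] [cg pg]; split.
- by move=> x; apply: (@continuousD _ _ _ f g); [exact: cf|exact: cg].
- by [].
- by move=> x; apply: (@continuousD _ _ _ f g); [exact: cf|exact: cg].
move=> i; have [df Hf] := pf i; have [dg Hg] := pg i.
split; first by move=> x; exact: derivableD.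
rewrite (_ : partial i _ = partial i f \+ partial i g); first exact: IH.
by apply/funext => x; rewrite /partial deriveD.
Qed.

Lemma CkM k f g : Ck k f -> Ck k g -> Ck k (f \* g).
Proof.
elim: k f g => [|k IH] f g Hf Hg; have [cf pf] := Hf; have [cg pg] := Hg; split.
- by move=> x; apply: (@continuousM _ _ f g); [exact: cf|exact: cg].
- by [].
- by move=> x; apply: (@continuousM _ _ f g); [exact: cf|exact: cg].
move=> i; have [df Hif] := pf i; have [dg Hig] := pg i.
split; first by move=> x; exact: derivableM.
rewrite (_ : partial i _ = (f \* partial i g) \+ (g \* partial i f)).
  by apply: CkD; apply: IH => //; exact: CkW.
by apply/funext => x; rewrite /partial deriveM.
Qed.

Lemma CkZ k (a : R) f : Ck k f -> Ck k (fun x => a * f x).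
Proof. by move=> Hf; exact: (CkM (Ck_cst k a) Hf). Qed.

Lemma Ck_sum k I (s : seq I) (F : I -> 'rV[R]_m -> R) :
  (forall i, Ck k (F i)) -> Ck k (fun x => \sum_(i <- s) F i x).
Proof.
move=> HF; elim: s => [|i s IH].
  by under eq_fun do rewrite big_nil; exact: Ck_cst.
by under eq_fun do rewrite big_cons; exact: CkD.
Qed.

Lemma Ck_prod k I (s : seq I) (F : I -> 'rV[R]_m -> R) :
  (forall i, Ck k (F i)) -> Ck k (fun x => \prod_(i <- s) F i x).
Proof.
move=> HF; elim: s => [|i s IH].
  by under eq_fun do rewrite big_nil; exact: Ck_cst.
by under eq_fun do rewrite big_cons; exact: CkM.
Qed.

Lemma Ck_coord k (i : 'I_m) : Ck k (fun x : 'rV[R]_m => x 0 i).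
Proof.
have D (j : 'I_m) x : is_derive x (delta_mx 0 j) (fun x : 'rV[R]_m => x 0 i) ((i == j)%:R : R).
  have -> : x = x + (0:R) *: delta_mx 0 j by rewrite scale0r addr0.
  apply/is_derive_line.
  have -> : (fun s : R => (x + s *: delta_mx 0 j) 0 i) =
      cst (x 0 i) + (i == j)%:R *: (id : R -> R).
    apply/funext => s; rewrite !mxE/= [in RHS]/GRing.add /=.
    by congr (_ + _); rewrite mulrC.
  have := is_deriveD (is_derive_cst (x 0 i) (0:R) (1:R))
    (is_deriveZ (i == j)%:R (is_derive_id (0:R) (1:R))).
  by rewrite add0r /GRing.scale/= mulr1.
case: k => [|k]; split=> //; try exact: coord_continuous.
move=> j.
split; first by move=> x; exact: (@ex_derive _ _ _ _ _ _ _ (D j x)).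
rewrite (_ : partial j _ = fun=> (i == j)%:R); first exact: Ck_cst.
by apply/funext => x; rewrite /partial (@derive_val _ _ _ _ _ _ _ (D j x)).
Qed.

Lemma Ck_affine k f (A L : 'rV[R]_m -> 'rV[R]_m) :
  continuous A -> (forall x v (h : R), A (x + h *: v) = A x + h *: L v) ->
  Ck k f -> Ck k (f \o A).
Proof.
move=> cA hA; elim: k f => [|k IH] f Hf.
  split=> // x; by apply: continuous_comp; [exact: cA|exact: (Ck_continuous Hf)].
have f1 : Ck 1 f by exact: Ck_le Hf.
split.
  move=> x; by apply: continuous_comp; [exact: cA|exact: (Ck_continuous Hf)].
move=> i.
have D x : is_derive x (delta_mx 0 i) (f \o A)
    (\sum_j L (delta_mx 0 i) 0 j * partial j f (A x)).
  have -> : x = x + (0:R) *: delta_mx 0 i by rewrite scale0r addr0.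
  apply/is_derive_line; rewrite /comp; under eq_fun do rewrite hA.
  by apply/is_derive_line; rewrite hA !scale0r !addr0; exact: Ck1_is_derive.
split; first by move=> x; exact: (@ex_derive _ _ _ _ _ _ _ (D x)).
rewrite (_ : partial i _ = fun x => \sum_j L (delta_mx 0 i) 0 j * partial j f (A x)).
  apply: Ck_sum => j; apply: CkZ; apply: (IH (partial j f)).
  by have [_ /(_ j)[]] := Hf.
by apply/funext => x; rewrite /partial (@derive_val _ _ _ _ _ _ _ (D x)).
Qed.

(** The sequence [h] lists a function of one variable with its successive derivatives; quantifying
    over [j] after [k] lets the chain rule feed the induction. *)
Lemma Ck_comp k (h : nat -> R -> R) g :
  (forall j (t : R), is_derive t (1:R) (h j) (h j.+1 t)) ->
  Ck k g -> forall j, Ck k (h j \o g).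
Proof.
move=> dh; elim: k => [|k IH] Hg j.
  split=> // x; apply: continuous_comp; first exact: (Ck_continuous Hg).
  by apply/differentiable_continuous/derivable1_diffP; exact: (@ex_derive _ _ _ _ _ _ _ (dh j _)).
have [cg pg] := Hg.
split.
  move=> x; apply: continuous_comp; first exact: cg.
  by apply/differentiable_continuous/derivable1_diffP; exact: (@ex_derive _ _ _ _ _ _ _ (dh j _)).
move=> i.
have D x : is_derive x (delta_mx 0 i) (h j \o g) (h j.+1 (g x) * partial i g x).
  have E : x = x + (0:R) *: delta_mx 0 i by rewrite scale0r addr0.
  rewrite [X in is_derive X]E; apply/is_derive_line.
  apply: is_derive1_comp; last first.
    by apply/is_derive_line; rewrite -E; apply: derivableP; exact: (pg i).1.
  rewrite -E; exact: dh.
split; first by move=> x; exact: (@ex_derive _ _ _ _ _ _ _ (D x)).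
rewrite (_ : partial i _ = (h j.+1 \o g) \* partial i g).
  by apply: CkM; [apply: IH; exact: CkW|exact: (pg i).2].
by apply/funext => x; rewrite /partial (@derive_val _ _ _ _ _ _ _ (D x)).
Qed.

End Ck_theory.

(** * Smooth bump functions *)

Section bump.
Context {R : realType}.

(** Differentiating $P(1/t)e^{-1/t}$ gives a function of the same form, so all derivatives of the
    flat function $e^{-1/t}$ are treated at once. *)
Definition expinv (P : {poly R}) (t : R) : R :=
  if 0 < t then P.[t^-1] * expR (- t^-1) else 0.

(** The quadratic bound makes the derivative at $0$ vanish. With $s=1/t$, each monomial is
    controlled by $e^s\ge s^{i+2}/(i+2)!$. *)
Lemma expinv_le (P : {poly R}) : exists2 C, 0 <= C &
  forall t, `|expinv P t| <= C * t ^+ 2.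
Proof.
exists (\sum_(i < size P) `|P`_i| * (i.+2)`!%:R).
  by apply: sumr_ge0 => i _; rewrite mulr_ge0.
move=> t; rewrite /expinv; case: ifPn => [t0|_]; last first.
  by rewrite normr0 mulr_ge0 ?sqr_ge0// sumr_ge0// => i _; rewrite mulr_ge0.
have s0 : 0 < t^-1 by rewrite invr_gt0.
rewrite -[t in _ * t ^+ 2]invrK; move: (t^-1) s0 => s s0 {t t0}.
rewrite normrM horner_coef (ger0_norm (expR_ge0 _)).
apply: (@le_trans _ _ ((\sum_(i < size P) `|P`_i| * s ^+ i) * expR (- s))).
  rewrite ler_wpM2r ?expR_ge0// (le_trans (ler_norm_sum _ _ _))//.
  by apply: ler_sum => i _; rewrite normrM normrX (gtr0_norm s0).
rewrite !mulr_suml; apply: ler_sum => i _; rewrite -!mulrA ler_wpM2l//.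
rewrite expRN -(@ler_pM2r _ (expR s))// ?expR_gt0// -mulrA mulVf ?gt_eqF ?expR_gt0//.
rewrite mulr1 mulrAC exprVn ler_pdivlMr ?exprn_gt0// -exprD addn2.
have := @expR_ge1Dxn R s i.+1 (ltW s0).
move=> H; rewrite mulrC -ler_pdivrMr ?ltr0n ?fact_gt0//.
by rewrite (le_trans _ H)// lerDr.
Qed.

Lemma is_derive_expinv (P : {poly R}) (t : R) :
  is_derive t (1:R) (expinv P) (expinv ('X^2 * (P - P^`())) t).
Proof.
have [t0|t0|->] := ltgtP t 0.
- rewrite [X in is_derive _ _ _ X]/expinv ltNge (ltW t0)/=.
  apply: (@near_eq_is_derive _ _ _ (cst 0)).
  near=> s; rewrite /expinv ifF//; apply/negbTE; rewrite -leNgt ltW//.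
  by near: s; exact: lt_nbhsl.
- rewrite [X in is_derive _ _ _ X]/expinv t0/=.
  pose g := fun s : R => P.[s^-1] * expR (- s^-1).
  apply: (@near_eq_is_derive _ _ _ g).
    near=> s; rewrite /expinv ifT//.
    by near: s; exact: lt_nbhsr.
  have dV : is_derive t (1:R) (fun s : R => s^-1) (- t ^- 2 *: (1:R)).
    by apply: is_deriveV; rewrite gt_eqF.
  have d1 := @is_derive1_comp R (horner P) _ t _ _ (is_derive_poly P t^-1) dV.
  have d2 := @is_derive1_comp R expR _ t _ _ (is_derive_expR _) (is_deriveN dV).
  have := is_deriveM d1 d2.
  have -> : (horner P \o (fun s : R => s^-1)) * (expR \o - (fun s : R => s^-1)) = g.
    by [].
  move=> [H1 H2]; split; first exact: H1. rewrite H2.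
  rewrite hornerM hornerXn hornerD hornerN exprVn /GRing.scale /= mulr1.
  by rewrite -[(- _) t]/(- t^-1); ring.
- rewrite [X in is_derive _ _ _ X]/expinv ltxx.
  have [C C0 hC] := expinv_le P.
  suff H : (fun h : R => h^-1 *: ((expinv P \o shift (0:R)) (h *: (1:R)) - expinv P 0))
      @ (0:R)^' --> (0:R).
    by split; [apply/cvg_ex; exists 0; exact: H|exact/cvg_lim].
  have -> : expinv P 0 = 0 by rewrite /expinv ltxx.
  have H0 : (fun h : R => C * `|h|) @ (0:R)^' --> (0:R).
    rewrite -[X in _ --> X](_ : C * `|0:R| = 0); last by rewrite normr0 mulr0.
    apply: cvgM; first exact: cvg_cst.
    by apply: cvg_norm; exact: nbhs_dnbhs.
  apply/cvgr0Pnorm_le => e e0; near=> h.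
  rewrite /= addr0 subr0 [h *: 1]mulr1 normrM normfV.
  have h0 : h != 0 by near: h; exact: nbhs_dnbhs_neq.
  rewrite mulrC ler_pdivrMr ?normr_gt0//.
  rewrite (le_trans (hC h))// -[h ^+ 2]ger0_norm ?sqr_ge0// normrX expr2 mulrA ler_wpM2r//.
  rewrite (le_trans (ler_norm _))//.
  by near: h; move: e e0; apply/cvgr0Pnorm_le.
Unshelve. all: by end_near. Qed.

Lemma exists_bump (m : nat) (r : R) : 0 < r ->
  exists eta : 'rV[R]_m -> R, [/\ smooth eta, forall x, 0 <= eta x,
    forall x, eta x != 0 -> forall i, `|x 0 i| < r & 0 < eta 0].
Proof.
move=> r0; pose h (j : nat) := expinv (iter j (fun P => 'X^2 * (P - P^`())) 1).
exists (fun x => \prod_(i < m) h 0%N (r ^+ 2 - x 0 i ^+ 2)); split.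
- move=> k; apply: Ck_prod => i.
  apply: (@Ck_comp _ _ k h (fun x => r ^+ 2 - x 0 i ^+ 2)).
    by move=> j t; exact: is_derive_expinv.
  apply: (@CkD _ _ _ (fun=> r ^+ 2)); first exact: Ck_cst.
  rewrite (_ : (fun=> _) = (fun x : 'rV[R]_m => -1 * (x 0 i * x 0 i))); last first.
    by apply/funext => x; rewrite mulN1r expr2.
  by apply: CkZ; apply: CkM; exact: Ck_coord.
- move=> x; apply: prodr_ge0 => i _; rewrite /h /expinv; case: ifP => // _.
  by rewrite hornerE mul1r expR_ge0.
- move=> x /prodf_neq0 => H i; have := H i isT; rewrite /h /expinv.
  case: ifP => [+ _|_]; last by rewrite eqxx.
  by rewrite subr_gt0 -real_normK ?num_real// ltr_pXn2r// nnegrE// ltW.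
- apply: prodr_gt0 => i _; rewrite mxE /h /expinv expr0n/= subr0 exprn_gt0//.
  by rewrite hornerE mul1r expR_gt0.
Qed.

End bump.

(** * Borel and Lebesgue measure on R^m *)

Section measurability.
Context {R : realType}.

Lemma continuous_measurable_mx (m k : nat) (g : 'rV[R]_m -> 'rV[R]_k) :
  continuous g -> measurable_fun setT g.
Proof.
move=> cg; apply: (@measurability _ _ _ 'rV[R]_k setT g (@open 'rV[R]_k)) => //.
move=> _ [U oU <-]; rewrite setTI; apply: open_measurable_mx.
by move/continuousP : cg; exact.
Qed.

Lemma continuous_measurable_real (m : nat) (g : 'rV[R]_m -> R) :
  continuous g -> measurable_fun setT g.
Proof.
move=> cg; apply: (measurability _ (RGenOpens.measurableE R)).
move=> _ [_ [a [b ->] <-]]; rewrite setTI; apply: open_measurable_mx.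
by move/continuousP : cg; apply; exact: interval_open.
Qed.

Lemma continuous_distP (T : topologicalType) (f : T -> R) (x : T) :
  {for x, continuous f} <->
  forall e, 0 < e -> \forall y \near x, `|f x - f y| <= e.
Proof. exact: cvgrPdist_le. Qed.

Lemma continuous_pair (S T U : topologicalType) (f : S -> T) (g : S -> U) (x : S) :
  {for x, continuous f} -> {for x, continuous g} ->
  {for x, continuous (fun y => (f y, g y))}.
Proof. by move=> cf cg; exact: cvg_pair. Qed.

Lemma continuous_mxP (T : topologicalType) (k : nat) (g : T -> 'rV[R]_k) :
  (forall i, continuous (fun x => g x 0 i)) -> continuous g.
Proof.
move=> H x; apply/cvgrPdist_le => e e0.
have : \forall y \near x, forall i, `|g x 0 i - g y 0 i| <= e.
  apply: filter_forall => i.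
  by have /cvgrPdist_le/(_ _ e0) := H i x.
apply: filterS => y Hy; rewrite [leLHS]mx_normrE; apply/bigmax_leP; split; first exact: ltW.
by move=> [i j] _ /=; rewrite !mxE !ord1.
Qed.

End measurability.

Section real_integrable.
Context d (T : measurableType d) (R : realType) (mu : {measure set T -> \bar R}).
Variables (D : set T) (mD : measurable D).
Implicit Types f g : T -> R.

Lemma integrableDR f g : mu.-integrable D (EFin \o f) ->
  mu.-integrable D (EFin \o g) -> mu.-integrable D (EFin \o (fun x => f x + g x)).
Proof. by move=> fi gi; apply: eq_integrable (integrableD mD fi gi). Qed.

Lemma integrableBR f g : mu.-integrable D (EFin \o f) ->
  mu.-integrable D (EFin \o g) -> mu.-integrable D (EFin \o (fun x => f x - g x)).
Proof. by move=> fi gi; apply: eq_integrable (integrableB mD fi gi). Qed.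

Lemma integrableZR (c : R) f : mu.-integrable D (EFin \o f) ->
  mu.-integrable D (EFin \o (fun x => c * f x)).
Proof. by move=> fi; apply: eq_integrable (integrableZl mD c fi). Qed.

Lemma integrable_sumR (I : Type) (s : seq I) (F : I -> T -> R) :
  (forall i, mu.-integrable D (EFin \o F i)) ->
  mu.-integrable D (EFin \o (fun x => \sum_(i <- s) F i x)).
Proof.
move=> Fi; elim: s => [|i s IH].
  apply: eq_integrable (integrable0 mu D) => // x _.
  by rewrite /= big_nil.
apply: eq_integrable (integrableDR (Fi i) IH) => // x _.
by rewrite /= big_cons.
Qed.

Lemma Rintegral_sum (I : Type) (s : seq I) (F : I -> T -> R) :
  (forall i, mu.-integrable D (EFin \o F i)) ->
  \int[mu]_(x in D) (\sum_(i <- s) F i x) = \sum_(i <- s) \int[mu]_(x in D) F i x.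
Proof.
move=> Fi; elim: s => [|i s IH].
  rewrite big_nil; under eq_Rintegral do rewrite big_nil.
  by rewrite /Rintegral integral0.
rewrite big_cons -IH -RintegralD//; last exact: integrable_sumR.
by apply: eq_Rintegral => x _; rewrite big_cons.
Qed.

Lemma Rintegral_linear3 (a b c : R) f g h : mu.-integrable D (EFin \o f) ->
  mu.-integrable D (EFin \o g) -> mu.-integrable D (EFin \o h) ->
  \int[mu]_(x in D) (a * f x + b * g x - c * h x) =
  a * \int[mu]_(x in D) f x + b * \int[mu]_(x in D) g x - c * \int[mu]_(x in D) h x.
Proof.
move=> fi gi hi; have [af bg] := (integrableZR a fi, integrableZR b gi).
rewrite RintegralB//; [|exact: integrableDR|exact: integrableZR].
by rewrite RintegralD// !RintegralZl.
Qed.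

End real_integrable.

(** * Invariance of Lebesgue measure under translations and shears *)

Section translation_invariance.
Context {R : realType}.
Local Notation leb := (@lebesgue_measure R).
Local Open Scope ereal_scope.

Lemma integral_lebesgue_rVS (m : nat) (f : 'rV[R]_m.+1 -> \bar R) :
  measurable_fun setT f -> (forall x, 0 <= f x) ->
  \int[lebesgue_rV m.+1]_x f x =
  \int[leb]_x \int[lebesgue_rV m]_v f (cons_row (x, v)).
Proof.
move=> mf f0.
have mc : measurable_fun setT (f \o @cons_row R m).
  by apply: measurableT_comp => //; exact: measurable_cons_row.
rewrite -(fubini_tonelli1 _ mc) => [|x]; last exact: f0.
by rewrite -[RHS](@ge0_integral_pushforward _ _ _ _ _ _ (@measurable_cons_row R m)
  (leb \x lebesgue_rV m) setT).
Qed.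

Lemma integral_leb_shift (f : R -> \bar R) (a : R) :
  measurable_fun setT f -> (forall x, 0 <= f x) ->
  \int[leb]_x f (x + a)%R = \int[leb]_x f x.
Proof.
move=> mf f0.
have ms : measurable_fun setT (fun x : measurableTypeR R => (x + a)%R : measurableTypeR R).
  by apply: measurable_funD.
have H (A : set (measurableTypeR R)) : measurable A ->
    pushforward leb (fun x : measurableTypeR R => (x + a)%R : measurableTypeR R) A = leb A.
  move=> mA; apply/esym.
  apply: (@lebesgue_measure_unique R (pushforward leb (fun x : measurableTypeR R => (x + a)%R : measurableTypeR R))) => //= _ [[u v]] _ <-.
  rewrite /pushforward.
  have -> : (fun x : measurableTypeR R => (x + a)%R : measurableTypeR R) @^-1` `]u, v]%classic =
      `](u - a)%R, (v - a)%R]%classic.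
    apply/seteqP; split=> x /=; rewrite !in_itv/= ltrBlDr lerBrDr//.
  by rewrite !lebesgue_measure_itv/= !lte_fin ltrD2r -!EFinD opprB addrACA addrC !addrA; congr (if _ then _%:E else _); lra.
transitivity (\int[pushforward leb (fun x : measurableTypeR R => (x + a)%R : measurableTypeR R)]_x f x).
  rewrite ge0_integral_pushforward//.
by apply: eq_measure_integral => A mA _; exact: H.
Qed.

End translation_invariance.

Section shear_invariance.
Context {R : realType}.
Local Notation leb := (@lebesgue_measure R).
Local Open Scope ereal_scope.

Let measurable_cons_row1 m (f : 'rV[R]_m.+1 -> \bar R) x : measurable_fun setT f ->
  measurable_fun setT (fun v => f (cons_row (x, v))).
Proof.
move=> mf.
apply: (measurableT_comp mf).
apply: (measurableT_comp (@measurable_cons_row R m)).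
by apply: measurable_fun_pair.
Qed.

Let measurable_cons_row2 m (f : 'rV[R]_m.+1 -> \bar R) v : measurable_fun setT f ->
  measurable_fun setT (fun x => f (cons_row (x, v))).
Proof.
move=> mf.
apply: (measurableT_comp mf).
apply: (measurableT_comp (@measurable_cons_row R m)).
by apply: measurable_fun_pair.
Qed.

Let measurable_shift m (f : 'rV[R]_m -> \bar R) a : measurable_fun setT f ->
  measurable_fun setT (fun v : 'rV[R]_m => f (v + a)%R).
Proof.
move=> mf; apply: (measurableT_comp mf); apply: continuous_measurable_mx.
by move=> x; apply: (@continuousD _ _ _ id (cst a)); [exact: cvg_id|exact: cst_continuous].
Qed.

Lemma measurable_integral_cons_row m (f : 'rV[R]_m.+1 -> \bar R) :
  measurable_fun setT f -> (forall x, 0 <= f x) ->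
  measurable_fun setT (fun x : R => \int[lebesgue_rV m]_v f (cons_row (x, v))).
Proof.
move=> mf f0.
apply: (@measurable_fun_fubini_tonelli_F _ _ _ _ R (lebesgue_rV m)
  (f \o @cons_row R m)) => [|x]; last exact: f0.
by apply: measurableT_comp => //; exact: measurable_cons_row.
Qed.

Lemma integral_rV_shift (m : nat) (a : 'rV[R]_m) (f : 'rV[R]_m -> \bar R) :
  measurable_fun setT f -> (forall x, 0 <= f x) ->
  \int[lebesgue_rV m]_(v in [set: 'rV[R]_m]) f (v + a)%R = \int[lebesgue_rV m]_v f v.
Proof.
elim: m a f => [|m IH] a f mf f0.
  by apply: eq_integral => v _; congr f; apply/rowP => -[].
rewrite [LHS]integral_lebesgue_rVS//; last exact: (measurable_shift a mf).
rewrite [RHS](integral_lebesgue_rVS mf f0).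
rewrite -[RHS](@integral_leb_shift _ _ (a 0%R 0%R)); last 2 first.
- exact: measurable_integral_cons_row.
- by move=> x; exact: integral_ge0.
apply: eq_integral => x _.
rewrite -[RHS](IH (uncons_row a).2) => [|//|//]; last exact: measurable_cons_row1.
apply: eq_integral => v _; congr f; apply/rowP => j; rewrite !mxE /=.
by case: unliftP => [k ->|->]; rewrite ?mxE.
Qed.

Lemma sum_cons_row m (b : 'rV[R]_m.+1) (x : R) (v : 'rV[R]_m) :
  (\sum_j b 0 j * cons_row (x, v) 0 j =
   b 0 0 * x + \sum_j (uncons_row b).2 0 j * v 0 j)%R.
Proof.
rewrite big_ord_recl /cons_row mxE unlift_none /=; congr (_ + _)%R.
by apply: eq_bigr => j _; rewrite !mxE liftK.
Qed.

(** Along the coordinate [l] the map is a translation by an amount that does not depend on that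
    coordinate, since [b 0 l = 0]; Tonelli reduces the claim to translations. Right translations of
    the Heisenberg group have this form. *)
Lemma integral_rV_shear (m : nat) (l : 'I_m) (a b : 'rV[R]_m)
    (f : 'rV[R]_m -> \bar R) : b 0%R l = 0%R ->
  measurable_fun setT f -> (forall x, 0 <= f x) ->
  \int[lebesgue_rV m]_(v in [set: 'rV[R]_m]) f (v + a + (\sum_j b 0 j * v 0 j) *: delta_mx 0 l)%R =
  \int[lebesgue_rV m]_v f v.
Proof.
elim: m l a b f => [[]//|m IH] l a b f bl mf f0.
have cT k (l1 : 'I_k) (a1 b1 : 'rV[R]_k) : continuous
   (fun v : 'rV[R]_k => v + a1 + (\sum_j b1 0 j * v 0 j) *: delta_mx 0 l1)%R.
  move=> v; apply: (@continuousD R _ _ (fun v : 'rV[R]_k => v + a1)%R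
    (fun v : 'rV[R]_k => (\sum_j b1 0 j * v 0 j) *: delta_mx 0 l1)%R).
    by apply: (@continuousD _ _ _ id (cst a1)); [exact: cvg_id|exact: cst_continuous].
  have cs : continuous (fun v : 'rV[R]_k => \sum_j b1 0 j * v 0 j)%R.
    apply: (@Ck_continuous _ _ 0).
    by apply: Ck_sum => j; apply: CkZ; exact: Ck_coord.
  exact: (@cvgZr_tmp R _ _ (nbhs v) _ (fun v : 'rV[R]_k => \sum_j b1 0 j * v 0 j)%R _ (delta_mx 0 l1)%R (cs v)).
have mT k (l1 : 'I_k) (a1 b1 : 'rV[R]_k) f' : measurable_fun setT f' ->
  measurable_fun setT (fun v : 'rV[R]_k =>
    f' (v + a1 + (\sum_j b1 0 j * v 0 j) *: delta_mx 0 l1)%R : \bar R).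
  move=> mf'; apply: (measurableT_comp mf'); apply: continuous_measurable_mx.
  exact: cT.
rewrite [LHS]integral_lebesgue_rVS//; last exact: (mT _ l a b _ mf).
rewrite [RHS](integral_lebesgue_rVS mf f0).
case: (unliftP 0%R l) bl => [l' ->|->] bl.
  rewrite -[RHS](@integral_leb_shift _ _ (a 0%R 0%R)); last 2 first.
  - exact: measurable_integral_cons_row.
  - by move=> x; exact: integral_ge0.
  apply: eq_integral => x _.
  (* For fixed first coordinate [x], its share [b 0 0 * x] of the shear is a mere translation of the
     other coordinates. *)
  rewrite -[RHS](IH l' ((uncons_row a).2 + (b 0 0 * x) *: delta_mx 0 l')%R
     (uncons_row b).2) => [||//|//]; last 2 first.
  - by rewrite mxE.
  - exact: measurable_cons_row1.
  apply: eq_integral => v _; congr f; apply/rowP => j.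
  rewrite sum_cons_row !mxE /=.
  case: unliftP => [k ->|->] /=; last by rewrite mulr0 addr0.
  rewrite !mxE (inj_eq lift_inj). by ring.
(* The sheared coordinate is the first one: the order of integration is exchanged so that it is
   integrated first, the amount of shear being fixed. *)
pose F (z : R * 'rV[R]_m) := f (cons_row z + a + (\sum_j b 0 j * cons_row z 0 j) *: delta_mx 0 0)%R.
have mF : measurable_fun setT F.
  apply: (measurableT_comp (mT _ _ _ _ _ mf)); exact: measurable_cons_row.
rewrite (@fubini_tonelli _ _ _ _ _ leb (lebesgue_rV m) F)//; last by move=> z; exact: f0.
rewrite (@fubini_tonelli _ _ _ _ _ leb (lebesgue_rV m) (f \o @cons_row R m))//; last 2 first.
  by apply: measurableT_comp => //; exact: measurable_cons_row.
  by move=> z; exact: f0.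
rewrite -[RHS](integral_rV_shift (uncons_row a).2); last 2 first.
- apply: (@measurable_fun_fubini_tonelli_G _ _ _ _ R leb
     (f \o @cons_row R m)) => [|x]; last exact: f0.
  by apply: measurableT_comp => //; exact: measurable_cons_row.
- by move=> v; apply: integral_ge0 => x _; exact: f0.
apply: eq_integral => v _.
rewrite -[RHS](@integral_leb_shift _ _ (a 0 0 + \sum_j (uncons_row b).2 0 j * v 0 j)%R) => [||x]; last 2 first.
- exact: (measurable_cons_row2 _ mf).
- exact: f0.
apply: eq_integral => x _; rewrite /F; congr f; apply/rowP => j.
rewrite sum_cons_row bl mul0r add0r !mxE /=.
case: unliftP => [k ->|->] /=; first by rewrite mulr0 addr0 !mxE.
by rewrite mulr1 addrA.
Qed.

Definition box (m : nat) (r : R) : set 'rV[R]_m :=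
  [set v | forall i, `|v 0 i| <= r]%R.

Lemma measurable_box (m : nat) (r : R) : measurable (@box m r).
Proof.
have -> : @box m r =
   \bigcap_(i : 'I_m) ((fun v : 'rV[R]_m => v 0%R i) @^-1` `[(- r)%R, r]%classic).
  apply/seteqP; split=> v /= H i.
    by move=> _; rewrite /= in_itv/= -ler_norml; exact: H.
  by have := H i I; rewrite /= in_itv/= -ler_norml.
apply: fin_bigcap_measurable; first exact: finite_finset.
by move=> i _; rewrite -[X in measurable X]setTI; exact: measurable_coord.
Qed.

Lemma lebesgue_rV_box (m : nat) (r : R) : (0 <= r)%R ->
  lebesgue_rV m (@box m r) = ((r *+ 2) ^+ m)%:E.
Proof.
move=> r0; elim: m => [|m IH].
  by rewrite expr0 /= diracE mem_set// => -[].
rewrite /= /lebesgue_cons /pushforward.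
have -> : @cons_row R m @^-1` (@box m.+1 r) = `[(- r)%R, r]%classic `*` @box m r.
  apply/seteqP; split=> -[x v] /=.
    move=> H; split=> [|i].
      by have := H ord0; rewrite mxE unlift_none /= in_itv/= -ler_norml.
    by have := H (lift ord0 i); rewrite mxE liftK.
  rewrite in_itv/= -ler_norml => -[Hx Hv] i; rewrite mxE.
  by case: unliftP => [j _|_] /=.
rewrite product_measure1E//; last exact: measurable_box.
rewrite IH exprS EFinM; congr (_ * _).
apply: (etrans (lebesgue_measure_itv _)); rewrite /= lte_fin.
have [r00|r00] := eqVneq r 0%R; first by rewrite r00 oppr0 ltxx mul0rn.
by rewrite gtrN ?lt_neqAle ?r0 1?eq_sym ?r00// -EFinD opprK -mulr2n.
Qed.

End shear_invariance.

(** * The Heisenberg group *)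

Section heisenberg_group.
Context {R : realType} {n : nat}.
Local Notation H := (heis R n).
Implicit Types (x y z : H) (Z W : 'rV[R]_(n + n)) (i : 'I_(n + n)).

Definition hc i : 'I_(n + n + 1) := lshift 1 i.

Definition hcoef i x : R :=
  match fintype.split i with
  | inl j => - (x 0 (yc j) / 2)
  | inr j => x 0 (xc j) / 2
  end.

Lemma hXE i f x : hX i f x = partial (hc i) f x + hcoef i x * partial tc f x.
Proof.
rewrite /hX /hcoef /hc; case: splitP => j ij.
  by rewrite mulNr; congr (partial _ f x - _); apply/val_inj; rewrite /= ij.
by congr (partial _ f x + _); apply/val_inj; rewrite /= ij.
Qed.

Lemma hcoefD i x y : hcoef i (x + y) = hcoef i x + hcoef i y.
Proof. by rewrite /hcoef; case: fintype.split => j; rewrite !mxE; lra. Qed.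

Lemma hcoefZ i (a : R) x : hcoef i (a *: x) = a * hcoef i x.
Proof. by rewrite /hcoef; case: fintype.split => j; rewrite !mxE; lra. Qed.

Lemma hcoef_tc i : hcoef i (delta_mx 0 tc) = 0.
Proof.
by rewrite /hcoef; case: fintype.split => j;
  rewrite !mxE eq_lrshift ?andbF ?mul0r ?oppr0.
Qed.

Lemma Ck_hcoef k i : Ck k (hcoef i).
Proof.
rewrite /hcoef; case: fintype.split => j.
  rewrite (_ : (fun x : H => _) = (fun x : H => - 2^-1 * x 0 (yc j))).
    by apply: CkZ; exact: Ck_coord.
  by apply/funext => x; lra.
rewrite (_ : (fun x : H => _) = (fun x : H => 2^-1 * x 0 (xc j))).
  by apply: CkZ; exact: Ck_coord.
by apply/funext => x; lra.
Qed.

Lemma continuous_hcoef i : continuous (hcoef i).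
Proof. exact: (Ck_continuous (Ck_hcoef 0 i)). Qed.

(** Half the standard symplectic form of the horizontal coordinates. *)
Definition hform x y : R := \sum_i hcoef i x * y 0 (hc i).

Lemma hformDl x y z : hform (x + y) z = hform x z + hform y z.
Proof. by rewrite -big_split; apply: eq_bigr => i _; rewrite hcoefD mulrDl. Qed.

Lemma hformZl a x z : hform (a *: x) z = a * hform x z.
Proof. by rewrite mulr_sumr; apply: eq_bigr => i _; rewrite hcoefZ mulrA. Qed.

Lemma hformDr x y z : hform z (x + y) = hform z x + hform z y.
Proof. by rewrite -big_split; apply: eq_bigr => i _; rewrite mxE mulrDr. Qed.

Lemma hformZr a x z : hform z (a *: x) = a * hform z x.
Proof. by rewrite mulr_sumr; apply: eq_bigr => i _; rewrite mxE mulrCA. Qed.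

Lemma hformNr x z : hform z (- x) = - hform z x.
Proof. by rewrite -scaleN1r hformZr mulN1r. Qed.

Lemma hform_tl y : hform (delta_mx 0 tc) y = 0.
Proof. by apply: big1 => i _; rewrite hcoef_tc mul0r. Qed.

Lemma hform_tr x : hform x (delta_mx 0 tc) = 0.
Proof. by apply: big1 => i _; rewrite !mxE eq_lrshift andbF mulr0. Qed.

Lemma hform_diag x : hform x x = 0.
Proof.
rewrite /hform big_split_ord /= -big_split /=; apply: big1 => j _.
rewrite /hcoef -[lshift n j]/(unsplit (inl j)) -[rshift n j]/(unsplit (inr j)).
by rewrite !unsplitK /= /hc -/(xc j) -/(yc j); lra.
Qed.

Lemma hform_sym x y : hform x y = - hform y x.
Proof.
have := hform_diag (x + y); rewrite hformDl !hformDr !hform_diag; lra.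
Qed.

(** The Heisenberg group law in exponential coordinates. The inverse of [x] is [- x], and the fields
    $X_i$ are left-invariant. *)
Definition hmul x y : H := x + y + hform x y *: delta_mx 0 tc.

Lemma hmulA x y z : hmul x (hmul y z) = hmul (hmul x y) z.
Proof.
rewrite /hmul !hformDl !hformDr !hformZl !hformZr hform_tl hform_tr.
by apply/rowP => i; rewrite !mxE; ring.
Qed.

Lemma hmulK x : cancel (hmul^~ x) (hmul^~ (- x)).
Proof.
move=> z; rewrite /hmul !hformDl hformZl hform_tl !hformNr hform_diag.
by apply/rowP => i; rewrite !mxE; ring.
Qed.

Lemma hmulKV x : cancel (hmul^~ (- x)) (hmul^~ x).
Proof. by move=> z; rewrite -{2}[x]opprK hmulK. Qed.

Lemma hmul0x x : hmul 0 x = x.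
Proof. by rewrite /hmul -(scale0r x) hformZl mul0r !scale0r add0r addr0. Qed.

Lemma hmulx0 x : hmul x 0 = x.
Proof. by rewrite /hmul -(scale0r x) hformZr mul0r !scale0r !addr0. Qed.

Definition hemb Z : H := row_mx Z 0.

Lemma hembE Z i : hemb Z 0 (hc i) = Z 0 i. Proof. exact: row_mxEl. Qed.
Lemma hemb_tc Z : hemb Z 0 tc = 0.
Proof. by rewrite /hemb /tc row_mxEr mxE. Qed.

Lemma hembZ a Z : hemb (a *: Z) = a *: hemb Z.
Proof. by rewrite /hemb scale_row_mx scaler0. Qed.

Lemma rowHP x y : (forall i, x 0 (hc i) = y 0 (hc i)) -> x 0 tc = y 0 tc -> x = y.
Proof.
move=> Hh Ht; apply/rowP => i.
case: (split_ordP i) => j ->; first exact: Hh.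
by rewrite ord1.
Qed.

Lemma big_heis (F : 'I_(n + n + 1) -> R) :
  \sum_j F j = \sum_i F (hc i) + F tc.
Proof. by rewrite big_split_ord /= big_ord1. Qed.

(* The velocity of the left-invariant field [\sum_i Z_i X_i] at [x]. *)
Definition hvel x Z : H := hemb Z + hform x (hemb Z) *: delta_mx 0 tc.

Definition hexp x Z : H := hmul x (hemb Z).

Lemma hexpE x Z : hexp x Z = x + hvel x Z.
Proof. by rewrite /hexp /hmul /hvel addrA. Qed.

Lemma hvelZ x a Z : hvel x (a *: Z) = a *: hvel x Z.
Proof. by rewrite /hvel hembZ hformZr scalerDr scalerA. Qed.

Lemma hexp_line x s Z : hexp x (s *: Z) = x + s *: hvel x Z.
Proof. by rewrite hexpE hvelZ. Qed.

(** The velocity is constant along an integral curve of a constant-coefficient horizontal field, so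
    these curves are straight lines. *)
Lemma hvel_line x s Z : hvel (x + s *: hvel x Z) Z = hvel x Z.
Proof.
rewrite /hvel hformDl hformZl hformDl hformZl hform_tl hform_diag.
by rewrite mulr0 addr0 mulr0 addr0.
Qed.

Lemma hvel_tc x Z : hvel x Z 0 tc = \sum_i Z 0 i * hcoef i x.
Proof.
rewrite /hvel mxE hemb_tc add0r mxE mxE !eqxx mulr1.
by apply: eq_bigr => i _; rewrite hembE mulrC.
Qed.

Lemma hvel_hc x Z i : hvel x Z 0 (hc i) = Z 0 i.
Proof. by rewrite /hvel mxE hembE mxE mxE eq_lrshift andbF mulr0 addr0. Qed.

Lemma is_derive_hvel f x Z : Ck 1 f ->
  is_derive x (hvel x Z) f (\sum_i Z 0 i * hX i f x).
Proof.
move=> f1; have := Ck1_is_derive x (hvel x Z) f1.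
case=> D E; split; rewrite ?E//; rewrite big_heis hvel_tc mulr_suml -big_split /=.
by apply: eq_bigr => i _; rewrite hvel_hc hXE mulrDr mulrA.
Qed.

Lemma is_derive_hexp f x Z (s : R) : Ck 1 f ->
  is_derive s (1:R) (fun s : R => f (hexp x (s *: Z)))
    (\sum_i Z 0 i * hX i f (hexp x (s *: Z))).
Proof.
move=> f1; under eq_fun do rewrite hexp_line.
apply/is_derive_line; rewrite hexp_line -{2}(hvel_line x s Z).
exact: is_derive_hvel.
Qed.

End heisenberg_group.

(** * The horizontal norm and its scalar product *)

Section hnorm_theory.
Context {R : realType} {n : nat}.
Implicit Types (a b : 'rV[R]_(n + n)).

Definition hdot a b : R := \sum_i a 0 i * b 0 i.

Lemma hnorm_ge0 a : 0 <= hnorm a. Proof. exact: sqrtr_ge0. Qed.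

Lemma hnorm_sqr a : hnorm a ^+ 2 = hdot a a.
Proof.
rewrite sqr_sqrtr; first by apply: eq_bigr => i _; rewrite expr2.
by apply: sumr_ge0 => i _; rewrite sqr_ge0.
Qed.

Lemma hdot_ge0 a : 0 <= hdot a a. Proof. by rewrite -hnorm_sqr sqr_ge0. Qed.

Lemma hdot_sqr_le a b : hdot a b ^+ 2 <= hdot a a * hdot b b.
Proof.
have E c d : \sum_i (c * a 0 i - d * b 0 i) ^+ 2 =
    c ^+ 2 * hdot a a - 2 * c * d * hdot a b + d ^+ 2 * hdot b b.
  rewrite !mulr_sumr -sumrB -big_split /=; apply: eq_bigr => i _; ring.
have P c d : 0 <= c ^+ 2 * hdot a a - 2 * c * d * hdot a b + d ^+ 2 * hdot b b.
  by rewrite -E; apply: sumr_ge0 => i _; rewrite sqr_ge0.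
have := P (hdot b b) (hdot a b); have a0 := hdot_ge0 a.
have [b0|b0] := eqVneq (hdot b b) 0.
  (* With $S=a\cdot b$ and $b\cdot b=0$, this choice makes the quadratic form equal to $-S^2$, which
     forces $S=0$. *)
  rewrite b0 => _; have := P (hdot a b) ((hdot a a + 1) / 2).
  rewrite b0; move: (hdot a b) (hdot a a) => S A; lra.
have bp : 0 < hdot b b by rewrite lt_neqAle eq_sym b0 hdot_ge0.
move=> HH; rewrite -subr_ge0 -(pmulr_rge0 _ bp); move: HH.
by congr (0 <= _); ring.
Qed.

Lemma hdot_le a b : hdot a b <= hnorm a * hnorm b.
Proof.
rewrite -sqrtrM; last by apply: sumr_ge0 => i _; rewrite sqr_ge0.
rewrite (le_trans (ler_norm _))// -sqrtr_sqr ler_wsqrtr//.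
have := hdot_sqr_le a b; rewrite -!hnorm_sqr !sqr_sqrtr//;
  by apply: sumr_ge0 => i _; rewrite sqr_ge0.
Qed.

Lemma hnorm_leP a (c : R) : 0 <= c ->
  (forall b, hdot b a <= c * hnorm b) -> hnorm a <= c.
Proof.
move=> c0 /(_ a); rewrite -hnorm_sqr expr2.
have [->//|a0] := eqVneq (hnorm a) 0.
by rewrite ler_pM2r// lt_neqAle eq_sym a0 hnorm_ge0.
Qed.

Lemma hnormZ (c : R) a : hnorm (c *: a) = `|c| * hnorm a.
Proof.
rewrite /hnorm -sqrtr_sqr -sqrtrM ?sqr_ge0//; congr Num.sqrt.
by rewrite mulr_sumr; apply: eq_bigr => i _; rewrite mxE exprMn.
Qed.

Lemma hnorm0 : hnorm (0 : 'rV[R]_(n + n)) = 0.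
Proof. by rewrite -(scale0r 0) hnormZ normr0 mul0r. Qed.

Lemma hnormD a b : hnorm (a + b) <= hnorm a + hnorm b.
Proof.
apply: hnorm_leP; first by rewrite addr_ge0 ?hnorm_ge0.
move=> c; rewrite mulrDl.
have -> : hdot c (a + b) = hdot c a + hdot c b.
  by rewrite -big_split; apply: eq_bigr => i _; rewrite mxE mulrDr.
by apply: lerD; rewrite mulrC; exact: hdot_le.
Qed.

Lemma hnorm_coord a i : `|a 0 i| <= hnorm a.
Proof.
rewrite -sqrtr_sqr ler_wsqrtr// (bigD1 i)//= lerDl.
by apply: sumr_ge0 => j _; rewrite sqr_ge0.
Qed.

Lemma hnorm_delta i : hnorm (delta_mx 0 i : 'rV[R]_(n + n)) = 1.
Proof.
rewrite /hnorm (bigD1 i)//= mxE !eqxx expr1n big1 ?addr0 ?sqrtr1// => j ji.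
by rewrite mxE (negbTE ji) andbF expr0n.
Qed.

Lemma continuous_hnorm : continuous (@hnorm R n).
Proof.
move=> x; apply: (@continuous_comp _ _ _ (fun v : 'rV[R]_(n+n) => \sum_i v 0 i ^+ 2)).
  apply: (@Ck_continuous _ _ 0); apply: Ck_sum => i.
  by rewrite /exprz; under eq_fun do rewrite expr2; apply: CkM; exact: Ck_coord.
exact: sqrt_continuous.
Qed.

End hnorm_theory.

(** * Boxes and compactly supported functions *)

Section box_support.
Context {R : realType} {m : nat}.
Local Notation T := 'rV[R]_m.
Local Notation lam := (@lebesgue_rV R m).

Definition boxsupp (r : R) (f : T -> R) : Prop := forall x, f x != 0 -> box r x.

Lemma box_compact (r : R) : compact (@box R m r).
Proof.
have -> : @box R m r = [set v : T | forall i, `[- r, r]%classic (v ord0 i)].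
  by apply/seteqP; split=> v Hv i; have := Hv i; rewrite /= in_itv/= -ler_norml.
by apply: (@rV_compact R m (fun=> `[- r, r]%classic)) => i; exact: segment_compact.
Qed.

Lemma box_norm (r : R) (x : T) : 0 <= r -> box r x <-> `|x| <= r.
Proof.
move=> r0; rewrite [`|x|]mx_normrE; split=> [H|/bigmax_leP[_ H] i].
  by apply/bigmax_leP; split=> // -[i j] _ /=; rewrite ord1.
exact: (H (ord0, i) isT).
Qed.

Lemma box_le (r s : R) : r <= s -> @box R m r `<=` box s.
Proof. by move=> rs x Hx i; exact: le_trans (Hx i) rs. Qed.

Lemma box_closed (r : R) : closed (@box R m r).
Proof. by apply: compact_closed; [exact: norm_hausdorff|exact: box_compact]. Qed.

Lemma nbhs_box (x : T) (r : R) : 0 < r -> \forall y \near x, box r (y - x).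
Proof.
move=> r0; near=> y; apply/box_norm; first exact: ltW.
rewrite distrC; near: y; exact: cvgr_dist_le.
Unshelve. all: by end_near. Qed.

Lemma box_normr (x : T) : box `|x| x. Proof. exact/box_norm. Qed.

Lemma continuous_box_bounded (f : T -> R) (r : R) : continuous f ->
  exists2 C, 0 <= C & forall x, box r x -> `|f x| <= C.
Proof.
move=> cf.
have : compact [set f x | x in box r].
  apply: continuous_compact; last exact: box_compact.
  exact: continuous_subspaceT.
move=> /compact_bounded[M [Mr HM]].
exists (Num.max 0 (M + 1)); first by rewrite le_max lexx.
move=> x bx; rewrite le_max; apply/orP; right.
by apply: (HM (M + 1)) => //; [rewrite ltrDl|exists x].
Qed.

Lemma boxsupp_bounded (f : T -> R) (r : R) : continuous f -> boxsupp r f ->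
  exists2 C, 0 <= C & forall x, `|f x| <= C.
Proof.
move=> cf bf; have [C C0 HC] := continuous_box_bounded r cf.
exists C => // x; have [->|fx] := eqVneq (f x) 0; first by rewrite normr0.
exact/HC/bf.
Qed.

Lemma compact_support_funP (f : T -> R) :
  compact_support_fun f <-> exists r, boxsupp r f.
Proof.
split=> [/compact_bounded[M [_ HM]]|[r br]].
  exists (`|M + 1|) => x fx; apply/box_norm => //.
  apply: le_trans (ler_norm _); apply: (HM (M + 1)); first by rewrite ltrDl.
  exact: subset_closure.
apply: (@subclosed_compact _ _ (box r)); first exact: closed_closure.
  exact: box_compact.
by rewrite closureE => x; apply; split=> //; exact: box_closed.
Qed.

Lemma boxsupp_partial (f : T -> R) (r : R) i : boxsupp r f -> boxsupp r (partial i f).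
Proof.
move=> bf x; apply: contra_neqP => nx.
rewrite /partial (@near_eq_derive _ _ _ _ (cst 0)) ?derive_cst//.
have : nbhs x (~` box r) by apply: open_nbhs_nbhs; split=> //; exact/closed_openC/box_closed.
by apply: filterS => y ny; apply: contra_notP ny => /eqP /bf.
Qed.

Lemma boxsuppMr (f g : T -> R) r : boxsupp r f -> boxsupp r (fun x => f x * g x).
Proof. by move=> bf x; rewrite mulf_eq0 negb_or => /andP[/bf]. Qed.

Lemma boxsuppMl (f g : T -> R) r : boxsupp r f -> boxsupp r (fun x => g x * f x).
Proof. by move=> bf x; rewrite mulf_eq0 negb_or => /andP[_ /bf]. Qed.

Lemma integrable_boxsupp (f : T -> R) (r C : R) : measurable_fun setT f ->
  boxsupp r f -> (forall x, `|f x| <= C) -> lam.-integrable setT (EFin \o f).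
Proof.
move=> mf bf' HC.
have [s s0 bf] : exists2 s, 0 <= s & boxsupp s f.
  exists (Num.max 0 r); first by rewrite le_max lexx.
  by move=> x /bf'; apply: box_le; rewrite le_max lexx orbT.
apply: (@le_integrable _ _ _ lam _ _ _ (fun x => (C%:E * (\1_(box s) x)%:E)%E)) => //.
- exact/measurable_EFinP.
- move=> x _ /=; have [->|fx] := eqVneq (f x) 0; first by rewrite normr0 lee_fin.
  rewrite indicE mem_set; last exact: bf.
  by rewrite mulr1 lee_fin (le_trans (HC x)) ?ler_norm.
- apply: integrableZl => //.
  apply/integrableP; split.
    apply/measurable_EFinP; apply: measurable_indic; exact: measurable_box.
  under eq_integral do rewrite gee0_abs ?lee_fin//.
  rewrite integral_indic//; last exact: measurable_box.
  rewrite setIT; have : (lebesgue_rV m (@box R m s) < +oo)%E; last exact.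
  by rewrite lebesgue_rV_box// ltry.
Qed.

Lemma integrable_cont_boxsupp (f : T -> R) (r : R) : continuous f ->
  boxsupp r f -> lam.-integrable setT (EFin \o f).
Proof.
move=> cf bf; have [C _ HC] := boxsupp_bounded cf bf.
by apply: integrable_boxsupp bf HC; exact: continuous_measurable_real.
Qed.

Lemma lebesgue_box_lty (r : R) : (lam (@box R m r) < +oo)%E.
Proof.
have H : (lebesgue_rV m (@box R m (Num.max 0 r)%R) < +oo)%E.
  by rewrite lebesgue_rV_box ?ltry// le_max lexx.
apply: le_lt_trans H; apply: le_measure; rewrite ?inE; try exact: measurable_box.
by apply: box_le; rewrite le_max lexx orbT.
Qed.

Lemma integrable_indic_box (r : R) : lam.-integrable setT (EFin \o \1_(@box R m r)).
Proof.
apply: (@integrable_boxsupp _ r 1).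
- by apply: measurable_indic; exact: measurable_box.
- by move=> x; rewrite indicE; case: (boolP (x \in _)) => [/set_mem//|]; rewrite eqxx.
- by move=> x; rewrite indicE; case: (_ \in _); rewrite ?normr1 ?normr0.
Qed.

Lemma Rintegral_indic_box (r : R) : \int[lam]_x \1_(@box R m r) x = fine (lam (box r)).
Proof.
rewrite /Rintegral integral_indic ?setIT//; exact: measurable_box.
Qed.

Lemma Rintegral_box_le (f : T -> R) (r C : R) : 0 <= C -> measurable_fun setT f ->
  boxsupp r f -> (forall x, box r x -> `|f x| <= C) ->
  `|\int[lam]_x f x| <= C * fine (lam (box r)).
Proof.
move=> C0 mf bf HC.
have HC' x : `|f x| <= C.
  have [->|fx] := eqVneq (f x) 0; first by rewrite normr0.
  exact/HC/bf.
have intf := integrable_boxsupp mf bf HC'.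
apply: (le_trans (le_normr_Rintegral measurableT intf)).
rewrite -Rintegral_indic_box -RintegralZl//; last exact: integrable_indic_box.
apply: le_Rintegral => //.
- apply: (@integrable_boxsupp _ r C).
  + exact: measurableT_comp.
  + by move=> x; rewrite normr_eq0 => /bf.
  + by move=> x; rewrite normr_id.
- have := integrableZl measurableT C (integrable_indic_box r).
  by apply: eq_integrable => // x _; rewrite /= EFinM.
- move=> x _; have [->|fx] := eqVneq (f x) 0; first by rewrite normr0 mulr_ge0.
  by rewrite indicE mem_set ?mulr1//; exact: bf.
Qed.

End box_support.

Lemma continuous_bigsum (R : realType) (T : topologicalType) (I : Type) (s : seq I)
    (F : I -> T -> R) (x : T) : (forall i, {for x, continuous (F i)}) ->
  {for x, continuous (fun y => \sum_(i <- s) F i y)}.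
Proof.
move=> cF; elim: s => [|i s IH].
  rewrite (_ : (fun y => _) = cst 0); first exact: cst_continuous.
  by apply/funext => y; rewrite big_nil.
rewrite (_ : (fun y => _) = F i \+ (fun y => \sum_(i <- s) F i y)).
  exact: (@continuousD R _ _ (F i)).
by apply/funext => y; rewrite big_cons.
Qed.

(** * Convolution and smooth approximation *)

Section convolution.
Context {R : realType} {n : nat}.
Local Notation H := (heis R n).
Local Notation lam := (@lebesgue_rV R (n + n + 1)).
Implicit Types (x y z : H) (f phi U : H -> R).

Lemma hform_sum x y : hform x y = \sum_j hform (delta_mx 0 j) y * x 0 j.
Proof.
rewrite {1}(row_sum_delta x).
have hsum (s : seq 'I_(n + n + 1)) :
    hform (\sum_(j <- s) x 0 j *: delta_mx 0 j) y =
    \sum_(j <- s) hform (delta_mx 0 j) y * x 0 j.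
  elim: s => [|j s IH].
    by rewrite !big_nil -(scale0r (0 : H)) hformZl mul0r.
  by rewrite !big_cons hformDl hformZl IH mulrC.
exact: hsum.
Qed.

Lemma continuous_hmul : continuous (fun p : H * H => hmul p.1 p.2).
Proof.
apply: continuous_mxP => i p.
have c1 j : {for p, continuous (fun p : H * H => p.1 0 j)}.
  by apply: (@continuous_comp _ _ _ (@fst H H) (fun x : H => x 0 j)); [exact: cvg_fst|exact: coord_continuous].
have c2 j : {for p, continuous (fun p : H * H => p.2 0 j)}.
  by apply: (@continuous_comp _ _ _ (@snd H H) (fun x : H => x 0 j)); [exact: cvg_snd|exact: coord_continuous].
have ch : {for p, continuous (fun p : H * H => hform p.1 p.2)}.
  rewrite /hform; apply: continuous_bigsum => j.
  apply: (@continuousM R _ (fun p : H * H => hcoef j p.1)); last exact: c2.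
  by apply: (@continuous_comp _ _ _ (@fst H H) (hcoef j)); [exact: cvg_fst|exact: continuous_hcoef].
have -> : (fun p : H * H => hmul p.1 p.2 0 i) = (fun p : H * H =>
  p.1 0 i + p.2 0 i + hform p.1 p.2 * (delta_mx 0 tc : H) 0 i).
  by apply/funext => q; rewrite /hmul !mxE.
have cs : {for p, continuous (fun p : H * H => p.1 0 i + p.2 0 i)}.
  exact: (@continuousD R _ _ (fun p : H * H => p.1 0 i) (fun p : H * H => p.2 0 i) p (c1 i) (c2 i)).
apply: (@continuousD R _ _ _ (fun p : H * H => hform p.1 p.2 * (delta_mx 0 tc : H) 0 i) p cs).
apply: (@continuousM R _ (fun p : H * H => hform p.1 p.2) (fun=> (delta_mx 0 tc : H) 0 i) p ch).
exact: cst_continuous.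
Qed.

Lemma continuous_hmulr x : continuous (fun z => hmul z x).
Proof.
move=> z; apply: (@continuous_comp _ _ _ (fun z : H => (z, x)) (fun p : H * H => hmul p.1 p.2)).
  exact: (@cvg_pair _ _ _ (nbhs z) (nbhs z) (nbhs x) _ _ _ id (cst x) cvg_id (@cst_continuous _ _ x z)).
exact: continuous_hmul.
Qed.

(** For fixed [x], the term [hform z x] is linear in [z] and ignores the vertical coordinate of [z],
    so right translation is a vertical shear composed with a translation. *)
Lemma integral_hmul (f : H -> \bar R) x : measurable_fun setT f ->
  (forall z, 0 <= f z)%E ->
  (\int[lam]_z f (hmul z x) = \int[lam]_z f z)%E.
Proof.
move=> mf f0.
rewrite -[RHS](@integral_rV_shear R _ tc x (\row_j hform (delta_mx 0 j) x))//; last first.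
  by rewrite mxE hform_tl.
apply: eq_integral => z _; congr f; rewrite /hmul; congr (_ + _ *: _).
by rewrite hform_sum; apply: eq_bigr => j _; rewrite mxE.
Qed.

Lemma Rintegral_hmul f x : measurable_fun setT f ->
  \int[lam]_z f (hmul z x) = \int[lam]_z f z.
Proof.
move=> mf; have mf' : measurable_fun setT (EFin \o f) by exact/measurable_EFinP.
rewrite /Rintegral; congr fine.
rewrite -[LHS]/(\int[lam]_z ((EFin \o f) \o hmul^~ x) z)%E.
rewrite [LHS]integralE [RHS]integralE funepos_comp funeneg_comp; congr (_ - _)%E.
  exact: (integral_hmul x (measurable_funepos mf') (fun z => funepos_ge0 _ z)).
exact: (integral_hmul x (measurable_funeneg mf') (fun z => funeneg_ge0 _ z)).
Qed.

Lemma hcoef_box r x i : box r x -> `|hcoef i x| <= r.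
Proof.
move=> bx; have h j : `|x 0 j / 2| <= r.
  by rewrite normrM (@ger0_norm _ 2^-1)//; have := bx j; have := normr_ge0 (x 0 j); lra.
by rewrite /hcoef; case: fintype.split => j; rewrite ?normrN.
Qed.

Lemma hform_box r s x y : box r x -> box s y -> `|hform x y| <= (r * s) *+ (n + n).
Proof.
move=> bx bs; rewrite (le_trans (ler_norm_sum _ _ _))//.
rewrite -[X in _ *+ X]card_ord -sumr_const; apply: ler_sum => i _.
by rewrite normrM; apply: ler_pM => //; exact: hcoef_box.
Qed.

Lemma box_hmul r s x y : box r x -> box s y -> box (r + s + (r * s) *+ (n + n)) (hmul x y).
Proof.
move=> bx bs i; rewrite /hmul !mxE (le_trans (ler_normD _ _))// lerD//.
  by rewrite (le_trans (ler_normD _ _))// lerD.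
rewrite normrM /= (le_trans _ (hform_box bx bs))// ler_piMr//.
by case: (_ == _); rewrite /= ?normr1 ?normr0.
Qed.

(** By right invariance of Lebesgue measure this is also the average $\int\phi(z)U(zx)\,dz$ of left
    translates of $U$. The first form puts derivatives in $x$ on $\phi$; the second preserves bounds
    along horizontal segments, which left translations map to horizontal segments. *)
Definition hconv phi U x : R := \int[lam]_z (phi (hmul z (- x)) * U z).

Lemma hconvE phi U x : measurable_fun setT phi -> measurable_fun setT U ->
  hconv phi U x = \int[lam]_z (phi z * U (hmul z x)).
Proof.
move=> mp mU; rewrite -[RHS](Rintegral_hmul (- x)).
  by apply: eq_Rintegral => z _; rewrite hmulKV.
apply: measurable_funM => //; apply: (measurableT_comp mU).
by apply: continuous_measurable_mx; exact: continuous_hmulr.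
Qed.

Lemma hmulN_box r s x z : box r (hmul z (- x)) -> box s x ->
  box (r + s + (r * s) *+ (n + n)) z.
Proof. by move=> b1 b2; rewrite -[z](hmulKV x); exact: box_hmul. Qed.

(* The direction in which [z * x^-1] moves when [x] moves in direction [v]. *)
Definition hrvel z v : H := - (v + hform z v *: delta_mx 0 tc).

Lemma hmul_line z x v (s : R) : hmul z (- (x + s *: v)) = hmul z (- x) + s *: hrvel z v.
Proof.
rewrite /hmul /hrvel opprD hformDr !hformNr hformZr.
by apply/rowP => i; rewrite !mxE; ring.
Qed.

Lemma is_derive_hrvel phi z v y : Ck 1 phi ->
  is_derive y (hrvel z (delta_mx 0 v)) phi
    (- (partial v phi y + hform z (delta_mx 0 v) * partial tc phi y)).
Proof.
move=> p1; case: (Ck1_is_derive y (hrvel z (delta_mx 0 v)) p1) => D E; split=> //.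
rewrite E /hrvel.
under eq_bigr do rewrite mxE [X in - X]mxE [X in - (_ + X)]mxE mulNr mulrDl.
rewrite sumrN big_split/=; congr (- (_ + _)).
  rewrite (bigD1 v)//= mxE !eqxx mul1r big1 ?addr0// => j jv.
  by rewrite mxE (negbTE jv) andbF mul0r.
rewrite (bigD1 tc)//= mxE !eqxx mulr1 big1 ?addr0// => j jv.
by rewrite mxE (negbTE jv) andbF mulr0 mul0r.
Qed.

Lemma continuous_hmulr_comp phi w : continuous phi -> continuous (fun z => phi (hmul z w)).
Proof.
move=> cp z; apply: (@continuous_comp _ _ _ (hmul^~ w) phi); last exact: cp.
exact: continuous_hmulr.
Qed.

Lemma hconv_integrable phi U r x : continuous phi -> boxsupp r phi -> continuous U ->
  lam.-integrable setT (EFin \o (fun z => phi (hmul z (- x)) * U z)).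
Proof.
move=> cp bp cU.
apply: (@integrable_cont_boxsupp _ _ _ (r + `|x| + (r * `|x|) *+ (n + n))).
  move=> z; apply: (@continuousM _ _ (fun z => phi (hmul z (- x)))); last exact: cU.
  exact: continuous_hmulr_comp.
move=> z; rewrite mulf_eq0 negb_or => /andP[/bp bz _].
exact: (hmulN_box bz (box_normr x)).
Qed.

Lemma hconv_continuous phi U r : continuous phi -> boxsupp r phi -> continuous U ->
  continuous (hconv phi U).
Proof.
move=> cp bp cU x; apply/continuous_distP => e e0.
(* A box containing the supports of [z |-> phi (hmul z (- y))] for all [y] within 1 of [x]. *)
pose q := r + (`|x| + 1) + (r * (`|x| + 1)) *+ (n + n).
have [C C0 HC] := continuous_box_bounded q cU.
pose L := fine (lam (box q)).
have mb := @measurable_box R (n + n + 1) q.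
have L0 : 0 <= L by exact: fine_ge0.
(* Adding 1 keeps the denominator positive even when [C] or [L] vanishes. *)
pose d := e / (C * L + 1).
have d0 : 0 < d by rewrite divr_gt0// ltr_wpDl// mulr_ge0.
have cov := (compact_near_coveringP (box q)).1 (@box_compact R (n + n + 1) q) H (nbhs x)
  (fun y z => `|phi (hmul z (- x)) - phi (hmul z (- y))| <= d) (nbhs_filter x).
have {}cov : \forall y \near x, box q `<=` (fun z => `|phi (hmul z (- x)) - phi (hmul z (- y))| <= d).
  apply: cov => z bz.
  have cph : {for (z, x), continuous (fun p : H * H => phi (hmul p.1 (- p.2)))}.
    apply: (@continuous_comp _ _ _ (fun p : H * H => (p.1, - p.2)) (fun p : H * H => phi (hmul p.1 p.2))).
      apply: (@continuous_pair _ _ _ (@fst H H) (fun p : H * H => - p.2)); first exact: cvg_fst.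
      by apply: (@continuousN R _ _ (@snd H H)); exact: cvg_snd.
    by apply: (@continuous_comp _ _ _ (fun p : H * H => hmul p.1 p.2) phi); [exact: continuous_hmul|exact: cp].
  have d20 : 0 < d / 2 by rewrite divr_gt0.
  move/continuous_distP: cph => /(_ _ d20) N1.
  have N2 : \forall z' \near z & y \near x, `|phi (hmul z (- x)) - phi (hmul z' (- x))| <= d / 2.
    have cz : {for z, continuous (fun z => phi (hmul z (- x)))}.
      exact: continuous_hmulr_comp.
    move/continuous_distP: cz => /(_ _ d20) N2.
    exists ([set z' | `|phi (hmul z (- x)) - phi (hmul z' (- x))| <= d / 2], setT).
      by split => //; exact: filterT.
    by case=> z' y [].
  apply: (@filterS2 _ (filter_prod (nbhs z) (nbhs x)) _ _ _ _ _ N1 N2) => -[z' y] /= h1 h2.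
  rewrite -(subrKA (phi (hmul z (- x)))) (le_trans (ler_normD _ _))// [leRHS]splitr lerD// distrC//.
near=> y.
have byx : box 1 (y - x) by near: y; exact: nbhs_box.
have by1 : box (`|x| + 1) y.
  rewrite -[y](subrK x) => i; rewrite mxE addrC (le_trans (ler_normD _ _))// lerD//.
  exact: box_normr.
have yd : box q `<=` (fun z => `|phi (hmul z (- x)) - phi (hmul z (- y))| <= d).
  by near: y.
have bx1 : box (`|x| + 1) x by apply: box_le (box_normr x); rewrite lerDl.
have ix := hconv_integrable x cp bp cU.
have iy := hconv_integrable y cp bp cU.
rewrite /hconv -RintegralB//.
apply: (@le_trans _ _ (d * C * L)).
  apply: Rintegral_box_le; first by rewrite mulr_ge0 ?(ltW d0).
  - apply: measurable_funB; apply: measurable_funM;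
      try exact: continuous_measurable_real;
      by apply: continuous_measurable_real; exact: continuous_hmulr_comp.
  - move=> z; rewrite -mulrBl mulf_eq0 negb_or => /andP[nz _].
    have [pz|pz] := eqVneq (phi (hmul z (- x))) 0.
      by apply: (hmulN_box (bp _ _) by1); move: nz; rewrite pz sub0r oppr_eq0.
    exact: (hmulN_box (bp _ pz) bx1).
  - move=> z bz; rewrite -mulrBl normrM; apply: ler_pM => //; [exact: yd|exact: HC].
rewrite -mulrA /d mulrAC ler_pdivrMr ?ltr_wpDl ?mulr_ge0//.
by rewrite ler_wpM2l ?(ltW e0)// lerDl.
Unshelve. all: by end_near. Qed.

End convolution.

Section convolution_derivative.
Context {R : realType} {n : nat}.
Local Notation H := (heis R n).
Local Notation lam := (@lebesgue_rV R (n + n + 1)).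
Implicit Types (x y z : H) (f phi U : H -> R).

(** Moving [x] in the direction [v] moves $zx^{-1}$ vertically by an amount depending on [z].
    Absorbing this factor in [U] makes the derivative of a convolution a combination of
    convolutions, so that smoothness follows by induction. *)
Definition hformM (v : 'I_(n + n + 1)) U : H -> R :=
  fun z => hform z (delta_mx 0 v) * U z.

Lemma continuous_hforml y : continuous (fun z : H => hform z y).
Proof.
move=> z; apply: (@continuous_comp _ _ _ (fun z : H => (z, y)) (fun p : H * H => hform p.1 p.2)).
  by apply: (@continuous_pair _ _ _ id (cst y)); [exact: cvg_id|exact: cst_continuous].
apply: continuous_bigsum => j.
apply: (@continuousM R _ (fun p : H * H => hcoef j p.1) (fun p : H * H => p.2 0 (hc j))).
  by apply: (@continuous_comp _ _ _ (@fst H H) (hcoef j)); [exact: cvg_fst|exact: continuous_hcoef].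
by apply: (@continuous_comp _ _ _ (@snd H H) (fun x : H => x 0 (hc j))); [exact: cvg_snd|exact: coord_continuous].
Qed.

Lemma continuous_hformM v U : continuous U -> continuous (hformM v U).
Proof.
move=> cU z; apply: (@continuousM R _ (fun z => hform z (delta_mx 0 v))); last exact: cU.
exact: continuous_hforml.
Qed.

Lemma hconv_is_derive phi U r x v : Ck 1 phi -> boxsupp r phi -> continuous U ->
  is_derive x (delta_mx 0 v) (hconv phi U)
    (- (hconv (partial v phi) U x + hconv (partial tc phi) (hformM v U) x)).
Proof.
move=> p1 bp cU.
have cp := Ck_continuous p1.
have cpi i : continuous (partial i phi).
  by case: p1 => _ /(_ i)[_]; exact: (@Ck_continuous _ _ 0).
have -> : x = x + (0:R) *: delta_mx 0 v by rewrite scale0r addr0.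
apply/is_derive_line.
rewrite scale0r addr0.
pose f (s : R) z := phi (hmul z (- (x + s *: delta_mx 0 v))) * U z.
pose df (s : R) z := - (partial v phi (hmul z (- (x + s *: delta_mx 0 v)))
   + hform z (delta_mx 0 v) * partial tc phi (hmul z (- (x + s *: delta_mx 0 v)))) * U z.
pose q := r + (`|x| + 1) + (r * (`|x| + 1)) *+ (n + n).
have fd (s : R) z : is_derive s (1:R) (f^~ z) (df s z).
  rewrite /f; have -> : (fun s : R => phi (hmul z (- (x + s *: delta_mx 0 v))) * U z) =
    (fun s : R => phi (hmul z (- x) + s *: hrvel z (delta_mx 0 v))) * cst (U z).
    by apply/funext => t; rewrite hmul_line.
  have D : is_derive s (1:R) (fun s : R => phi (hmul z (- x) + s *: hrvel z (delta_mx 0 v)))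
     (- (partial v phi (hmul z (- (x + s *: delta_mx 0 v)))
   + hform z (delta_mx 0 v) * partial tc phi (hmul z (- (x + s *: delta_mx 0 v))))).
    by apply/is_derive_line; rewrite -hmul_line; exact: is_derive_hrvel.
  case: (is_deriveM D (is_derive_cst (U z) s (1:R))) => Dx E; split=> //.
  by rewrite E scaler0 add0r /GRing.scale/= mulrC.
have xs (s : R) : `]-1, 1[%classic s -> box (`|x| + 1) (x + s *: delta_mx 0 v).
  rewrite /= in_itv/= => /andP[s1 s2] i; rewrite !mxE (le_trans (ler_normD _ _))// lerD//.
    exact: box_normr.
  rewrite normrM; apply: mulr_ile1 => //; first by rewrite ler_norml !ltW.
  by case: (_ && _); rewrite ?normr1 ?normr0.
have [C1 C10 HC1] := boxsupp_bounded (cpi v) (boxsupp_partial (i := v) bp).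
have [C2 C20 HC2] := boxsupp_bounded (cpi tc) (boxsupp_partial (i := tc) bp).
have [C3 C30 HC3] := continuous_box_bounded q cU.
have [C4 C40 HC4] := continuous_box_bounded q (@continuous_hforml (delta_mx 0 v)).
(* The dominating function for $|s|<1$: for these parameters the integrands are all supported in
   [box q]. *)
pose G z : R := (C1 + C4 * C2) * C3 * \1_(box q) z.
have C0 : 0 <= (C1 + C4 * C2) * C3 by rewrite mulr_ge0 ?addr_ge0// mulr_ge0.
have I0 : `]-1, 1[%classic (0 : R) by rewrite /= in_itv/= ltrN10 ltr01.
have If (s : R) : `]-1, 1[%classic s -> lam.-integrable setT (EFin \o f s).
  by move=> _; exact: (hconv_integrable _ cp bp cU).
have Df (s : R) z : `]-1, 1[%classic s -> setT z -> derivable (f^~ z) s 1.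
  by move=> _ _; exact: (@ex_derive _ _ _ _ _ _ _ (fd s z)).
have dfE (s : R) z : partial1of2 f s z = df s z.
  by rewrite partial1of2E (@derive_val _ _ _ _ _ _ _ (fd s z)).
have IG : lam.-integrable setT (EFin \o G).
  have := integrableZl measurableT ((C1 + C4 * C2) * C3) (@integrable_indic_box R (n + n + 1) q).
  by apply: eq_integrable => // z _; rewrite /= EFinM.
have G0 z : 0 <= G z by rewrite mulr_ge0.
have Gb (s : R) z : `]-1, 1[%classic s -> setT z -> `|partial1of2 f s z| <= G z.
  move=> Is _; rewrite dfE /df /G.
  have [bz|nbz] := pselect (box q z).
    rewrite indicE mem_set// mulr1 normrM normrN; apply: ler_pM => //; last exact: HC3.
    rewrite (le_trans (ler_normD _ _))// lerD//.
    by rewrite normrM; apply: ler_pM => //; exact: HC4.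
  have Z g : boxsupp r g -> g (hmul z (- (x + s *: delta_mx 0 v))) = 0.
    move=> bg; apply/eqP/negPn/negP => /bg bz; apply: nbz.
    exact: (hmulN_box bz (xs _ Is)).
  rewrite !Z; [|exact: boxsupp_partial|exact: boxsupp_partial].
  by rewrite mulr0 addr0 oppr0 mul0r normr0 mulr_ge0.
have J1 := derivable_under_integral measurableT I0 If Df G0 IG Gb.
have J2 := differentiation_under_integral measurableT I0 If Df G0 IG Gb.
split; first exact: J1.
rewrite -derive1E; apply: (etrans J2).
under eq_Rintegral do rewrite dfE /df scale0r addr0.
rewrite /hconv -RintegralD//; last 2 first.
- exact: (hconv_integrable x (cpi v) (boxsupp_partial (i := v) bp) cU).
- exact: (hconv_integrable x (cpi tc) (boxsupp_partial (i := tc) bp) (@continuous_hformM v U cU)).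
rewrite -mulN1r -RintegralZl//; last first.
  apply: integrableDR => //.
  exact: (hconv_integrable x (cpi v) (boxsupp_partial (i := v) bp) cU).
  exact: (hconv_integrable x (cpi tc) (boxsupp_partial (i := tc) bp) (@continuous_hformM v U cU)).
apply: eq_Rintegral => z _; rewrite /hformM; ring.
Qed.

End convolution_derivative.

Section convolution_gradient.
Context {R : realType} {n : nat}.
Local Notation H := (heis R n).
Local Notation lam := (@lebesgue_rV R (n + n + 1)).
Implicit Types (x y z : H) (f phi U : H -> R) (i : 'I_(n + n)).

Lemma hconv_Ck k phi U r : smooth phi -> boxsupp r phi -> continuous U ->
  Ck k (hconv phi U).
Proof.
elim: k phi U => [|k IH] phi U sp bp cU.
  by split=> //; exact: (hconv_continuous (Ck_continuous (sp 0)) bp cU).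
have D x v := hconv_is_derive x v (sp 1) bp cU.
split; first exact: (hconv_continuous (Ck_continuous (sp 0)) bp cU).
move=> v; split; first by move=> x; exact: (@ex_derive _ _ _ _ _ _ _ (D x v)).
rewrite (_ : partial v _ = fun x => -1 * (hconv (partial v phi) U x +
    hconv (partial tc phi) (hformM v U) x)).
  have [_ _ sp'] := (smoothP phi).1 sp.
  apply/CkZ/CkD; apply: IH => //; try exact: boxsupp_partial.
  exact: continuous_hformM.
by apply/funext => x; rewrite /partial (@derive_val _ _ _ _ _ _ _ (D x v)) mulN1r.
Qed.

Lemma hmul_Nline z x v (s : R) : hmul (z + s *: v) (- x) =
  hmul z (- x) + s *: (v - hform v x *: delta_mx 0 tc).
Proof.
rewrite /hmul hformDl hformZl !hformNr.
by apply/rowP => i; rewrite !mxE; ring.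
Qed.

Lemma Ck_translate k phi x : Ck k phi -> Ck k (fun z => phi (hmul z (- x))).
Proof.
apply: (@Ck_affine _ _ k phi (fun z => hmul z (- x))
   (fun v => v - hform v x *: delta_mx 0 tc)).
  exact: continuous_hmulr.
by move=> z v s; exact: hmul_Nline.
Qed.

Lemma boxsupp_translate phi x r : boxsupp r phi ->
  boxsupp (r + `|x| + (r * `|x|) *+ (n + n)) (fun z => phi (hmul z (- x))).
Proof. by move=> bp z /bp bz; exact: (hmulN_box bz (box_normr x)). Qed.

Lemma sum_delta_mull i (F : 'I_(n + n) -> R) :
  \sum_j (delta_mx 0 i : 'rV[R]_(n + n)) 0 j * F j = F i.
Proof.
rewrite (bigD1 i)//= mxE !eqxx mul1r big1 ?addr0// => j ji.
by rewrite mxE (negbTE ji) andbF mul0r.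
Qed.

Lemma is_derive_hX f x i : Ck 1 f -> is_derive x (hvel x (delta_mx 0 i)) f (hX i f x).
Proof.
by move=> f1; have := is_derive_hvel x (delta_mx 0 i) f1; rewrite sum_delta_mull.
Qed.

(** The right-hand side is written as in [hconv_is_derive], in order to compare derivatives in [z]
    with derivatives in [x]. *)
Lemma hX_translate phi x z i : Ck 1 phi ->
  hX i (fun z => phi (hmul z (- x))) z =
  \sum_v hvel x (delta_mx 0 i) 0 v *
    (partial v phi (hmul z (- x)) + hform z (delta_mx 0 v) * partial tc phi (hmul z (- x))).
Proof.
move=> p1; have D1 := is_derive_hX z i (Ck_translate x p1).
have E : z = z + (0 : R) *: hvel z (delta_mx 0 i) by rewrite scale0r addr0.
pose V := hvel x (delta_mx 0 i).
have D2 : is_derive z (hvel z (delta_mx 0 i)) (fun z => phi (hmul z (- x)))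
  (\sum_v (V + hform z V *: delta_mx 0 tc) 0 v * partial v phi (hmul z (- x))).
  rewrite [X in is_derive X]E; apply/is_derive_line.
  have -> : (fun s : R => phi (hmul (z + s *: hvel z (delta_mx 0 i)) (- x))) =
     (fun s : R => phi (hmul z (- x) + s *: (V + hform z V *: delta_mx 0 tc))).
    apply/funext => s; rewrite hmul_Nline; congr (phi (_ + _ *: _)).
    rewrite /V /hvel !hformDl !hformDr !hformZl !hformZr hform_tl hform_tr.
    by rewrite (hform_sym x); apply/rowP => j; rewrite !mxE; ring.
  by apply/is_derive_line; rewrite scale0r addr0; exact: Ck1_is_derive.
rewrite -(@derive_val _ _ _ _ _ _ _ D1) (@derive_val _ _ _ _ _ _ _ D2).
under eq_bigr do rewrite mxE [X in _ + X]mxE mulrDl.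
under [RHS]eq_bigr do rewrite mulrDr.
rewrite !big_split /=; congr (_ + _).
rewrite (bigD1 tc)//= mxE !eqxx mulr1 big1 ?addr0; last first.
  by move=> j jt; rewrite mxE (negbTE jt) andbF mulr0 mul0r.
rewrite (hform_sym z) hform_sum -sumrN mulr_suml.
by apply: eq_bigr => j _; rewrite (hform_sym _ z); ring.
Qed.

(** As $z(x\exp sZ)^{-1}=z\exp(-sZ)\,x^{-1}$, applying $X_i$ in $x$ to $\phi(zx^{-1})$ is minus
    applying it in $z$. The integral obtained is the one in which a weak gradient of [U] can be
    inserted, with test function $z\mapsto\phi(zx^{-1})$. *)
Lemma hX_hconv phi U r x i : Ck 1 phi -> boxsupp r phi -> continuous U ->
  Ck 1 (hconv phi U) ->
  hX i (hconv phi U) x = - \int[lam]_z (U z * hX i (fun z => phi (hmul z (- x))) z).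
Proof.
move=> p1 bp cU c1.
have cp := Ck_continuous p1.
have cpi v : continuous (partial v phi).
  by case: p1 => _ /(_ v)[_]; exact: (@Ck_continuous _ _ 0).
have D1 := is_derive_hX x i c1.
have D2 := Ck1_is_derive x (hvel x (delta_mx 0 i)) c1.
rewrite -(@derive_val _ _ _ _ _ _ _ D1) (@derive_val _ _ _ _ _ _ _ D2).
have I1 v := hconv_integrable x (cpi v) (boxsupp_partial (i := v) bp) cU.
have I2 v := hconv_integrable x (cpi tc) (boxsupp_partial (i := tc) bp) (@continuous_hformM _ _ v U cU).
under eq_bigr => v _ do rewrite /partial
  (@derive_val _ _ _ _ _ _ _ (hconv_is_derive x v p1 bp cU)) /hconv -RintegralD//
  mulrN -RintegralZl ?integrableDR//.
rewrite sumrN -Rintegral_sum//; last first.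
  by move=> v; apply: integrableZR => //; exact: integrableDR.
congr (- _); apply: eq_Rintegral => z _; rewrite hX_translate// mulr_sumr.
by apply: eq_bigr => v _; rewrite /hformM; ring.
Qed.

Lemma hX_near_eq f g x i : f =1 g -> hX i f x = hX i g x.
Proof. by move=> /funext ->. Qed.

(** The convolution of [phi] with the constant 1 is constant, by invariance of the measure; its
    derivative at 0 is both 0 and minus the integral in question. *)
Lemma Rintegral_hX phi r i : smooth phi -> boxsupp r phi ->
  \int[lam]_z hX i phi z = 0.
Proof.
move=> sp bp.
have c1 : continuous (fun _ : H => 1 : R) by move=> ?; exact: cst_continuous.
have := hX_hconv 0 i (sp 1) bp c1 (hconv_Ck 1 sp bp c1).
have -> : hconv phi (fun=> 1) = fun=> \int[lam]_z phi z.
  apply/funext => x; rewrite /hconv; under eq_Rintegral do rewrite mulr1.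
  apply: Rintegral_hmul; apply: continuous_measurable_real.
  exact: (Ck_continuous (sp 0)).
rewrite hXE /partial !derive_cst mulr0 addr0 => /esym/eqP; rewrite oppr_eq0 => /eqP <-.
apply: eq_Rintegral => z _; rewrite mul1r; apply: hX_near_eq => y.
by rewrite oppr0 hmulx0.
Qed.

Lemma hXM f g x i : Ck 1 f -> Ck 1 g ->
  hX i (f \* g) x = f x * hX i g x + g x * hX i f x.
Proof.
move=> [_ f1] [_ g1]; rewrite !hXE.
have d v : partial v (f \* g) x = f x * partial v g x + g x * partial v f x.
  by rewrite /partial deriveM//; [exact: (f1 v).1|exact: (g1 v).1].
by rewrite !d; ring.
Qed.

Lemma hX_continuous f i : Ck 1 f -> continuous (hX i f).
Proof.
move=> [_ f1] x.
have cp v : continuous (partial v f) by case: (f1 v) => _; exact: (@Ck_continuous _ _ 0).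
rewrite (_ : hX i f = (fun x => partial (hc i) f x + hcoef i x * partial tc f x)).
  apply: (@continuousD R _ _ (partial (hc i) f)); first exact: cp.
  by apply: (@continuousM R _ (hcoef i)); [exact: continuous_hcoef|exact: cp].
by apply/funext => y; exact: hXE.
Qed.

Lemma boxsupp_hX f r i : boxsupp r f -> boxsupp r (hX i f).
Proof.
move=> bf x; rewrite hXE; apply: contra_neqP => nx.
have Z v : partial v f x = 0.
  by apply/eqP/negPn/negP => /(boxsupp_partial bf).
by rewrite !Z mulr0 addr0.
Qed.

Lemma smooth_hgrad_weak f g r i : smooth f -> smooth g -> boxsupp r g ->
  \int[lam]_z (f z * hX i g z) = - \int[lam]_z (hX i f z * g z).
Proof.
move=> sf sg bg.
have cf := Ck_continuous (sf 0); have cg := Ck_continuous (sg 0).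
have bfg : boxsupp r (f \* g) by exact: boxsuppMl.
have sfg : smooth (f \* g) by move=> k; apply: CkM.
have := Rintegral_hX i sfg bfg.
under eq_Rintegral => z _ do rewrite (hXM _ _ (sf 1) (sg 1)).
rewrite RintegralD//.
- move=> /eqP; rewrite addr_eq0 => /eqP ->; congr (- _).
  by apply: eq_Rintegral => z _; rewrite mulrC.
- apply: (@integrable_cont_boxsupp _ _ _ r).
    move=> z; apply: (@continuousM R _ f); first exact: cf.
    exact: (hX_continuous (i := i) (sg 1)).
  exact/boxsuppMl/boxsupp_hX.
- apply: (@integrable_cont_boxsupp _ _ _ r).
    move=> z; apply: (@continuousM R _ g); first exact: cg.
    exact: (hX_continuous (i := i) (sf 1)).
  exact: boxsuppMr.
Qed.

End convolution_gradient.

(** * Mollifiers and smooth approximation *)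

Section mollifier.
Context {R : realType} {n : nat}.
Local Notation H := (heis R n).
Local Notation lam := (@lebesgue_rV R (n + n + 1)).
Implicit Types (x y z : H) (f phi u v : H -> R) (i : 'I_(n + n)).

Definition mollifier r phi := [/\ smooth phi, forall x, 0 <= phi x,
  boxsupp r phi & \int[lam]_z phi z = 1].

Lemma mollifier_integrable r phi : mollifier r phi -> lam.-integrable setT (EFin \o phi).
Proof. by case=> sp _ bp _; exact: (integrable_cont_boxsupp (Ck_continuous (sp 0)) bp). Qed.

Lemma exists_mollifier (r : R) : 0 < r -> exists phi, mollifier r phi.
Proof.
move=> r0; have [eta [se e0 be ep]] := @exists_bump R (n + n + 1) r r0.
have ce := Ck_continuous (se 0).
have bs : boxsupp r eta by move=> x /be bx i; exact/ltW/bx.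
have ie := integrable_cont_boxsupp ce bs.
have m0 : 0 < \int[lam]_z eta z.
  have h0 : 0 < eta 0 / 2 by rewrite divr_gt0.
  have := (continuous_distP eta 0).1 (ce 0) _ h0.
  move=> /nbhs_ballP[d /= d0 Hd].
  pose q := d / 2; have q0 : 0 < q by rewrite divr_gt0.
  apply: (@lt_le_trans _ _ (\int[lam]_z (eta 0 / 2 * \1_(@box R (n + n + 1) q) z))).
    rewrite RintegralZl//; last exact: integrable_indic_box.
    rewrite Rintegral_indic_box mulr_gt0//.
    have E : lam (@box R (n + n + 1) q) = ((q *+ 2) ^+ (n + n + 1))%:E.
      exact: (lebesgue_rV_box _ (ltW q0)).
    by rewrite [X in fine X]E /= exprn_gt0// mulrn_wgt0.
  apply: le_Rintegral => //.
    by apply: integrableZR => //; exact: integrable_indic_box.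
  move=> z _; rewrite indicE; have [bz|nbz] := pselect (box q z); last first.
    by rewrite memNset ?mulr0.
  rewrite mem_set// mulr1.
  have : `|eta 0 - eta z| <= eta 0 / 2.
    apply: Hd; rewrite -ball_normE /= sub0r normrN.
    rewrite (le_lt_trans ((box_norm z (ltW q0)).1 bz))// /q; lra.
  rewrite ler_norml; lra.
exists (fun x => (\int[lam]_z eta z)^-1 * eta x); split.
- by move=> k; apply: CkZ.
- by move=> x; rewrite mulr_ge0// invr_ge0 ltW.
- exact: boxsuppMl.
- by rewrite RintegralZl// mulVf ?gt_eqF.
Qed.

Lemma mollifier_approx u (q e : R) : continuous u -> 0 < e ->
  exists2 phi, mollifier 1 phi & forall x, box q x -> `|hconv phi u x - u x| <= e.
Proof.
move=> cu e0.
have cov := (compact_near_coveringP (box q)).1 (@box_compact R (n + n + 1) q) H (nbhs (0 : H))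
  (fun z x => `|u (hmul z x) - u x| <= e) (nbhs_filter (0 : H)).
have {}cov : \forall z \near (0 : H), box q `<=` (fun x => `|u (hmul z x) - u x| <= e).
  apply: cov => x bx.
  have e20 : 0 < e / 2 by rewrite divr_gt0.
  have cuu : {for (x, 0), continuous (fun p : H * H => u (hmul p.2 p.1))}.
    apply: (@continuous_comp _ _ _ (fun p : H * H => (p.2, p.1)) (fun p : H * H => u (hmul p.1 p.2))).
      by apply: (@continuous_pair _ _ _ (@snd H H) (@fst H H)); [exact: cvg_snd|exact: cvg_fst].
    by apply: (@continuous_comp _ _ _ (fun p : H * H => hmul p.1 p.2) u); [exact: continuous_hmul|exact: cu].
  move/continuous_distP: cuu => /(_ _ e20) N1.
  have N2 : \forall x' \near x & z \near (0 : H), `|u x - u x'| <= e / 2.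
    exists ([set x' | `|u x - u x'| <= e / 2], setT).
      split => //=; last exact: filterT.
      exact: ((continuous_distP u x).1 (cu x) _ e20).
    by case=> z' y [].
  apply: (@filterS2 _ (filter_prod (nbhs x) (nbhs (0 : H))) _ _ _ _ _ N1 N2) => -[x' z] /= h1 h2.
  rewrite hmul0x in h1.
  rewrite distrC -(subrKA (u x)) (le_trans (ler_normD _ _))// [leRHS]splitr lerD// distrC//.
move: cov => /nbhs_ballP[d /= d0 Hd].
(* Boxes are closed and balls are open, hence [d / 2]; the bound 1 gives all these mollifiers a
   common support. *)
pose r := Num.min 1 (d / 2); have r0 : 0 < r by rewrite lt_min ltr01 divr_gt0.
have [phi mp] := exists_mollifier r0; have [sp p0 bp ip] := mp.
exists phi.
  by split=> // z /bp; apply: box_le; rewrite ge_min lexx.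
move=> x bx.
have cp := Ck_continuous (sp 0).
rewrite hconvE; try exact: continuous_measurable_real.
have intp := mollifier_integrable mp.
have cux : continuous (fun z => u (hmul z x)) by exact: continuous_hmulr_comp.
have i1 : lam.-integrable setT (EFin \o (fun z => phi z * u (hmul z x))).
  apply: (@integrable_cont_boxsupp _ _ _ r); last exact: boxsuppMr.
  by move=> z; apply: (@continuousM R _ phi); [exact: cp|exact: cux].
have -> : u x = \int[lam]_z (u x * phi z) by rewrite RintegralZl// ip mulr1.
have i2 : lam.-integrable setT (EFin \o (fun z => u x * phi z)) by exact: integrableZR.
rewrite -RintegralB//.
apply: (le_trans (le_normr_Rintegral _ _)) => //; first exact: integrableBR.
rewrite -[leRHS]mulr1 -ip -RintegralZl//.
apply: le_Rintegral => //.
- apply: (@le_integrable _ _ _ lam _ measurableT _ (EFin \o (fun z => phi z * u (hmul z x) - u x * phi z))).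
  + apply/measurable_EFinP; apply: measurableT_comp => //; apply: measurable_funB; apply: measurable_funM => //;
    exact: continuous_measurable_real.
  + by move=> z _; rewrite /= normr_id.
  + exact: integrableBR.
- exact: integrableZR.
- move=> z _; rewrite (mulrC (u x)) -mulrBr normrM ger0_norm// mulrC.
  have [->|pz] := eqVneq (phi z) 0; first by rewrite !mulr0.
  rewrite ler_wpM2r//; apply: (Hd z) => //.
  rewrite -ball_normE /= sub0r normrN.
  rewrite (le_lt_trans ((box_norm z (ltW r0)).1 (bp _ pz)))//.
  by rewrite gt_min; apply/orP; right; lra.
Qed.

End mollifier.

Section smooth_approximation.
Context {R : realType} {n : nat}.
Local Notation H := (heis R n).
Local Notation lam := (@lebesgue_rV R (n + n + 1)).
Implicit Types (x y z : H) (f phi u v : H -> R) (i : 'I_(n + n)).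

(* Both [HW1oo_ball] and the functions that are 1-Lipschitz along horizontal
   segments are of this kind. *)
Definition smooth_approx u := forall q e : R, 0 < e ->
  exists v, [/\ smooth v, forall x, hnorm (hgrad v x) <= 1
    & forall x, box q x -> `|v x - u x| <= e].

Lemma hdot_hgrad (b : 'rV[R]_(n + n)) f x : hdot b (hgrad f x) = \sum_i b 0 i * hX i f x.
Proof. by apply: eq_bigr => i _; rewrite mxE. Qed.

Lemma hconv_smooth phi u r : smooth phi -> boxsupp r phi -> continuous u ->
  smooth (hconv phi u).
Proof. by move=> sp bp cu k; exact: hconv_Ck bp cu. Qed.

Lemma hnorm_hgrad_le1 f : smooth f ->
  (forall (b : 'rV[R]_(n + n)) x, \sum_i b 0 i * hX i f x <= hnorm b) -> forall x, hnorm (hgrad f x) <= 1.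
Proof.
move=> sf fb x; apply: hnorm_leP => // b.
by rewrite hdot_hgrad mul1r.
Qed.

Lemma is_derive_le (V : normedModType R) (f : V -> R) (x w : V) (d C : R) :
  is_derive x w f d -> (forall s : R, `|f (x + s *: w) - f x| <= C * `|s|) -> d <= C.
Proof.
move=> [D E] fC; rewrite -E /derive; apply: limr_le; first exact: D.
near=> h => /=; rewrite (le_trans (ler_norm _))// normrM normfV.
have h0 : h != 0 by near: h; exact: nbhs_dnbhs_neq.
by rewrite mulrC ler_pdivrMr ?normr_gt0// [_ + x]addrC fC.
Unshelve. all: by end_near. Qed.

Lemma lip_smooth_approx u : continuous u ->
  (forall x Z, `|u (hexp x Z) - u x| <= hnorm Z) -> smooth_approx u.
Proof.
move=> cu ulip q e e0; have [phi mp Hphi] := mollifier_approx q cu e0.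
have [sp p0 bp ip] := mp; have cp := Ck_continuous (sp 0).
have sv := hconv_smooth sp bp cu.
exists (hconv phi u); split=> //.
apply: hnorm_hgrad_le1 => // b x.
apply: (is_derive_le (is_derive_hvel x b (sv 1))) => s.
rewrite -hexp_line !hconvE; try exact: continuous_measurable_real.
have int y : lam.-integrable setT (EFin \o (fun z => phi z * u (hmul z y))).
  apply: (@integrable_cont_boxsupp _ _ _ 1); last exact: boxsuppMr.
  move=> z; apply: (@continuousM R _ phi); first exact: cp.
  exact: (@continuous_hmulr_comp _ _ _ y cu).
rewrite -RintegralB//.
have intB := integrableBR measurableT (int (hexp x (s *: b))) (int x).
apply: (le_trans (le_normr_Rintegral _ _)) => //.
rewrite -[leRHS]mulr1 -ip -RintegralZl//; last exact: mollifier_integrable mp.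
apply: le_Rintegral => //.
- apply: (le_integrable measurableT _ _ intB).
    have /measurable_EFinP mB := measurable_int _ intB.
    by apply/measurable_EFinP; exact: measurableT_comp.
  by move=> z _; rewrite /= normr_id.
- by apply: integrableZR => //; exact: mollifier_integrable mp.
- move=> z _; rewrite -mulrBr normrM ger0_norm// mulrC ler_wpM2r//.
  (* Associativity reads $z(x\exp Z)=(zx)\exp Z$: the hypothesis on [u] is applied at the point
     $zx$. *)
  by rewrite /hexp hmulA (le_trans (ulip _ _))// hnormZ mulrC.
Qed.

Lemma Lfun_measurable (mu : {measure set H -> \bar R}) p (f : H -> R) :
  f \in Lfun mu p -> measurable_fun setT f.
Proof. by move=> /sub_Lfun_mfun; rewrite inE. Qed.

(** Testing the weak gradient on $z\mapsto\phi(zx^{-1})$ shows that the gradient of the convolution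
    at $x$ is the average of [g] with density $\phi(zx^{-1})$, so its norm is at most 1. *)
Lemma ball_smooth_approx u : HW1oo_ball R n u -> smooth_approx u.
Proof.
move=> [cu [g [uoo goo ug] g1]] q e e0.
have [phi mp Hphi] := mollifier_approx q cu e0.
have [sp p0 bp ip] := mp; have cp := Ck_continuous (sp 0).
have sv := hconv_smooth sp bp cu.
exists (hconv phi u); split=> //.
apply: hnorm_hgrad_le1 => // b x.
have mg i : measurable_fun setT (fun x => g x 0 i) by exact: Lfun_measurable (goo i).
have mng : measurable_fun setT (fun x => hnorm (g x)).
  apply: (@measurableT_comp _ _ _ _ _ _ (@hnorm R n) _ g).
    by apply: continuous_measurable_real; exact: continuous_hnorm.
  exact: measurable_rowP.
pose A := [set x | hnorm (g x) <= 1].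
have mA : measurable A.
  have -> : A = (fun x => hnorm (g x)) @^-1` `]-oo, 1]%classic.
    by apply/seteqP; split=> y; rewrite /A /= in_itv.
  by rewrite -[X in measurable X]setTI; apply: mng.
(* Equal to [g] almost everywhere, but with norm at most 1 everywhere. *)
pose g' z : 'rV[R]_(n + n) := \1_A z *: g z.
have g'1 z : hnorm (g' z) <= 1.
  rewrite /g' hnormZ indicE; have [Az|nAz] := pselect (A z).
    by rewrite mem_set// normr1 mul1r.
  by rewrite memNset// normr0 mul0r.
pose F z := phi (hmul z (- x)).
have sF : smooth F by move=> k; exact: Ck_translate.
have bF := boxsupp_translate (x := x) bp; rewrite -/F in bF.
have cF := Ck_continuous (sF 0).
have mF := continuous_measurable_real cF.
have F0 z : 0 <= F z by exact: p0.
have iF := integrable_cont_boxsupp cF bF.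
have mg' i : measurable_fun setT (fun z => g' z 0 i).
  rewrite (_ : (fun z => _) = (fun z => \1_A z * g z 0 i)).
    by apply: measurable_funM => //; exact: measurable_indic.
  by apply/funext => z; rewrite mxE.
have ig' i : lam.-integrable setT (EFin \o (fun z => g' z 0 i * F z)).
  apply: (le_integrable measurableT _ _ iF).
    by apply/measurable_EFinP; exact: measurable_funM.
  move=> z _; rewrite /= lee_fin normrM ler_piMl//.
  exact: le_trans (hnorm_coord _ _) (g'1 z).
have gE i : \int[lam]_z (g z 0 i * F z) = \int[lam]_z (g' z 0 i * F z).
  rewrite /Rintegral; congr fine; apply: ae_eq_integral => //.
  - by apply/measurable_EFinP; exact: measurable_funM.
  - by apply/measurable_EFinP; exact: measurable_funM.
  - move/ess_supP : g1; apply: filterS => z; rewrite lee_fin => gz _.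
    by rewrite /g' indicE mem_set// scale1r.
have hXv i : hX i (hconv phi u) x = \int[lam]_z (g' z 0 i * F z).
  rewrite (hX_hconv _ _ (sp 1) bp cu (sv 1)) ug ?opprK//.
  by apply/compact_support_funP; eexists; exact: bF.
under eq_bigr do rewrite hXv -RintegralZl//.
rewrite -Rintegral_sum//; last by move=> i; exact: integrableZR.
have -> : hnorm b = \int[lam]_z (hnorm b * F z).
  rewrite RintegralZl// /F (Rintegral_hmul (- x) (continuous_measurable_real cp)).
  by rewrite ip mulr1.
apply: le_Rintegral => //; [|exact: integrableZR|].
  by apply: integrable_sumR => // i; exact: integrableZR.
move=> z _; under eq_bigr do rewrite mulrA.
rewrite -mulr_suml ler_wpM2r// (le_trans (hdot_le _ _))//.
by rewrite ler_piMr ?hnorm_ge0.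
Qed.

End smooth_approximation.

(** * Weak gradients of smooth limits *)

Section weight.
Context {R : realType} {m : nat}.
Local Notation lam := (@lebesgue_rV R m).

(** Integrability makes the energy of any bounded gradient finite; positivity everywhere lets
    finiteness of a weighted sum at a point be read without the weight. *)
Lemma exists_weight : exists w : 'rV[R]_m -> R,
  [/\ measurable_fun setT w, forall x, 0 < w x & lam.-integrable setT (EFin \o w)].
Proof.
pose L (k : nat) : R := fine (lam (@box R m k%:R)).
have L0 k : 0 <= L k by exact: fine_ge0.
(* Both [a k] and [a k * L k] are at most $2^{-k-1}$: the first makes the sum of the [a k] times
   indicators converge pointwise, the second bounds its integral. *)
pose a k : R := (2 ^ k.+1)%:R^-1 / (L k + 1).
have LE k : lam (@box R m k%:R) = (L k)%:E.
  by apply/esym/fineK; rewrite ge0_fin_numE//; exact: lebesgue_box_lty.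
have L1 k : 0 < L k + 1 by rewrite ltr_wpDl.
have a0 k : 0 < a k by rewrite divr_gt0// invr_gt0 ltr0n expn_gt0.
have aL k : a k * L k <= (2 ^ k.+1)%:R^-1.
  by rewrite /a mulrAC ler_pdivrMr// ler_wpM2l// lerDl.
have a1 k : a k <= (2 ^ k.+1)%:R^-1.
  by rewrite /a ler_pdivrMr// ler_peMr// lerDr.
pose F k (x : 'rV[R]_m) : \bar R := (a k * \1_(@box R m k%:R) x)%:E.
have mF k : measurable_fun setT (F k).
  apply/measurable_EFinP; apply: measurable_funM => //.
  by apply: measurable_indic; exact: measurable_box.
have F0 k x : (0 <= F k x)%E by rewrite lee_fin mulr_ge0// ltW.
have geo : (\sum_(k <oo) ((2 ^ k.+1)%:R^-1 : R)%:E <= 1)%E.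
  have := @epsilon_trick0 R 1 xpredT ler01.
  by under eq_eseriesr do rewrite div1r.
pose W x := (\sum_(k <oo) F k x)%E.
have mW : measurable_fun setT W by exact: ge0_emeasurable_sum.
have W1 x : (W x <= 1)%E.
  apply: le_trans geo; apply: lee_nneseries => // k _.
  rewrite /F lee_fin; apply: le_trans (a1 k).
  rewrite ler_piMr ?(ltW (a0 k))// indicE; case: (_ \in _) => //=.
have W0 x : (0 <= W x)%E by apply: nneseries_ge0.
have Wfin x : W x \is a fin_num.
  by rewrite ge0_fin_numE// (le_lt_trans (W1 x)) ?ltry.
have Wpos x : (0 < W x)%E.
  have [k Hk] : exists k : nat, `|x| <= k%:R.
    by exists (Num.bound `|x|); rewrite ltW// archi_boundP.
  apply: (@lt_le_trans _ _ (\sum_(0 <= i < k.+1) F i x)%E); last first.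
    by apply: nneseries_lim_ge.
  rewrite big_nat_recr//=; apply: (@lt_le_trans _ _ (F k x)).
    rewrite lte_fin mulr_gt0// indicE mem_set//.
    by apply/box_norm.
  by rewrite leeDr// sume_ge0.
exists (fun x => fine (W x)); split.
- by apply: measurableT_comp => //; exact: measurable_fine.
- by move=> x; rewrite fine_gt0// Wpos/= (le_lt_trans (W1 x)) ?ltry.
- have -> : EFin \o (fun x => fine (W x)) = W.
    by apply/funext => x /=; rewrite fineK.
  apply/integrableP; split => //.
  under eq_integral do rewrite gee0_abs//.
  rewrite integral_nneseries//.
  apply: (@le_lt_trans _ _ 1%E); last exact: ltry.
  apply: le_trans geo; apply: lee_nneseries => [k _ _|k _].
    exact: integral_ge0.
  have -> : (\int[lam]_x F k x = (a k * L k)%:E)%E.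
    under eq_integral do rewrite /F EFinM.
    rewrite ge0_integralZl//.
    + rewrite integral_indic//; last exact: measurable_box.
      rewrite setIT; apply: (etrans (congr1 (fun z => (a k)%:E * z)%E (LE k))).
      by rewrite -EFinM.
    + apply/measurable_EFinP; apply: measurable_indic; exact: measurable_box.
    + by rewrite lee_fin ltW.
  by rewrite lee_fin.
Qed.

End weight.

(** * The weighted Dirichlet energy *)

Section energy.
Context {R : realType} {n : nat}.
Local Notation H := (heis R n).
Local Notation lam := (@lebesgue_rV R (n + n + 1)).
Implicit Types (x y z : H) (f u v : H -> R) (i : 'I_(n + n)).

(** From $|d|\le 2^{-j}+2^j d^2$ the increments are absolutely summable. The constant [c] will be
    the value of the weight at a point. *)
Lemma cvg_weighted_increments (a : nat -> R) (c : R) : 0 < c ->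
  (\sum_(j <oo) (2 ^+ j * (a j - a j.+1) ^+ 2 * c)%:E)%E \is a fin_num -> cvgn a.
Proof.
move=> c0; set M := (X in X \is a fin_num) => Mfin.
have bnd N : \sum_(0 <= j < N) (2 ^+ j * (a j - a j.+1) ^+ 2) <= fine M / c.
  rewrite ler_pdivlMr// mulr_suml -lee_fin fineK// -sumEFin.
  apply: nneseries_lim_ge => j _ _; rewrite lee_fin mulr_ge0 ?(ltW c0)//.
  by rewrite mulr_ge0 ?sqr_ge0// exprn_ge0.
have geo N : \sum_(0 <= j < N) (2 ^- j : R) <= 2.
  have -> : \sum_(0 <= j < N) (2 ^- j : R) = 2 - 2 * 2 ^- N.
    elim: N => [|N IH]; first by rewrite big_geq// expr0 invr1 mulr1 subrr.
    rewrite big_nat_recr//= IH exprS invfM mulrA mulfV// mul1r; lra.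
  by rewrite gerBl mulr_ge0// invr_ge0 exprn_ge0.
have cd : cvgn (series (fun j => a j - a j.+1)).
  apply: normed_cvg; apply: nondecreasing_is_cvgn.
    by apply: nondecreasing_series => j _ _; exact: normr_ge0.
  exists (2 + fine M / c) => _ [N _ <-].
  apply: (@le_trans _ _ (\sum_(0 <= j < N) (2 ^- j + 2 ^+ j * (a j - a j.+1) ^+ 2))).
    apply: ler_sum => j _; have p0 : 0 < 2 ^+ j :> R by rewrite exprn_gt0.
    set d := `|a j - a j.+1|.
    have -> : (a j - a j.+1) ^+ 2 = d ^+ 2 by rewrite /d real_normK ?num_real.
    rewrite -(ler_pM2r p0) mulrDl mulVf ?gt_eqF//.
    by rewrite -[X in X * _ <= _]/d; move: (2 ^+ j) d => p d; have := sqr_ge0 (p * d - 1); have := sqr_ge0 (p * d); lra.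
  by rewrite big_split /= lerD.
have -> : a = (fun N => a 0%N - series (fun j => a j - a j.+1) N).
  apply/funext => N; rewrite /series /=.
  elim: N => [|N IH]; first by rewrite big_geq// subr0.
  by rewrite big_nat_recr//=; move: IH; lra.
by apply: is_cvgB => //; exact: is_cvg_cst.
Qed.

Lemma hXZD (a : R) f g x i : Ck 1 f -> Ck 1 g ->
  hX i (fun x => a * (f x + g x)) x = a * (hX i f x + hX i g x).
Proof.
move=> [cf f1] [cg g1]; rewrite !hXE.
have d (v : 'I_(n + n + 1)) : partial v (fun x => a * (f x + g x)) x = a * (partial v f x + partial v g x).
  rewrite /partial.
  have D := is_deriveZ a (is_deriveD (derivableP ((f1 v).1 x)) (derivableP ((g1 v).1 x))).
  exact: (@derive_val _ _ _ _ _ _ _ D).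
by rewrite !d; ring.
Qed.

Lemma continuous_hgrad_coord f i : smooth f -> continuous (fun x => hgrad f x 0 i).
Proof.
move=> sf; rewrite (_ : (fun x => _) = hX i f); first exact: hX_continuous (sf 1).
by apply/funext => x; rewrite mxE.
Qed.

Definition dgrad f g x : R := \sum_i (hX i f x - hX i g x) ^+ 2.

Lemma dgrad_continuous f g : smooth f -> smooth g -> continuous (dgrad f g).
Proof.
move=> sf sg x; apply: continuous_bigsum => i.
have c : {for x, continuous (fun x => hX i f x - hX i g x)}.
  by apply: (@continuousB R _ _ (hX i f) (hX i g)); exact: hX_continuous.
exact: (@continuousM R _ _ _ x c c).
Qed.

Variable w : H -> R.
Hypothesis mw : measurable_fun setT w.
Hypothesis w0 : forall x, 0 < w x.
Hypothesis iw : lam.-integrable setT (EFin \o w).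

Definition energy f : R := \int[lam]_x (hdot (hgrad f x) (hgrad f x) * w x).

Lemma integrable_bounded_weight (g : H -> R) (C : R) : continuous g ->
  (forall x, `|g x| <= C) -> lam.-integrable setT (EFin \o (fun x => g x * w x)).
Proof.
move=> cg gC; apply: (le_integrable measurableT _ _ (integrableZR measurableT C iw)).
  by apply/measurable_EFinP; apply: measurable_funM => //; exact: continuous_measurable_real.
move=> x _; rewrite /= lee_fin !normrM ler_wpM2r//.
exact: le_trans (gC x) (ler_norm _).
Qed.

Definition short f := smooth f /\ forall x, hnorm (hgrad f x) <= 1.

Lemma hdot_hgrad_continuous f : smooth f -> continuous (fun x => hdot (hgrad f x) (hgrad f x)).
Proof.
move=> sf x; rewrite /hdot; apply: continuous_bigsum => i.
have c := @continuous_hgrad_coord f i sf x.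
exact: (@continuousM R _ _ _ x c c).
Qed.

Lemma short_hdot f x : short f -> `|hdot (hgrad f x) (hgrad f x)| <= 1.
Proof.
by case=> _ f1; rewrite ger0_norm ?hdot_ge0// -hnorm_sqr expr_le1 ?hnorm_ge0.
Qed.

Lemma energy_integrable f : short f ->
  lam.-integrable setT (EFin \o (fun x => hdot (hgrad f x) (hgrad f x) * w x)).
Proof.
move=> sf; apply: (@integrable_bounded_weight _ 1) => [|x]; last exact: short_hdot.
by apply: hdot_hgrad_continuous; case: sf.
Qed.

Definition mid f g : H -> R := fun x => 2^-1 * (f x + g x).

Lemma mid_short f g : short f -> short g -> short (mid f g).
Proof.
move=> [sf f1] [sg g1]; split; first by move=> k; apply/CkZ/CkD.
move=> x; have -> : hgrad (mid f g) x = 2^-1 *: (hgrad f x + hgrad g x).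
  by apply/rowP => i; rewrite !mxE hXZD.
rewrite hnormZ ger0_norm// ler_pdivrMl// mulr1 (le_trans (hnormD _ _))//.
by rewrite -[2]/(1 + 1) lerD.
Qed.

Lemma energy_parallelogram f g : short f -> short g ->
  \int[lam]_x (dgrad f g x * w x) = 2 * energy f + 2 * energy g - 4 * energy (mid f g).
Proof.
move=> sf sg; have sm := mid_short sf sg.
have ef := energy_integrable sf; have eg := energy_integrable sg.
have em := energy_integrable sm.
apply: etrans (Rintegral_linear3 measurableT 2 2 4 ef eg em).
apply: eq_Rintegral => x _; rewrite !mulrA -mulrDl -mulrBl; congr (_ * _).
rewrite /dgrad /hdot !mulr_sumr -big_split -sumrB /=.
apply: eq_bigr => i _; rewrite !mxE (hXZD _ _ _ (sf.1 1) (sg.1 1)).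
by move: (hX i f x) (hX i g x) => a b {ef eg em sf sg sm}; field.
Qed.

Lemma energy_ge0 f : 0 <= energy f.
Proof. by apply: Rintegral_ge0 => x _; rewrite mulr_ge0 ?hdot_ge0 ?(ltW (w0 x)). Qed.

Lemma energy_le f : short f -> energy f <= \int[lam]_x w x.
Proof.
move=> sf; apply: le_Rintegral => //; first exact: energy_integrable.
move=> x _; rewrite ler_piMl ?(ltW (w0 x))//.
exact: le_trans (ler_norm _) (short_hdot x sf).
Qed.

End energy.

Section weak_gradient.
Context {R : realType} {n : nat}.
Local Notation H := (heis R n).
Local Notation lam := (@lebesgue_rV R (n + n + 1)).
Implicit Types (x y z : H) (f u v : H -> R) (i : 'I_(n + n)).

Variable u : H -> R.
Hypothesis cu : continuous u.
Hypothesis au : smooth_approx u.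
Variable w : H -> R.
Hypothesis mw : measurable_fun setT w.
Hypothesis w0 : forall x, 0 < w x.
Hypothesis iw : lam.-integrable setT (EFin \o w).

Let E := energy w.

(** The constraint sets of the minimisation: decreasing in [k] and stable under midpoints, they
    force locally uniform convergence to [u]. *)
Definition near_short (k : nat) v :=
  short v /\ forall x, box k%:R x -> `|v x - u x| <= k.+1%:R^-1.

Lemma near_short_le k l v : (k <= l)%N -> near_short l v -> near_short k v.
Proof.
move=> kl [sv uv]; split=> // x bx; apply: le_trans (uv x _) _.
  by apply: box_le bx; rewrite ler_nat.
by rewrite lef_pV2 ?posrE// ler_nat.
Qed.

Lemma near_short_mid k f g : near_short k f -> near_short k g -> near_short k (mid f g).
Proof.
move=> [sf uf] [sg ug]; split; first exact: mid_short.
move=> x bx; have := uf x bx; have := ug x bx; rewrite /mid.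
move: (k.+1%:R^-1) (f x) (g x) (u x) => e a b c; rewrite !ler_norml => /andP[??] /andP[??].
by apply/andP; split; lra.
Qed.

Let emin k := inf [set E v | v in near_short k].

Let has_inf_E k : has_inf [set E v | v in near_short k].
Proof.
split.
  have [v [sv v1 uv]] := au (k%:R) (e := k.+1%:R^-1) (eqbRL (invr_gt0 _) (ltr0Sn _ _)).
  by exists (E v); exists v.
by exists 0 => _ [v _ <-]; exact: energy_ge0.
Qed.

Let emin_le k v : near_short k v -> emin k <= E v.
Proof. by move=> kv; apply: ge_inf; [exact: (has_inf_E k).2|exists v]. Qed.

Let emin_nd k l : (k <= l)%N -> emin k <= emin l.
Proof.
move=> kl; apply: lb_le_inf; first exact: (has_inf_E l).1.
by move=> _ [v lv <-]; apply: emin_le; exact: near_short_le lv.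
Qed.

Let has_sup_emin : has_sup (range emin).
Proof.
split; first by exists (emin 0%N); exists 0%N.
exists (\int[lam]_x w x) => _ [k _ <-].
have [_ [v kv _]] := (has_inf_E k).1.
by apply: le_trans (emin_le kv) _; apply: energy_le => //; case: kv.
Qed.

Let S := sup (range emin).

(** The infima [emin] increase to [S]. With $e=4^{-j}$, the energies of [v j] and [v j.+1] are at
    most $S+e$ and that of their midpoint is at least $S-e$, so the parallelogram identity leaves at
    most $4(S+e)-4(S-e)=8e$. *)
Lemma exists_minimizing : exists v : nat -> H -> R,
  (forall j, near_short j (v j)) /\
  forall j, \int[lam]_x (dgrad (v j) (v j.+1) x * w x) <= 8 * (4 ^ j)%:R^-1.
Proof.
have /choice[vN vNP] : forall j : nat, exists p : nat * (H -> R),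
   [/\ (j <= p.1)%N, near_short p.1 p.2, E p.2 <= S + (4 ^ j)%:R^-1 & S - (4 ^ j)%:R^-1 <= emin p.1].
  move=> j; have e0 : 0 < (4 ^ j)%:R^-1 :> R by rewrite invr_gt0 ltr0n expn_gt0.
  have [_ [N0 _ <-] HN0] := sup_adherent e0 has_sup_emin.
  (* Large enough for [emin N] to be close to [S] and for the approximant to be [near_short] at
     level [j]. *)
  pose N := maxn N0 j.
  have [_ [v Nv <-] Hv] := inf_adherent e0 (has_inf_E N).
  exists (N, v); split => //=; first exact: leq_maxr.
    rewrite (le_trans (ltW Hv))// lerD2r.
    by apply: ub_le_sup; [exact: has_sup_emin.2|exists N].
  by rewrite (le_trans (ltW HN0))//; apply: emin_nd; exact: leq_maxl.
exists (fun j => (vN j).2); split.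
  by move=> j; have [jN nv _ _] := vNP j; exact: near_short_le nv.
move=> j; have [jN nv E1 S1] := vNP j; have [jN' nv' E2 S2] := vNP j.+1.
rewrite (energy_parallelogram mw iw nv.1 nv'.1) -/E.
have e4 : (4 ^ j.+1)%:R^-1 <= (4 ^ j)%:R^-1 :> R.
  by rewrite lef_pV2 ?posrE ?ltr0n ?expn_gt0// ler_nat leq_exp2l.
(* The midpoint satisfies the weaker of the two constraints, and the infimum at either level is at
   least $S-4^{-j}$. *)
have Em : S - (4 ^ j)%:R^-1 <= E (mid (vN j).2 (vN j.+1).2).
  have [NN|NN] := leqP (vN j).1 (vN j.+1).1.
    apply: le_trans S1 _; apply: emin_le; apply: near_short_mid => //.
    exact: near_short_le nv'.
  apply: (@le_trans _ _ (emin (vN j.+1).1)).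
    by apply: le_trans S2; rewrite lerD2l lerN2.
  apply: emin_le; apply: near_short_mid => //.
  exact: near_short_le (ltnW NN) nv.
move: E1 E2 Em e4.
move: (E _) (E _) (E _) S ((4 ^ j)%:R^-1) ((4 ^ j.+1)%:R^-1) => a b c s e e'.
move=> h1 h2 h3 h4.
lra.
Qed.

End weak_gradient.

Lemma cvg_bigsum (R : realType) (I : Type) (s : seq I) (F : I -> nat -> R) (l : I -> R) :
  (forall i, F i @ \oo --> l i) ->
  (fun j => \sum_(i <- s) F i j) @ \oo --> \sum_(i <- s) l i.
Proof.
move=> Fl; elim: s => [|i s IH].
  by rewrite big_nil; under eq_fun do rewrite big_nil; exact: cvg_cst.
by rewrite big_cons; under eq_fun do rewrite big_cons; exact: cvgD.
Qed.

Section bounded_approx.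
Context {R : realType} {n : nat}.
Local Notation H := (heis R n).
Local Notation lam := (@lebesgue_rV R (n + n + 1)).
Implicit Types (x y z : H) (f u v : H -> R) (i : 'I_(n + n)).

Lemma bounded_Lfun_oo (mu : {measure set H -> \bar R}) (f : H -> R) (C : R) :
  measurable_fun setT f -> (forall x, `|f x| <= C) -> f \in Lfun mu +oo%E.
Proof.
move=> mf fC; rewrite inE; apply/andP; split; first by rewrite inE.
rewrite inE /= /finite_norm unlock /=; case: ifP => _; last by rewrite ltry.
apply: (@le_lt_trans _ _ C%:E); last by rewrite ltry.
by apply/ess_supP; apply: nearW => x; rewrite /= lee_fin.
Qed.

Lemma short_coord f x i : short f -> `|hX i f x| <= 1.
Proof.
by move=> [_ /(_ x)]; apply: le_trans; have := hnorm_coord (hgrad f x) i; rewrite mxE.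
Qed.

(** The sum over $j$ of $2^j|\nabla_H v_j-\nabla_H v_{j+1}|^2w$ has finite integral, hence is finite
    almost everywhere; wherever it is finite, [cvg_weighted_increments] applies to each
    component. *)
Lemma exists_ae_cvg_gradients u : continuous u -> smooth_approx u ->
  exists (v : nat -> H -> R) (A : set H), [/\ forall j, near_short u j (v j),
    measurable A, lam (~` A) = 0%E
  & forall x i, A x -> cvgn (fun j => hX i (v j) x)].
Proof.
move=> cu au; have [w [mw w0 iw]] := @exists_weight R (n + n + 1).
have [v [nv vE]] := exists_minimizing au mw w0 iw.
have sv j := (nv j).1.
pose F j x : \bar R := (2 ^+ j * dgrad (v j) (v j.+1) x * w x)%:E.
have dg0 j x : 0 <= dgrad (v j) (v j.+1) x by apply: sumr_ge0 => i _; rewrite sqr_ge0.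
have F0 j x : (0 <= F j x)%E by rewrite lee_fin !mulr_ge0 ?exprn_ge0 ?(ltW (w0 x)).
have mF j : measurable_fun setT (F j).
  apply/measurable_EFinP; apply: measurable_funM => //; apply: measurable_funM => //.
  by apply: continuous_measurable_real; exact: (dgrad_continuous (sv j).1 (sv j.+1).1).
(* This is $2^j\cdot 8\cdot 4^{-j}$, written as the general term of a geometric series of sum 16. *)
have iF j : (\int[lam]_x F j x <= (16 / (2 ^ j.+1)%:R)%:E)%E.
  have dgw : lam.-integrable setT (EFin \o (fun x => dgrad (v j) (v j.+1) x * w x)).
    apply: (@integrable_bounded_weight _ _ _ mw iw _ (\sum_(i < n + n) 4)).
      exact: (dgrad_continuous (sv j).1 (sv j.+1).1).
    move=> x; rewrite ger0_norm//; apply: ler_sum => i _.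
    have := short_coord x i (sv j); have := short_coord x i (sv j.+1).
    move: (hX i _ _) (hX i _ _) => a b; rewrite !ler_norml => /andP[h1 h2] /andP[h3 h4].
    nra.
  rewrite (_ : (\int[lam]_x F j x)%E = (2 ^+ j * \int[lam]_x (dgrad (v j) (v j.+1) x * w x))%:E).
    rewrite lee_fin; apply: (le_trans (ler_wpM2l _ (vE j))); first exact: exprn_ge0.
    have -> : (4 ^ j)%:R = 2 ^+ j * 2 ^+ j :> R by rewrite natrX -exprMn -natrM.
    rewrite natrX exprS; have : 0 < 2 ^+ j :> R by rewrite exprn_gt0.
    move: (2 ^+ j) => p p0; rewrite le_eqVlt; apply/orP; left; apply/eqP; field.
    by rewrite gt_eqF.
  rewrite EFinM /Rintegral fineK; last exact: integrable_fin_num.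
  rewrite -integralZl//; apply: eq_integral => x _.
  by rewrite /F /= -EFinM mulrA.
pose W x := (\sum_(j <oo) F j x)%E.
have mW : measurable_fun setT W by exact: ge0_emeasurable_sum.
have iW : lam.-integrable setT W.
  apply/integrableP; split=> //.
  under eq_integral do rewrite gee0_abs ?nneseries_ge0//.
  rewrite integral_nneseries//; apply: (@le_lt_trans _ _ 16%:E); last exact: ltry.
  apply: le_trans (@epsilon_trick0 R 16 xpredT _) => //.
  by apply: lee_nneseries => // j _ _; exact: integral_ge0.
pose A := [set x | W x \is a fin_num].
have mA : measurable A by rewrite -[A]setTI; exact: emeasurable_fin_num.
exists v, A; split => //.
- have [N [mN N0 subN]] := integrable_ae measurableT iW.
  apply/eqP; rewrite -measure_le0 -N0; apply: le_measure; rewrite ?inE//.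
    exact: measurableC.
  by move=> x nA; apply: subN => /= /(_ I).
- move=> x i Ax; apply: (@cvg_weighted_increments _ _ (w x)) => //.
  have Wx : W x \is a fin_num := Ax.
  have T0 j : (0 <= (2 ^+ j * (hX i (v j) x - hX i (v j.+1) x) ^+ 2 * w x)%:E)%E.
    rewrite lee_fin; apply: mulr_ge0; last exact: ltW.
    by apply: mulr_ge0; [exact: exprn_ge0|exact: sqr_ge0].
  rewrite ge0_fin_numE; last exact: nneseries_ge0.
  apply: (@le_lt_trans _ _ (W x)); last by rewrite -ge0_fin_numE// nneseries_ge0.
  apply: lee_nneseries => // j _; rewrite lee_fin ler_wpM2r ?(ltW (w0 x))//.
  rewrite ler_wpM2l ?exprn_ge0// /dgrad (bigD1 i)//= lerDl.
  by apply: sumr_ge0 => k _; rewrite sqr_ge0.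
Qed.

Lemma smooth_approx_HW1oo u (M : R) : continuous u -> (forall x, `|u x| <= M) ->
  smooth_approx u -> HW1oo_ball R n u.
Proof.
move=> cu uM au.
have [v [A [nv mA A0 cA]]] := exists_ae_cvg_gradients cu au.
have sv j := (nv j).1.
(* Replaced by 0 off [A], the gradients converge everywhere, so that the limit is measurable and has
   norm at most 1 at every point. *)
pose h i (j : nat) x : R := hX i (v j) x * \1_A x.
have ch x i : cvgn (h i ^~ x).
  have [Ax|nAx] := pselect (A x).
    rewrite /h indicE mem_set//; under eq_fun do rewrite mulr1; exact: cA.
  by rewrite /h indicE memNset//; under eq_fun do rewrite mulr0; exact: is_cvg_cst.
have hM x i j : `|h i j x| <= 1.
  rewrite /h normrM indicE; case: (_ \in _); rewrite ?normr1 ?normr0 ?mulr1 ?mulr0//.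
  exact: short_coord.
pose g x : 'rV[R]_(n + n) := \row_i limn (h i ^~ x).
have gE x i : g x 0 i = limn (h i ^~ x) by rewrite mxE.
have mg i : measurable_fun setT (fun x => g x 0 i).
  apply: (@measurable_fun_cvg _ _ _ _ (fun j => h i j)).
    move=> j; apply: measurable_funM; last exact: measurable_indic.
    by apply: continuous_measurable_real; exact: hX_continuous ((sv j).1 1).
  by move=> x _; rewrite gE; exact: ch.
have g1 x : hnorm (g x) <= 1.
  apply: hnorm_leP => // b; rewrite mul1r /hdot.
  have cs : (fun j => \sum_i b 0 i * h i j x) @ \oo --> \sum_i b 0 i * g x 0 i.
    apply: cvg_bigsum => i; apply: cvgM; first exact: cvg_cst.
    by rewrite gE; exact: ch.
  rewrite -(cvg_lim _ cs)//; apply: limr_le; first by apply/cvg_ex; eexists; exact: cs.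
  apply: nearW => j; rewrite /h.
  under eq_bigr do rewrite mulrA.
  rewrite -mulr_suml -hdot_hgrad.
  have hb : hdot b (hgrad (v j) x) <= hnorm b.
    by apply: le_trans (hdot_le _ _) _; rewrite ler_piMr ?hnorm_ge0//; exact: (sv j).2.
  by rewrite indicE; case: (_ \in _); rewrite ?mulr1// mulr0 hnorm_ge0.
split=> //; exists g; last first.
  by apply/ess_supP; apply: nearW => x; rewrite lee_fin.
split.
- exact: bounded_Lfun_oo (continuous_measurable_real cu) uM.
- move=> i; apply: (@bounded_Lfun_oo _ _ 1) => // x.
  exact: le_trans (hnorm_coord _ _) (g1 x).
- move=> i f sf /compact_support_funP[r bf].
  have cf := Ck_continuous (sf 0); have ci := hX_continuous (i := i) (sf 1).
  have bi := boxsupp_hX (i := i) bf.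
  have intv j : lam.-integrable setT (EFin \o (fun x => v j x * hX i f x)).
    apply: (@integrable_cont_boxsupp _ _ _ r); last exact: boxsuppMl.
    by move=> x; apply: (@continuousM R _ (v j)); [exact: (Ck_continuous ((sv j).1 0))|exact: ci].
  have intu : lam.-integrable setT (EFin \o (fun x => u x * hX i f x)).
    apply: (@integrable_cont_boxsupp _ _ _ r); last exact: boxsuppMl.
    by move=> x; apply: (@continuousM R _ u); [exact: cu|exact: ci].
  have [C C0 HC] := boxsupp_bounded ci bi.
  pose L := fine (lam (box r)).
  have c1 : (fun j => \int[lam]_x (v j x * hX i f x)) @ \oo --> \int[lam]_x (u x * hX i f x).
    apply/cvgrPdist_le => e e0; near=> j.
    rewrite distrC -RintegralB//.
    apply: (@le_trans _ _ (j.+1%:R^-1 * C * L)).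
      apply: Rintegral_box_le.
      + by rewrite mulr_ge0.
      + apply: measurable_funB; apply: continuous_measurable_real => x.
          by apply: (@continuousM R _ (v j)); [exact: (Ck_continuous ((sv j).1 0))|exact: ci].
        by apply: (@continuousM R _ u); [exact: cu|exact: ci].
      + by move=> x; rewrite -mulrBl mulf_eq0 negb_or => /andP[_ /bi].
      + move=> x bx; rewrite -mulrBl normrM; apply: ler_pM => //.
        apply: (nv j).2; apply: box_le bx; near: j; exact: nbhs_infty_ger.
    rewrite -mulrA mulrC ler_pdivrMr// -ler_pdivrMl//.
    rewrite (@le_trans _ _ j%:R) ?ler_nat//; near: j; exact: nbhs_infty_ger.
  (* Integration by parts for the smooth [v j], then dominated convergence with bound [|f|], since
     the components of the gradients are at most 1. *)
  have c2 : (fun j => \int[lam]_x (v j x * hX i f x)) @ \oo --> - \int[lam]_x (g x 0 i * f x).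
    under eq_fun do rewrite (smooth_hgrad_weak i (sv _).1 sf bf).
    apply: cvgN.
    have [|||||ig _] := @dominated_convergence _ _ R lam setT measurableT
      (fun j x => (hX i (v j) x * f x)%:E) (fun x => (g x 0 i * f x)%:E)
      (fun x => `|f x|%:E).
    + move=> j; apply/measurable_EFinP; apply: continuous_measurable_real => x.
      by apply: (@continuousM R _ (hX i (v j))); [exact: (hX_continuous (i := i) ((sv j).1 1))|exact: cf].
    + by apply/measurable_EFinP; apply: measurable_funM => //; exact: continuous_measurable_real.
    + exists (~` A); split => //; first exact: measurableC.
      move=> x /= nx Ax; apply: nx => _.
      apply: cvg_EFin; first exact: nearW.
      apply: cvgM; last exact: cvg_cst.
      have := ch x i; rewrite -gE /h indicE mem_set//.
      by under eq_fun do rewrite mulr1.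
    + have := integrable_cont_boxsupp cf bf.
      by move=> /integrable_abse.
    + apply: nearW => x j _; rewrite /= lee_fin normrM ler_piMl//.
      exact: short_coord.
    + rewrite -[X in _ --> X -> _](fineK (integrable_fin_num measurableT ig)).
      by move=> cvgI; exact: (fine_cvg cvgI).
  exact: (cvg_unique _ c1 c2).
Unshelve. all: by end_near. Qed.

End bounded_approx.

(** * Integration against charges *)

Section bounded_measurable.
Context {R : realType} d (T : measurableType d).
Implicit Types f g : T -> R.

Definition bmeas f := measurable_fun setT f /\ exists C, forall x, `|f x| <= C.

Lemma bmeas_cst (c : R) : bmeas (fun=> c).
Proof. by split; [exact: measurable_cst|exists `|c|]. Qed.

Lemma bmeasD f g : bmeas f -> bmeas g -> bmeas (fun x => f x + g x).
Proof.
move=> [mf [C HC]] [mg [D HD]]; split; first exact: measurable_funD.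
by exists (C + D) => x; apply: le_trans (ler_normD _ _) (lerD (HC x) (HD x)).
Qed.

Lemma bmeasM f g : bmeas f -> bmeas g -> bmeas (fun x => f x * g x).
Proof.
move=> [mf [C HC]] [mg [D HD]]; split; first exact: measurable_funM.
by exists (C * D) => x; rewrite normrM; apply: ler_pM.
Qed.

Lemma bmeas_indic (A : set T) : measurable A -> bmeas (\1_A).
Proof.
move=> mA; split; first exact: measurable_indic.
by exists 1 => x; rewrite indicE; case: (_ \in _); rewrite ?normr1 ?normr0.
Qed.

Lemma bmeas_sum I (s : seq I) (F : I -> T -> R) : (forall i, bmeas (F i)) ->
  bmeas (fun x => \sum_(i <- s) F i x).
Proof.
move=> HF; elim: s => [|i s IH].
  by under eq_fun do rewrite big_nil; exact: bmeas_cst.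
by under eq_fun do rewrite big_cons; exact: bmeasD.
Qed.

Lemma bmeas_integrable (mu : {finite_measure set T -> \bar R}) f : bmeas f ->
  mu.-integrable setT (EFin \o f).
Proof.
move=> [mf [C HC]].
apply: (@le_integrable _ _ _ mu _ measurableT _ (EFin \o cst C)).
- exact/measurable_EFinP.
- by move=> x _; rewrite /= lee_fin (le_trans (HC x)) ?ler_norm.
- exact: finite_measure_integrable_cst.
Qed.

Lemma Rintegral_bmeas_le (mu : {finite_measure set T -> \bar R}) f (C : R) :
  measurable_fun setT f -> (forall x, `|f x| <= C) ->
  `|\int[mu]_x f x| <= fine (mu setT) * C.
Proof.
move=> mf HC; have bf : bmeas f by split=> //; exists C.
apply: (le_trans (le_normr_Rintegral measurableT (bmeas_integrable mu bf))).
rewrite mulrC -Rintegral_cst//; apply: le_Rintegral => //.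
- apply: bmeas_integrable; split; first exact: measurableT_comp.
  by exists C => x; rewrite normr_id.
- exact: finite_measure_integrable_cst.
Qed.

Lemma simple_approx f (e : R) : bmeas f -> 0 < e -> exists (N : nat) (c : nat -> R) (A : nat -> set T),
  (forall k, measurable (A k)) /\
  forall x, `|f x - \sum_(k < N) c k * \1_(A k) x| <= e.
Proof.
move=> [mf [C HC]] e0.
pose h x := (f x + C) / e.
have h0 x : 0 <= h x.
  by rewrite divr_ge0 ?(ltW e0)//; have := HC x; rewrite ler_norml => /andP[? ?]; lra.
have mh : measurable_fun setT h.
  by apply: measurable_funM => //; apply: measurable_funD.
pose A (k : nat) := h @^-1` `[k%:R, k.+1%:R[%classic.
have mA k : measurable (A k) by rewrite -[A k]setTI; apply: mh.
(* The level sets of width [e] up to this index exhaust the range of [h], which lies between 0 and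
   [(C + C) / e]. *)
pose N := (Num.trunc ((C + C) / e)).+1.
exists N, (fun k => k%:R * e - C), A; split => // x.
have [tx1 tx2] := andP (truncn_itv (h0 x)).
have tN : (Num.trunc (h x) < N)%N.
  rewrite ltnS le_truncn// /h ler_wpM2r ?invr_ge0 ?(ltW e0)// lerD2r.
  by rewrite (le_trans (ler_norm _)).
rewrite (bigD1 (Ordinal tN))//= big1 ?addr0.
  rewrite indicE mem_set ?mulr1; last by rewrite /A /= in_itv/= tx1.
  have fE : f x = h x * e - C by rewrite /h mulrVK ?unitfE ?gt_eqF//; lra.
  rewrite fE; move: tx1 tx2; rewrite -natr1; move: (h x) ((Num.trunc (h x))%:R) => a b h1 h2.
  have -> : a * e - C - (b * e - C) = (a - b) * e by ring.
  rewrite normrM (gtr0_norm e0) ler_piMl ?(ltW e0)// ger0_norm; lra.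
move=> k /eqP kN; rewrite indicE memNset ?mulr0// /A /= in_itv/= => /andP[k1 k2].
apply: kN; apply/val_inj => /=; apply/esym/truncn_def.
by rewrite k1.
Qed.

End bounded_measurable.

Section charge_integral_theory.
Context {R : realType} {m : nat}.
Local Notation T := 'rV[R]_m.
Implicit Types (nu : {charge set T -> \bar R}) (f g : T -> R).

Lemma charge_integralD nu f g : bmeas f -> bmeas g ->
  charge_integral nu (fun x => f x + g x) = charge_integral nu f + charge_integral nu g.
Proof.
move=> bf bg; rewrite /charge_integral !RintegralD//; try exact: bmeas_integrable.
by rewrite opprD addrACA.
Qed.

Lemma charge_integralZ nu (c : R) f : bmeas f ->
  charge_integral nu (fun x => c * f x) = c * charge_integral nu f.
Proof.
move=> bf; rewrite /charge_integral !RintegralZl//; try exact: bmeas_integrable.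
by rewrite mulrBr.
Qed.

Lemma charge_integral_indic nu (A : set T) : measurable A ->
  charge_integral nu (\1_A) = fine (nu A).
Proof.
move=> mA; rewrite /charge_integral /Rintegral !integral_indic// !setIT.
rewrite (jordan_decomp (hahnP nu) mA) /cadd /= cscaleN1 fineD ?fineN//.
- exact: (@fin_num_measure _ _ _ (jordan_pos (hahnP nu)) A mA).
- by rewrite fin_numN; exact: (@fin_num_measure _ _ _ (jordan_neg (hahnP nu)) A mA).
Qed.

Lemma charge_integral_bound nu : exists2 K, 0 <= K & forall f (C : R),
  measurable_fun setT f -> (forall x, `|f x| <= C) -> `|charge_integral nu f| <= K * C.
Proof.
exists (fine (jordan_pos (hahnP nu) setT) + fine (jordan_neg (hahnP nu) setT)).
  by rewrite addr_ge0// fine_ge0.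
move=> f C mf HC; rewrite /charge_integral (le_trans (ler_normB _ _))// mulrDl.
by apply: lerD; exact: Rintegral_bmeas_le.
Qed.

(** A linear functional continuous for the uniform norm is determined by its values on indicators,
    as simple functions are uniformly dense. This computes integrals against sums, multiples and
    images of charges without comparing Hahn decompositions. *)
Lemma charge_integral_charac nu (L : (T -> R) -> R) :
  (forall f g, bmeas f -> bmeas g -> L (fun x => f x + g x) = L f + L g) ->
  (forall c f, bmeas f -> L (fun x => c * f x) = c * L f) ->
  (forall A, measurable A -> L (\1_A) = fine (nu A)) ->
  (exists2 K, 0 <= K & forall f (C : R), measurable_fun setT f ->
    (forall x, `|f x| <= C) -> `|L f| <= K * C) ->
  forall f, bmeas f -> charge_integral nu f = L f.
Proof.
move=> LD LZ LI [K1 K10 LB] f bf.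
have [K2 K20 CB] := charge_integral_bound nu.
apply/eqP; rewrite -subr_eq0 -normr_le0; apply/ler_addgt0Pr => e e0.
rewrite add0r.
pose K := K1 + K2 + 1.
have K0 : 0 < K by rewrite ltr_wpDl ?addr_ge0.
have [N [c [A [mA HA]]]] := simple_approx bf (divr_gt0 e0 K0).
pose g x := \sum_(k < N) c k * \1_(A k) x.
have bcA k : bmeas (fun x => c k * \1_(A k) x : R).
  by apply: bmeasM; [exact: bmeas_cst|exact: bmeas_indic].
have bg : bmeas g by apply: bmeas_sum => k; exact: bcA.
have Lg : charge_integral nu g = L g.
  rewrite /g; elim: (index_enum _) => [|k s IH].
    have E : (fun x : T => \sum_(k <- [::] : seq 'I_N) c k * \1_(A k) x) = fun x => 0 * 0.
      by apply/funext => x; rewrite big_nil mul0r.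
    by rewrite E LZ ?charge_integralZ ?mul0r//; exact: bmeas_cst.
  have E : (fun x : T => \sum_(k <- k :: s) c k * \1_(A k) x) =
      fun x => c k * \1_(A k) x + \sum_(k <- s) c k * \1_(A k) x.
    by apply/funext => x; rewrite big_cons.
  have bs : bmeas (fun x : T => \sum_(k <- s : seq 'I_N) c k * \1_(A k) x).
    by apply: bmeas_sum => j; exact: bcA.
  rewrite E LD// charge_integralD// IH LZ ?charge_integralZ//; try exact: bmeas_indic.
  by rewrite LI// charge_integral_indic.
have bng : bmeas (fun x => -1 * g x) by apply: bmeasM => //; exact: bmeas_cst.
have bfg := bmeasD bf bng.
have E1 : charge_integral nu (fun x => f x + -1 * g x) = charge_integral nu f - charge_integral nu g.
  by rewrite charge_integralD// charge_integralZ// mulN1r.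
have E2 : L (fun x => f x + -1 * g x) = L f - L g.
  by rewrite LD// LZ// mulN1r.
have -> : charge_integral nu f - L f =
   charge_integral nu (fun x => f x + -1 * g x) - L (fun x => f x + -1 * g x).
  by rewrite E1 E2 Lg; ring.
rewrite (le_trans (ler_normB _ _))//.
have HA' x : `|f x + -1 * g x| <= e / K by rewrite mulN1r; exact: HA.
apply: (le_trans (lerD (CB _ _ bfg.1 HA') (LB _ _ bfg.1 HA'))).
by rewrite -mulrDl mulrCA ler_piMr ?(ltW e0)// ler_pdivrMr// mul1r /K; lra.
Qed.

End charge_integral_theory.

Section null_outside.
Context {R : realType} {m : nat}.
Local Notation T := 'rV[R]_m.
Implicit Types (nu : {charge set T -> \bar R}) (f g : T -> R).

Definition null_outside (r : R) (nu : set T -> \bar R) :=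
  forall A, measurable A -> A `<=` ~` box r -> nu A = 0%E.

Lemma null_outside_le r s nu : r <= s -> null_outside r nu -> null_outside s nu.
Proof.
move=> rs nr A mA AS; apply: nr => // x Ax bx; apply: (AS x Ax); exact: box_le bx.
Qed.

Lemma null_outside_compact r (nu : set T -> \bar R) :
  null_outside r nu -> compactly_supported nu.
Proof.
move=> nr; apply: (@subclosed_compact _ _ (box r)).
- rewrite -[msupport nu]setCK; apply: open_closedC; rewrite openE => x /=.
  move=> /existsNP[U /not_implyP[oU /not_implyP[Ux nA]]].
  have : nbhs x U by exact: open_nbhs_nbhs.
  by rewrite /interior; apply: filterS => y Uy My; apply: nA; exact: My.
- exact: box_compact.
- move=> x Mx; apply: contrapT => nbx.
  have [A [mA AU]] := Mx _ (closed_openC (@box_closed R m r)) nbx.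
  by rewrite nr// eqxx.
Qed.

(** All measurable subsets are required to be null, since the value of a charge on [U] may vanish by
    cancellation. *)
Definition charge_null nu (U : set T) :=
  measurable U /\ forall A, measurable A -> A `<=` U -> nu A = 0%E.

Lemma charge_null_bigcup nu (U : nat -> set T) :
  (forall k, charge_null nu (U k)) -> charge_null nu (\bigcup_k U k).
Proof.
move=> nU; split; first by apply: bigcup_measurable => k _; exact: (nU k).1.
move=> A mA AU.
have mS k : measurable (seqDU (fun k => A `&` U k) k).
  apply: measurableD; first by apply: measurableI => //; exact: (nU k).1.
  apply: bigsetU_measurable => j _; apply: measurableI => //; exact: (nU j).1.
have -> : A = \bigcup_k seqDU (fun k => A `&` U k) k.
  by rewrite -seqDU_bigcup_eq -setI_bigcupr; apply/esym/setIidl.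
have := @charge_semi_sigma_additive _ _ _ nu _ mS (@trivIset_seqDU _ _) _.
move=> /(_ (bigcup_measurable (fun k _ => mS k))) => H.
apply: (cvg_unique _ H); first exact: ereal_hausdorff.
have -> : (fun k => \sum_(0 <= i < k) nu (seqDU (fun k => A `&` U k) i))%E = cst 0%E.
  apply/funext => k; apply: big1 => i _; apply: (nU i).2 => //.
  by move=> x [[]].
exact: cvg_cst.
Qed.

Lemma charge_null0 nu : charge_null nu set0.
Proof.
by split=> // A _; rewrite subset0 => ->; exact: charge0.
Qed.

Lemma charge_nullS nu (U V : set T) : measurable V -> V `<=` U ->
  charge_null nu U -> charge_null nu V.
Proof. by move=> mV VU [mU nU]; split => // A mA AV; apply: nU => //; exact: subset_trans VU. Qed.

Lemma compact_charge_null nu (K : set T) : compact K -> K `<=` ~` msupport nu ->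
  charge_null nu K.
Proof.
move=> cK KS.
have /choice[U UP] : forall x : T, exists U : set T,
    [/\ open U, (K x -> U x) & charge_null nu U].
  move=> x; have [Kx|nKx] := pselect (K x); last first.
    by exists set0; split; [exact: open0|by []|exact: charge_null0].
  have /existsNP[U /not_implyP[oU /not_implyP[Ux nA]]] := KS _ Kx.
  exists U; split=> //; split; first exact: open_measurable_mx.
  move=> A mA AU; apply/eqP; apply: contrapT => nuA; apply: nA.
  by exists A; split=> //; apply/negP.
have mK : measurable K by rewrite -[K]setCK; apply: measurableC; apply: open_measurable_mx; apply: closed_openC; apply: compact_closed => //; exact: norm_hausdorff.
move: cK; rewrite compact_cover => /(_ T K U) [|x Kx|D DK KD].
- by move=> x _; have [] := UP x.
- by exists x => //; have [_ + _] := UP x; exact.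
apply: (charge_nullS mK KD).
have [s ->] := (finite_seqP _).1 (@finite_fset _ D).
have -> : cover [set` s] U = \bigcup_k (nth set0 [seq U i | i <- s] k).
  apply/seteqP; split=> [x [i /= si Ux]|x [k _]].
    exists (index i s) => //.
    by rewrite (nth_map i) ?index_mem// nth_index.
  have [ks|ks] := ltnP k (size s); last by rewrite nth_default// size_map.
  rewrite (nth_map 0)// => Ux; exists (nth 0 s k) => //.
  by rewrite /= mem_nth.
apply: charge_null_bigcup => k.
have [ks|ks] := ltnP k (size s).
  by rewrite (nth_map 0)//; have [] := UP (nth 0 s k).
by rewrite nth_default ?size_map//; exact: charge_null0.
Qed.

(** Points off the support have null neighbourhoods, so compact sets off the support are null; the
    complement of a large box is covered by countably many of these. *)
Lemma compactly_supported_null_outside nu : compactly_supported nu ->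
  exists2 r, 0 <= r & null_outside r nu.
Proof.
move=> /compact_bounded[M [_ HM]].
pose r0 := `|M + 1|; have r00 : 0 <= r0 by exact: normr_ge0.
have Sr : msupport nu `<=` box r0.
  move=> x Sx; apply: (box_norm x r00).2; apply: le_trans (ler_norm (M + 1)).
  by apply: (HM (M + 1)) => //; rewrite ltrDl.
exists (r0 + 1); first by rewrite addr_ge0.
(* The margin 1 makes these sets closed and still disjoint from the box of radius [r0] containing
   the support. *)
pose K (k : nat) : set T := box k%:R `&` [set x | r0 + 1 <= `|x|].
have cK k : compact (K k).
  apply: (@subclosed_compact _ _ (box k%:R)); [|exact: box_compact|exact: subIsetl].
  apply: closedI; first exact: box_closed.
  rewrite (_ : [set x | _] = (fun x : T => `|x|) @^-1` [set t | r0 + 1 <= t]) //.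
  apply: closed_comp; last exact: closed_ge.
  by move=> x _; exact: norm_continuous.
have KS k : K k `<=` ~` msupport nu.
  move=> x [_ /= rx] /Sr bx.
  have := (box_norm x (normr_ge0 _)).1 bx; rewrite -/r0 => xr.
  by have := le_trans rx xr; rewrite gerDl ler10.
have [mK nK] := charge_null_bigcup (fun k => compact_charge_null (@cK k) (@KS k)).
move=> A mA AB; apply: nK => // x Ax.
exists (Num.bound `|x|) => //; split.
  by apply/box_norm => //; rewrite ltW// archi_boundP.
have := AB x Ax; apply: contra_notP => /negP; rewrite -ltNge => xr.
by apply/box_norm; [rewrite addr_ge0|exact: ltW].
Qed.

(** Gradients of smooth functions may be unbounded; the cut-off makes them [bmeas], the class in
    which charge integrals are linear. Both Jordan parts vanish outside the box, being restrictions
    of [nu] up to sign. *)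
Lemma charge_integral_null_outside nu r f : null_outside r nu -> measurable_fun setT f ->
  charge_integral nu f = charge_integral nu (fun x => f x * \1_(box r) x).
Proof.
move=> nr mf; have mB := @measurable_box R m r.
have mg : measurable_fun setT (fun x : T => f x * \1_(box r) x).
  by apply: measurable_funM => //; exact: measurable_indic.
have ae (mu : {measure set T -> \bar R}) : mu (~` box r) = 0%E ->
    ae_eq mu setT (EFin \o f) (EFin \o (fun x => f x * \1_(box r) x)).
  move=> mu0; exists (~` box r); split=> //; first exact: measurableC.
  by move=> x /= + bx; apply; rewrite indicE mem_set// mulr1.
have [[mP _] [mN _] _ _] := hahnP nu.
have mCB : measurable (~` box r : set T) by exact: measurableC.
have jp0 : jordan_pos (hahnP nu) (~` box r) = 0%E.
  rewrite jordan_posE cjordan_posE /crestr0 mem_set//=.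
  by apply: nr; [exact: measurableI|move=> x []].
have jn0 : jordan_neg (hahnP nu) (~` box r) = 0%E.
  rewrite jordan_negE cjordan_negE /crestr0 mem_set//= -[RHS]oppe0; congr (- _)%E.
  by apply: nr; [exact: measurableI|move=> x []].
rewrite /charge_integral /Rintegral.
rewrite (ae_eq_integral (EFin \o (fun x => f x * \1_(box r) x)) _ measurableT _ _ (ae _ jp0));
  [|exact/measurable_EFinP|exact/measurable_EFinP].
rewrite (ae_eq_integral (EFin \o (fun x => f x * \1_(box r) x)) _ measurableT _ _ (ae _ jn0));
  [|exact/measurable_EFinP|exact/measurable_EFinP].
by [].
Qed.

End null_outside.

Section charge_operations.
Context {R : realType} {m : nat}.
Local Notation T := 'rV[R]_m.
Implicit Types (nu : {charge set T -> \bar R}) (f g : T -> R).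

Lemma charge_integral_cadd nu1 nu2 f : bmeas f ->
  charge_integral (cadd nu1 nu2) f = charge_integral nu1 f + charge_integral nu2 f.
Proof.
move=> bf; apply: (@charge_integral_charac _ _ _
  (fun f => charge_integral nu1 f + charge_integral nu2 f)) => //.
- by move=> g h bg bh; rewrite !charge_integralD// addrACA.
- by move=> c g bg; rewrite !charge_integralZ// -mulrDr.
- by move=> A mA; rewrite !charge_integral_indic// /cadd fineD// fin_num_measure.
- have [K1 K10 H1] := charge_integral_bound nu1.
  have [K2 K20 H2] := charge_integral_bound nu2.
  exists (K1 + K2); first exact: addr_ge0.
  move=> g C mg HC; rewrite (le_trans (ler_normD _ _))// mulrDl.
  by apply: lerD; [exact: H1|exact: H2].
Qed.

Lemma charge_integral_cscale (a : R) nu f : bmeas f ->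
  charge_integral (cscale a nu) f = a * charge_integral nu f.
Proof.
move=> bf; apply: (@charge_integral_charac _ _ _ (fun f => a * charge_integral nu f)) => //.
- by move=> g h bg bh; rewrite !charge_integralD// mulrDr.
- by move=> c g bg; rewrite !charge_integralZ// mulrCA.
- by move=> A mA; rewrite !charge_integral_indic// /cscale fineM// fin_num_measure.
- have [K K0 HK] := charge_integral_bound nu.
  exists (`|a| * K); first exact: mulr_ge0.
  by move=> g C mg HC; rewrite normrM -mulrA ler_wpM2l//; exact: HK.
Qed.

End charge_operations.

(** * Functionals that are divergences *)

Section representation.
Context {R : realType} {n : nat}.
Local Notation H := (heis R n).
Implicit Types (w : hmeasure R n) (f : H -> R) (sigma : (H -> R) -> R).

(** Testing on all bounded measurable fields implies the bound on [hmass], which tests only on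
    [C0_fields], and fits integration against charges given by a density. *)
Definition mass_le w (c : R) := forall phi : H -> 'rV[R]_(n + n),
  (forall i, bmeas (fun x => phi x 0 i)) -> (forall x, hnorm (phi x) <= 1) ->
  `|hpairing w phi| <= c.

(* [sigma] is the horizontal divergence of a compactly supported vector measure
   of mass at most [c]. *)
Definition hdiv_cost sigma (c : R) := exists w (r : R),
  [/\ forall i, null_outside r (w i), forall f, smooth f -> hdiv w f = sigma f
    & mass_le w c].

Lemma bmeas_box (g : H -> R) r : continuous g -> bmeas (fun x => g x * \1_(box r) x).
Proof.
move=> cg; split.
  apply: measurable_funM; first exact: continuous_measurable_real.
  by apply: measurable_indic; exact: measurable_box.
have [C C0 HC] := continuous_box_bounded r cg.
exists C => x; rewrite indicE; have [bx|nbx] := pselect (box r x).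
  by rewrite mem_set// mulr1; exact: HC.
by rewrite memNset// mulr0 normr0.
Qed.


Lemma hpairing_box w r f : (forall i, null_outside r (w i)) -> smooth f ->
  hpairing w (hgrad f) =
  \sum_i charge_integral (w i) (fun x => hgrad f x 0 i * \1_(box r) x).
Proof.
move=> nw sf; apply: eq_bigr => i _; apply: charge_integral_null_outside => //.
by apply: continuous_measurable_real; exact: continuous_hgrad_coord.
Qed.

Lemma hdiv_cost_ext s1 s2 c : (forall f, smooth f -> s1 f = s2 f) ->
  hdiv_cost s1 c -> hdiv_cost s2 c.
Proof.
move=> s12 [w [r [nw dw mw]]]; exists w, r; split=> // f sf.
by rewrite dw// s12.
Qed.

Lemma hdiv_costD s1 s2 c1 c2 : hdiv_cost s1 c1 -> hdiv_cost s2 c2 ->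
  hdiv_cost (fun f => s1 f + s2 f) (c1 + c2).
Proof.
move=> [w1 [r1 [n1 d1 m1]]] [w2 [r2 [n2 d2 m2]]].
pose w : hmeasure R n := fun i => cadd (w1 i) (w2 i).
pose r := Num.max r1 r2.
have n1' i : null_outside r (w1 i) by apply: null_outside_le (n1 i); rewrite le_max lexx.
have n2' i : null_outside r (w2 i) by apply: null_outside_le (n2 i); rewrite le_max lexx orbT.
have nw i : null_outside r (w i).
  by move=> A mA AB; rewrite /w /= /cadd n1'// n2'// adde0.
exists w, r; split=> //.
- move=> f sf; rewrite -d1// -d2// /hdiv (hpairing_box nw)// (hpairing_box n1')//.
  rewrite (hpairing_box n2')// -opprD -big_split /=; congr (- _).
  apply: eq_bigr => i _; rewrite charge_integral_cadd//.
  by apply: bmeas_box; exact: continuous_hgrad_coord.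
- move=> phi bphi phi1.
  have -> : hpairing w phi = hpairing w1 phi + hpairing w2 phi.
    by rewrite -big_split /=; apply: eq_bigr => i _; rewrite charge_integral_cadd.
  by rewrite (le_trans (ler_normD _ _))// lerD// ?m1 ?m2.
Qed.

Lemma hdiv_costZ a s c : hdiv_cost s c -> hdiv_cost (fun f => a * s f) (`|a| * c).
Proof.
move=> [w1 [r [n1 d1 m1]]].
pose w : hmeasure R n := fun i => cscale a (w1 i).
have nw i : null_outside r (w i).
  by move=> A mA AB; rewrite /w /= /cscale n1// mule0.
exists w, r; split=> //.
- move=> f sf; rewrite -d1// /hdiv (hpairing_box nw)// (hpairing_box n1)//.
  rewrite mulrN mulr_sumr; congr (- _).
  apply: eq_bigr => i _; rewrite charge_integral_cscale//.
  by apply: bmeas_box; exact: continuous_hgrad_coord.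
- move=> phi bphi phi1.
  have -> : hpairing w phi = a * hpairing w1 phi.
    by rewrite mulr_sumr; apply: eq_bigr => i _; rewrite charge_integral_cscale.
  by rewrite normrM ler_wpM2l// m1.
Qed.

Lemma hdiv_cost_ge0 s c : hdiv_cost s c -> 0 <= c.
Proof.
move=> [w [r [_ _ mw]]]; apply: le_trans (mw (fun=> 0) _ _).
- exact: normr_ge0.
- move=> i; rewrite (_ : (fun x => _) = fun=> 0); first exact: bmeas_cst.
  by apply/funext => x; rewrite mxE.
- by move=> x; rewrite hnorm0.
Qed.

Lemma C0_fields_continuous (phi : H -> 'rV[R]_(n + n)) i : C0_fields phi ->
  continuous (fun x => phi x 0 i).
Proof.
move=> C0 x; apply/continuous_distP => e e0.
have e3 : 0 < e / 3 by rewrite divr_gt0.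
have [psi [cpsi _] Hpsi] := C0 _ e3.
have cp : {for x, continuous (fun x => psi x 0 i)}.
  apply: (@continuous_comp _ _ _ psi (fun v : 'rV[R]_(n + n) => v 0 i)); first exact: cpsi.
  exact: coord_continuous.
move/continuous_distP: cp => /(_ _ e3); apply: filterS => y Hy.
have h z : `|phi z 0 i - psi z 0 i| <= e / 3.
  by apply: le_trans (Hpsi z); have := hnorm_coord (phi z - psi z) i; rewrite !mxE.
have := h x; have := h y; move: Hy.
rewrite !ler_norml => /andP[? ?] /andP[? ?] /andP[? ?]; apply/andP; split; lra.
Qed.

Lemma mass_le_hmass w c : mass_le w c -> (hmass w <= c%:E)%E.
Proof.
move=> mw; apply: ge_ereal_sup => _ [phi [C0 phi1] <-].
rewrite lee_fin; apply: mw => // i; split.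
  by apply: continuous_measurable_real; exact: C0_fields_continuous.
by exists 1 => x; exact: le_trans (hnorm_coord _ _) (phi1 x).
Qed.

End representation.

(** * Vector measures carried by horizontal segments *)

Section uniform01.
Context {R : realType}.

Definition unif : probability (measurableTypeR R) R := uniform_prob (@ltr01 R).

Lemma Rintegral_unif (f : R -> R) : measurable_fun setT f ->
  \int[unif]_t f t = \int[lebesgue_measure]_(t in `[0, 1]) f t.
Proof.
move=> mf; have mf' : measurable_fun setT (EFin \o f) by exact/measurable_EFinP.
rewrite /Rintegral; congr fine.
rewrite [LHS]integralE [RHS]integralE.
have E g : measurable_fun setT g -> (forall t, 0 <= g t)%E ->
   (\int[unif]_t g t = \int[lebesgue_measure]_(t in `[0%R, 1%R]) g t)%E.
  move=> mg g0; apply: (etrans (integral_uniform (@ltr01 R) mg g0)).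
  by rewrite subr0 invr1 mul1e.
by rewrite !E//; [exact: measurable_funeneg|exact: measurable_funepos].
Qed.

(** The parameter ranges over the whole line, where [f] may be unbounded; the indicator restricts it
    to the segment. *)
Lemma unif_FTC (f F : R -> R) : continuous f ->
  (forall t : R, is_derive t (1:R) F (f t)) ->
  \int[unif]_t (f t * \1_`[0, 1]%classic t) = F 1 - F 0.
Proof.
move=> cf dF.
have mf : measurable_fun setT f by exact: continuous_measurable_fun.
rewrite Rintegral_unif; last first.
  by apply: measurable_funM => //; exact: measurable_indic.
have -> : \int[lebesgue_measure]_(t in `[0, 1]) (f t * \1_`[0, 1]%classic t) =
   \int[lebesgue_measure]_(t in `[0, 1]) f t.
  by apply: eq_Rintegral => t t01; rewrite indicE t01 mulr1.
have cF : continuous F.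
  move=> t; apply/differentiable_continuous/derivable1_diffP.
  exact: (@ex_derive _ _ _ _ _ _ _ (dF t)).
rewrite /Rintegral (@continuous_FTC2 _ f F 0 1 ltr01).
- by rewrite -EFinB.
- exact: continuous_subspaceT.
- split.
  + by move=> t _; exact: (@ex_derive _ _ _ _ _ _ _ (dF t)).
  + by apply: cvg_at_right_filter; exact: cF.
  + by apply: cvg_at_left_filter; exact: cF.
- by move=> t _; rewrite derive1E (@derive_val _ _ _ _ _ _ _ (dF t)).
Qed.

Lemma Rintegral_cst0 d (T : measurableType d) (theta : {measure set T -> \bar R}) :
  \int[theta]_p (0 : R) = 0.
Proof. by rewrite /Rintegral integral0. Qed.

End uniform01.

Section density_charge.
Context {R : realType} d (T : measurableType d) {m : nat}.
Local Notation H := 'rV[R]_m.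
Variables (theta : {finite_measure set T -> \bar R}) (g : T -> R) (h : T -> H).
Hypotheses (bg : bmeas g) (mh : measurable_fun setT h).

Definition density_charge : set H -> \bar R :=
  pushforward (induced_charge (bmeas_integrable theta bg)) h.

Let mpre A : measurable A -> measurable (h @^-1` A).
Proof. by move=> mA; rewrite -[X in measurable X]setTI; exact: mh. Qed.

Let density_charge0 : density_charge set0 = 0%E.
Proof. by rewrite /density_charge /pushforward preimage_set0 charge0. Qed.

Let density_charge_finite A : measurable A -> density_charge A \is a fin_num.
Proof. by move=> mA; apply: fin_num_measure. Qed.

Let density_charge_sigma_additive : semi_sigma_additive density_charge.
Proof.
move=> F mF tF mUF; rewrite /density_charge /pushforward preimage_bigcup.
apply: charge_semi_sigma_additive.
- by move=> k; exact: mpre.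
- apply/trivIsetP => /= i j _ _ ij; rewrite -preimage_setI.
  by move/trivIsetP : tF => /(_ _ _ _ _ ij) ->//; rewrite preimage_set0.
- by rewrite -preimage_bigcup; exact: mpre.
Qed.

HB.instance Definition _ := isCharge.Build _ _ _ density_charge
  density_charge0 density_charge_finite density_charge_sigma_additive.

Lemma bmeas_comp (f : H -> R) : bmeas f -> bmeas (fun p => f (h p)).
Proof.
move=> [mf [C HC]]; split; first exact: measurableT_comp mf mh.
by exists C => p; exact: HC.
Qed.

Lemma density_chargeE A : measurable A ->
  density_charge A = (\int[theta]_p (g p * \1_A (h p)))%:E.
Proof.
move=> mA; rewrite /density_charge /pushforward /induced_charge.
have bgA : bmeas (fun p => g p * \1_A (h p)).
  by apply: bmeasM => //; exact: (bmeas_comp (bmeas_indic mA)).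
rewrite /Rintegral fineK; last exact: integrable_fin_num (bmeas_integrable theta bgA).
rewrite [LHS]integral_mkcond; apply: eq_integral => p _.
rewrite patchE /= indicE; have [Ap|nAp] := pselect (A (h p)).
  by rewrite !mem_set// mulr1.
by rewrite !memNset// mulr0.
Qed.

Lemma charge_integral_density f : bmeas f ->
  charge_integral density_charge f = \int[theta]_p (g p * f (h p)).
Proof.
move=> bf.
have bgf f' : bmeas f' -> bmeas (fun p => g p * f' (h p)).
  by move=> bf'; apply: bmeasM => //; exact: bmeas_comp.
apply: (@charge_integral_charac _ _ _ (fun f => \int[theta]_p (g p * f (h p)))) => //.
- move=> f1 f2 b1 b2; rewrite -RintegralD//; try exact: bmeas_integrable (bgf _ _).
  by apply: eq_Rintegral => p _; rewrite mulrDr.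
- move=> c f1 b1; rewrite -RintegralZl//; try exact: bmeas_integrable (bgf _ _).
  by apply: eq_Rintegral => p _; rewrite mulrCA.
- by move=> A mA; exact: (esym (congr1 fine (density_chargeE mA))).
- have [mg [C HC]] := bg.
  exists (fine (theta setT) * `|C|); first by rewrite mulr_ge0// fine_ge0.
  move=> f1 D mf1 HD; rewrite -mulrA; apply: Rintegral_bmeas_le.
    by apply: measurable_funM => //; exact: measurableT_comp mf1 mh.
  move=> p; rewrite normrM ler_pM//; exact: le_trans (HC p) (ler_norm _).
Qed.

Lemma exists_density_charge : exists nu : {charge set H -> \bar R},
  (forall A, measurable A -> nu A = (\int[theta]_p (g p * \1_A (h p)))%:E) /\
  forall f, bmeas f -> charge_integral nu f = \int[theta]_p (g p * f (h p)).
Proof.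
by eexists; split; [exact: density_chargeE|exact: charge_integral_density].
Qed.

End density_charge.

Lemma hdot_norm_le (R : realType) (n : nat) (a b : 'rV[R]_(n + n)) :
  `|hdot a b| <= hnorm a * hnorm b.
Proof.
rewrite ler_norml hdot_le andbT lerNl.
have -> : - hdot a b = hdot (-1 *: a) b.
  by rewrite -sumrN; apply: eq_bigr => i _; rewrite mxE mulN1r mulNr.
by apply: (le_trans (hdot_le _ _)); rewrite hnormZ normrN normr1 mul1r.
Qed.

Section segment_charge.
Context {R : realType} {n : nat}.
Local Notation H := (heis R n).
Local Notation I01 := (`[0 : R, 1 : R]%classic : set (measurableTypeR R)).
Variables (mu : probability H R) (S : H -> H) (Z : H -> 'rV[R]_(n + n)) (s c : R).
Hypotheses (mS : measurable_fun setT S) (mZ : measurable_fun setT Z).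
Hypotheses (bS : forall x, box s (S x)) (bZ : forall x, hnorm (Z x) <= c).
Local Notation T := (H * measurableTypeR R)%type.

Definition seg_theta : probability T R := (mu \x unif)%E.

Definition seg (p : T) : H := hexp (S p.1) ((p.2 : R) *: Z p.1).

Let mZi i : measurable_fun setT (fun x => Z x 0 i).
Proof.
by apply: (@measurableT_comp _ _ _ _ _ _ (fun v : 'rV[R]_(n + n) => v 0 i) _ Z) => //; exact: measurable_coord.
Qed.

Let mSi j : measurable_fun setT (fun x => S x 0 j).
Proof.
by apply: (@measurableT_comp _ _ _ _ _ _ (fun v : H => v 0 j) _ S) => //; exact: measurable_coord.
Qed.

Let mvel j : measurable_fun setT (fun x => hvel (S x) (Z x) 0 j).
Proof.
case: (split_ordP j) => k ->.
  rewrite (_ : (fun x => _) = (fun x => Z x 0 k))//.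
  by apply/funext => x; exact: hvel_hc.
rewrite (_ : (fun x => _) = (fun x => \sum_i Z x 0 i * hcoef i (S x))); last first.
  by apply/funext => x; rewrite ord1 -/tc hvel_tc.
apply: measurable_sum => i; apply: measurable_funM => //.
apply: (@measurableT_comp _ _ _ _ _ _ (hcoef i) _ S) => //.
by apply: continuous_measurable_real; exact: continuous_hcoef.
Qed.

Lemma measurable_seg : measurable_fun setT seg.
Proof.
apply: measurable_rowP => j; rewrite /seg.
under eq_fun do rewrite hexp_line mxE [X in _ + X]mxE.
apply: measurable_funD.
  exact: (@measurableT_comp _ _ _ _ _ _ (fun x => S x 0 j) _ (@fst H (measurableTypeR R))).
apply: measurable_funM; first exact: measurable_snd.
exact: (@measurableT_comp _ _ _ _ _ _ (fun x => hvel (S x) (Z x) 0 j) _ (@fst H (measurableTypeR R))).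
Qed.

(* The i-th component of the vector measure carrying the image of [mu] under
   [S] to its image under [S exp Z] is the image under [seg] of the measure with
   density [seg_density i]. *)
Definition seg_density i (p : T) : R := Z p.1 0 i * \1_I01 p.2.

Lemma bmeas_seg_density i : bmeas (seg_density i).
Proof.
apply: bmeasM.
  split; first exact: (@measurableT_comp _ _ _ _ _ _ (fun x => Z x 0 i) _ (@fst H (measurableTypeR R))).
  by exists c => p; exact: le_trans (hnorm_coord _ _) (bZ _).
split; last by exists 1 => p; rewrite indicE; case: (_ \in _); rewrite ?normr1 ?normr0.
have mI : measurable I01 by exact: measurable_itv.
have := @measurable_indic _ (measurableTypeR R) R setT I01 mI.
move=> /measurableT_comp /(_ (@measurable_snd _ _ H (measurableTypeR R))).
exact.
Qed.

Lemma box_seg p : I01 p.2 -> box (s + c + (s * c) *+ (n + n)) (seg p).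
Proof.
case: p => x t /=; rewrite in_itv/= => /andP[t0 t1]; rewrite /seg /hexp.
apply: box_hmul => //= i; have c0 : 0 <= c := le_trans (hnorm_ge0 _) (bZ x).
have [k ->|k ->] := split_ordP i.
  rewrite -/(hc k) hembE !mxE normrM (ger0_norm t0).
  by rewrite -[leRHS]mul1r ler_pM//; exact: le_trans (hnorm_coord _ _) (bZ x).
by rewrite ord1 -/tc hemb_tc normr0.
Qed.

(** Integrating the derivative of $f$ along $t\mapsto S(x)\exp(tZ(x))$ shows that $-\int\nabla_H
    f\cdot d\mathbf{w}$ is the value at the start minus the value at the end. The density has norm
    at most $|Z(x)|\le c$ with respect to a probability, which bounds the mass by [c]. *)
Lemma hdiv_cost_seg :
  hdiv_cost (fun f => \int[mu]_x (f (S x) - f (hexp (S x) (Z x)))) c.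
Proof.
have /choice[w Hw] := fun i => exists_density_charge seg_theta (bmeas_seg_density i) measurable_seg.
pose r := s + c + (s * c) *+ (n + n).
have nw i : null_outside r (w i).
  move=> A mA AB; rewrite (Hw i).1//; congr EFin.
  rewrite -[RHS](@Rintegral_cst0 _ _ _ seg_theta); congr (Rintegral _ _ _).
  apply/funext => p; rewrite /seg_density.
  have [p01|np] := pselect (I01 p.2).
    rewrite [\1_A _]indicE memNset ?mulr0// => /AB; apply; exact: box_seg.
  by rewrite [\1_I01 _]indicE memNset// mulr0 mul0r.
exists w, r; split=> //.
- move=> f sf; rewrite /hdiv (hpairing_box nw)//.
  pose G i (p : T) := seg_density i p * (hgrad f (seg p) 0 i * \1_(box r) (seg p)).
  have bG i : bmeas (G i).
    apply: bmeasM; first exact: bmeas_seg_density.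
    have := bmeas_comp measurable_seg (bmeas_box r (continuous_hgrad_coord (i := i) sf)). exact.
  have -> : \sum_i charge_integral (w i) (fun x => hgrad f x 0 i * \1_(box r) x) =
      \sum_i \int[seg_theta]_p G i p.
    apply: eq_bigr => i _; rewrite (Hw i).2//.
    exact: (bmeas_box r (continuous_hgrad_coord (i := i) sf)).
  rewrite -(Rintegral_sum measurableT (index_enum _) (fun i => bmeas_integrable seg_theta (bG i))).
  (* The sum is the derivative of [f] along the segment; the cut-off to the box disappears because
     the segment stays inside it. *)
  have GE p : \sum_i G i p = (\sum_i Z p.1 0 i * hX i f (seg p)) * \1_I01 p.2.
    rewrite mulr_suml; apply: eq_bigr => i _; rewrite /G /seg_density mxE.
    have [p01|np] := pselect (I01 p.2).
      by rewrite [\1_(box r) _]indicE mem_set ?mulr1; [exact: mulrAC|exact: box_seg].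
    by rewrite [\1_I01 _]indicE memNset// !mulr0 mul0r.
  have bGs := bmeas_sum (index_enum _) bG.
  rewrite -mulN1r -RintegralZl//; last exact: bmeas_integrable.
  have bN := bmeasM (bmeas_cst _ (-1)) bGs.
  rewrite /Rintegral -(integral12_prod_meas1 (bmeas_integrable seg_theta bN)).
  congr fine; apply: eq_integral => x _; rewrite /fubini_F /=.
  pose g t := \sum_i Z x 0 i * hX i f (hexp (S x) (t *: Z x)).
  have cg : continuous g.
    move=> t; apply: continuous_bigsum => i.
    have c3 : {for t, continuous (fun t : R => hexp (S x) (t *: Z x))}.
      have -> : (fun t : R => hexp (S x) (t *: Z x)) = (fun t => S x + t *: hvel (S x) (Z x)).
        by apply/funext => r'; rewrite hexp_line.
      have c4 : {for t, continuous (fun _ : R => S x)} by exact: cst_continuous.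
      have c5 : {for t, continuous (fun t : R => t *: hvel (S x) (Z x))} by exact: scalel_continuous.
      exact: continuousD c4 c5.
    have c1 : {for t, continuous (fun _ : R => Z x 0 i)} by exact: cst_continuous.
    have c2 : {for t, continuous (fun t : R => hX i f (hexp (S x) (t *: Z x)))}.
      apply: (@continuous_comp _ _ _ (fun t : R => hexp (S x) (t *: Z x)) (hX i f) t c3); exact: (hX_continuous (i := i) (sf 1%N)).
    exact: continuousM c1 c2.
  have mg : measurable_fun setT (fun t : measurableTypeR R => g t * \1_I01 t).
    apply: measurable_funM; first exact: continuous_measurable_fun.
    by apply: measurable_indic; exact: measurable_itv.
  rewrite (_ : (fun t => _) = (fun t => (-1 * (g t * \1_I01 t))%:E)); last first.
    by apply/funext => t; rewrite GE.
  have bgt : bmeas (fun t : measurableTypeR R => -1 * (g t * \1_I01 t)).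
    apply: bmeasM; first exact: bmeas_cst.
    split=> //; have [C HC] := bN.2.
    exists C => t; have := HC (x, t); rewrite GE normrM normrN normr1 mul1r; exact.
  have iI := bmeas_integrable unif bgt.
  rewrite -[LHS]fineK; last exact: (integrable_fin_num measurableT iI).
  have bgt0 : bmeas (fun t : measurableTypeR R => g t * \1_I01 t).
    by have := bmeasM (bmeas_cst _ (-1)) bgt; under eq_fun do rewrite mulrA mulrNN !mul1r.
  congr EFin; rewrite -/(Rintegral unif setT (fun t => -1 * (g t * \1_I01 t))).
  rewrite RintegralZl//; last exact: bmeas_integrable.
  have dF t : is_derive t (1 : R) (fun t : R => f (hexp (S x) (t *: Z x))) (g t).
    exact: is_derive_hexp (sf 1%N).
  rewrite (unif_FTC cg dF).
  by rewrite scale1r scale0r /hexp /hemb row_mx0 hmulx0; ring.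
- move=> phi bphi phi1; rewrite /hpairing.
  have bG i : bmeas (fun p => seg_density i p * phi (seg p) 0 i).
    apply: bmeasM; first exact: bmeas_seg_density.
    exact: (bmeas_comp measurable_seg (bphi i)).
  under eq_bigr do rewrite (Hw _).2//.
  rewrite -(Rintegral_sum measurableT (index_enum _) (fun i => bmeas_integrable seg_theta (bG i))).
  have [mG _] := bmeas_sum (index_enum _) bG.
  rewrite -[c]mul1r.
  have <- : fine (seg_theta setT) = 1 by rewrite probability_setT.
  apply: Rintegral_bmeas_le => // -[x t].
  have c0 : 0 <= c := le_trans (hnorm_ge0 _) (bZ x).
  rewrite (_ : \sum_i _ = hdot (Z x) (phi (seg (x, t))) * \1_I01 t); last first.
    by rewrite mulr_suml; apply: eq_bigr => i _; rewrite /seg_density /= mulrAC.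
  rewrite normrM -[leRHS]mulr1; apply: ler_pM => //.
    apply: (le_trans (hdot_norm_le _ _)).
    by rewrite -[leRHS]mulr1; apply: ler_pM; rewrite ?hnorm_ge0.
  by rewrite indicE; case: (_ \in _); rewrite ?normr1 ?normr0.
Qed.

End segment_charge.

(** * Transport between images of a probability *)

Section transport.
Context {R : realType} {n : nat}.
Local Notation H := (heis R n).

Definition bmap (S : H -> H) :=
  measurable_fun setT S /\ exists s, forall x, box s (S x).

Lemma bmap_coord (S : H -> H) j : bmap S -> bmeas (fun x => S x 0 j).
Proof.
move=> [mS [s bS]]; split; last by exists s => x; exact: bS.
by apply: (@measurableT_comp _ _ _ _ _ _ (fun v : H => v 0 j) _ S) => //; exact: measurable_coord.
Qed.

Lemma bmeas_bmap (f : H -> R) (S : H -> H) : continuous f -> bmap S -> bmeas (fun x => f (S x)).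
Proof.
move=> cf [mS [s bS]].
have := bmeas_comp mS (bmeas_box s cf); congr bmeas.
by apply/funext => x; rewrite indicE mem_set ?mulr1//; exact: bS.
Qed.

Lemma bmap_hexp (S : H -> H) (Z : H -> 'rV[R]_(n + n)) c :
  measurable_fun setT Z -> (forall x, hnorm (Z x) <= c) -> bmap S ->
  bmap (fun x => hexp (S x) (Z x)).
Proof.
move=> mZ bZ [mS [s bS]]; have c0 : 0 <= c := le_trans (hnorm_ge0 _) (bZ 0).
split.
  have m1 : measurable_fun setT (fun x : H => (x, 1 : measurableTypeR R)).
    by apply: measurable_fun_pair; [exact: measurable_id|exact: measurable_cst].
  have := measurableT_comp (measurable_seg mS mZ) m1; congr measurable_fun.
  by apply/funext => x; rewrite /seg /= scale1r.
exists (s + c + (s * c) *+ (n + n)) => x.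
by have := box_seg bS bZ (p := (x, 1)); rewrite /seg /= scale1r; apply; rewrite in_itv/= ler01 lexx.
Qed.

Variable mu : probability H R.

Definition transport (S T : H -> H) c :=
  hdiv_cost (fun f => \int[mu]_x (f (S x) - f (T x))) c.

Lemma transport_hexp S Z c : measurable_fun setT Z -> (forall x, hnorm (Z x) <= c) ->
  bmap S -> transport S (fun x => hexp (S x) (Z x)) c.
Proof. by move=> mZ bZ [mS [s bS]]; exact: hdiv_cost_seg mS mZ bS bZ. Qed.

Lemma bmap_integral f S T : smooth f -> bmap S -> bmap T ->
  \int[mu]_x (f (S x) - f (T x)) = \int[mu]_x f (S x) - \int[mu]_x f (T x).
Proof.
move=> sf bS bT; have cf : continuous f := (sf 0%N).1.
by rewrite RintegralB//; exact: bmeas_integrable (bmeas_bmap cf _).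
Qed.

Lemma transport_trans S T U c1 c2 : bmap S -> bmap T -> bmap U ->
  transport S T c1 -> transport T U c2 -> transport S U (c1 + c2).
Proof.
move=> bS bT bU h1 h2; apply: hdiv_cost_ext (hdiv_costD h1 h2) => f sf /=.
by rewrite !bmap_integral// addrA subrK.
Qed.

End transport.

Section connect.
Context {R : realType} {n : nat}.
Local Notation H := (heis R n).
Implicit Types x y : H.

Definition hdiff x y : 'rV[R]_(n + n) := \row_i (y 0 (hc i) - x 0 (hc i)).

(** The vertical coordinate of $x^{-1}y$, whose horizontal part is [hdiff x y]. *)
Definition vdiff x y : R := y 0 tc - x 0 tc - hform x y.

Lemma hexp_hdiff x y :
  hexp x (hdiff x y) + vdiff x y *: delta_mx 0 tc = y.
Proof.
have hE : hform x (hemb (hdiff x y)) = hform x y.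
  rewrite -[RHS]subr0 -[X in _ - X](hform_diag x) -[X in _ - X]opprK addrC opprK.
  rewrite addrC -hformNr -hformDr; apply: eq_bigr => i _.
  by rewrite hembE !mxE.
apply: rowHP => [i|].
  by rewrite hexpE mxE [X in X + _]mxE hvel_hc !mxE /hc eq_lrshift andbF mulr0; ring.
rewrite /hexp /hmul mxE [X in X + _]mxE [X in X + _ + _]mxE hemb_tc hE.
by rewrite !mxE !eqxx /vdiff !mulr1; ring.
Qed.

Lemma hexp_commutator x (A B : 'rV[R]_(n + n)) :
  hexp (hexp (hexp (hexp x A) B) (- A)) (- B) =
  x + (2 * hform (hemb A) (hemb B)) *: delta_mx 0 tc.
Proof.
have hN C : hemb (- C) = - hemb C by rewrite -scaleN1r hembZ scaleN1r.
rewrite /hexp !hN; move: (hemb A) (hemb B) => a b.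
have nl c d : hform (- c : H) d = - hform c d by rewrite hform_sym hformNr -hform_sym.
rewrite /hmul !hformDl !hformZl !hform_tl !hformNr !nl !hform_diag (hform_sym b a).
by apply/rowP => k; rewrite !mxE; ring.
Qed.

(** The commutator of sides [a] and [b] along $X_j$ and $X_{n+j}$ thus rises by [a * b], so a height
    $v$ is reached with sides of length $\sqrt{|v|}$. *)
Lemma hform_delta (a b : R) (j : 'I_n) :
  hform (hemb (a *: delta_mx 0 (lshift n j))) (hemb (b *: delta_mx 0 (rshift n j))) = a * b / 2.
Proof.
rewrite !hembZ hformZl hformZr mulrA; congr (_ * _).
rewrite /hform (bigD1 (rshift n j))//= big1 ?addr0 => [|i ij]; last first.
  by rewrite hembE mxE (negPf ij) andbF mulr0.
rewrite hembE mxE !eqxx mulr1 /hcoef -[rshift n j]/(unsplit (inr j)) unsplitK.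
by rewrite -[xc j]/(hc (lshift n j)) hembE mxE !eqxx mul1r.
Qed.

(* Decomposition of an arbitrary displacement into five horizontal segments. *)
Lemma hexp_connect x y (j : 'I_n) :
  let s := Num.sqrt `|vdiff x y| in
  let A := s *: delta_mx 0 (lshift n j) in
  let B := (Num.sg (vdiff x y) * s) *: delta_mx 0 (rshift n j) in
  hexp (hexp (hexp (hexp (hexp x (hdiff x y)) A) B) (- A)) (- B) = y.
Proof.
move=> s A B; rewrite hexp_commutator hform_delta.
rewrite -[RHS](hexp_hdiff x y); congr (_ + _ *: _).
have -> : 2 * (s * (Num.sg (vdiff x y) * s) / 2) = Num.sg (vdiff x y) * s ^+ 2.
  by move: (Num.sg _) => e; field.
by rewrite sqr_sqrtr// -numEsg.
Qed.

End connect.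

Section transport_connect.
Context {R : realType} {n : nat}.
Local Notation H := (heis R n).
Variable mu : probability H R.
Hypothesis n_ge1 : (1 <= n)%N.

Lemma measurable_hform (S T : H -> H) : bmap S -> bmap T ->
  measurable_fun setT (fun x => hform (S x) (T x)).
Proof.
move=> bS bT; apply: measurable_sum => i; apply: measurable_funM.
  have [h _] := bmeas_bmap (continuous_hcoef (i := i)) bS; exact: h.
exact: (bmap_coord _ bT).1.
Qed.

(** The five segments joining [S x] to [T x] are chosen measurably in [x] and followed one after the
    other: one of length at most [c1], four of length at most [c2]. *)
Lemma transport_connect S T c1 c2 : bmap S -> bmap T ->
  (forall x, hnorm (hdiff (S x) (T x)) <= c1) ->
  (forall x, Num.sqrt `|vdiff (S x) (T x)| <= c2) ->
  transport mu S T (c1 + c2 + c2 + c2 + c2).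
Proof.
move=> bS bT H1 H2; pose j := Ordinal n_ge1.
have mv : measurable_fun setT (fun x => vdiff (S x) (T x)).
  apply: measurable_funB; last exact: measurable_hform.
  by apply: measurable_funB; exact: (bmap_coord _ _).1.
pose s x := Num.sqrt `|vdiff (S x) (T x)|.
have msqrt : measurable_fun setT (@Num.sqrt R).
  by apply: continuous_measurable_fun; exact: sqrt_continuous.
have ms : measurable_fun setT s.
  by apply: (measurableT_comp msqrt); exact: measurableT_comp.
pose s' x := Num.sg (vdiff (S x) (T x)) * s x.
have ms' : measurable_fun setT s'.
  (* Since [Num.sqrt] is 0 on negative numbers, the signed root is a difference of continuous
     functions of [vdiff], which gives measurability despite the jump of [Num.sg]. *)
  have -> : s' = fun x => Num.sqrt (vdiff (S x) (T x)) - Num.sqrt (- vdiff (S x) (T x)).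
    apply/funext => x; rewrite /s' /s; move: (vdiff _ _) => v.
    have [v0|v0|->] := ltrgtP v 0.
    - by rewrite ltr0_sg// ltr0_norm// (ler0_sqrtr (ltW v0)) mulN1r sub0r.
    - by rewrite gtr0_sg// gtr0_norm// (@ler0_sqrtr _ (- v)) ?oppr_le0 ?ltW// mul1r subr0.
    - by rewrite sgr0 mul0r oppr0 subrr.
  apply: measurable_funB; apply: (measurableT_comp msqrt) => //.
  exact: measurableT_comp.
have mZ (a : H -> R) i : measurable_fun setT a ->
    measurable_fun setT (fun x => a x *: delta_mx 0 i : 'rV[R]_(n + n)).
  move=> ma; apply: measurable_rowP => k; under eq_fun do rewrite mxE.
  by apply: measurable_funM => //; exact: measurable_cst.
have mN (Z : H -> 'rV[R]_(n + n)) : measurable_fun setT Z -> measurable_fun setT (fun x => - Z x).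
  move=> mZ0; apply: measurable_rowP => k; under eq_fun do rewrite mxE.
  apply: measurableT_comp => //.
  by apply: (@measurableT_comp _ _ _ _ _ _ (fun v : 'rV[R]_(n + n) => v 0 k) _ Z) => //; exact: measurable_coord.
pose A x : 'rV[R]_(n + n) := s x *: delta_mx 0 (lshift n j).
pose B x : 'rV[R]_(n + n) := s' x *: delta_mx 0 (rshift n j).
have md : measurable_fun setT (fun x => hdiff (S x) (T x)).
  apply: measurable_rowP => k; under eq_fun do rewrite mxE.
  by apply: measurable_funB; exact: (bmap_coord _ _).1.
have nN (Z : 'rV[R]_(n + n)) : hnorm (- Z) = hnorm Z.
  by rewrite -scaleN1r hnormZ normrN normr1 mul1r.
have nA x : hnorm (A x) <= c2.
  by rewrite hnormZ hnorm_delta mulr1 ger0_norm ?sqrtr_ge0//; exact: H2.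
have nB x : hnorm (B x) <= c2.
  rewrite hnormZ hnorm_delta mulr1 normrM (ger0_norm (sqrtr_ge0 _)).
  apply: le_trans (H2 x); rewrite ler_piMl ?sqrtr_ge0// normr_sg.
  by case: (_ == _).
pose S1 x := hexp (S x) (hdiff (S x) (T x)).
pose S2 x := hexp (S1 x) (A x).
pose S3 x := hexp (S2 x) (B x).
pose S4 x := hexp (S3 x) (- A x).
have b1 : bmap S1 by exact: bmap_hexp H1 bS.
have b2 : bmap S2 by apply: bmap_hexp nA b1; exact: mZ.
have b3 : bmap S3 by apply: bmap_hexp nB b2; exact: mZ.
have nNA x : hnorm (- A x) <= c2 by rewrite nN.
have nNB x : hnorm (- B x) <= c2 by rewrite nN.
have b4 : bmap S4 by apply: bmap_hexp nNA b3; apply: mN; exact: mZ.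
have E : T = fun x => hexp (S4 x) (- B x).
  by apply/funext => x; rewrite -[LHS](hexp_connect (S x) _ j).
apply: (transport_trans bS b4 bT).
  apply: (transport_trans bS b3 b4).
    apply: (transport_trans bS b2 b3).
      apply: (transport_trans bS b1 b2); first exact: transport_hexp.
      by apply: transport_hexp => //; exact: mZ.
    by apply: transport_hexp => //; exact: mZ.
  by apply: transport_hexp => //; apply: mN; exact: mZ.
by rewrite E; apply: transport_hexp => //; apply: mN; exact: mZ.
Qed.

End transport_connect.

(** * Hahn-Banach and the potential *)

Section hahn_banach.
Context {R : realType} {V : lmodType R}.
(* [C] encodes the sublinear function [p x = inf [set c | C x c]], which is
   finite on the subspace of those [x] with [C x c] for some [c]. *)
Variable C : V -> R -> Prop.
Hypothesis C_ge0 : forall x c, C x c -> 0 <= c.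
Hypothesis CD : forall x y c d, C x c -> C y d -> C (x + y) (c + d).
Hypothesis CZ : forall a x c, C x c -> C (a *: x) (`|a| * c).

(* Graphs of partial linear functionals bounded by [p]; that such a graph is
   single-valued is automatic, see [graph_le_fun]. *)
Definition graph_le (G : set (V * R)) :=
  (forall (a : R) x y s t, G (x, s) -> G (y, t) -> G (a *: x + y, a * s + t)) /\
  (forall x s, G (x, s) -> (exists c, C x c) /\ forall c, C x c -> s <= c).

Lemma graph_le0 G x s : graph_le G -> G (x, s) -> G (0, 0).
Proof.
move=> [GL _] Gx; have := GL (-1) _ _ _ _ Gx Gx.
by rewrite scaleN1r addNr mulN1r addNr.
Qed.

Lemma graph_leZ G a x s : graph_le G -> G (x, s) -> G (a *: x, a * s).
Proof.
move=> gG Gx; have := gG.1 a _ _ _ _ Gx (graph_le0 gG Gx).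
by rewrite !addr0.
Qed.

Lemma graph_le_fun G x s t : graph_le G -> G (x, s) -> G (x, t) -> s = t.
Proof.
move=> gG Gs Gt.
suff W s' t' : G (x, s') -> G (x, t') -> s' <= t' by apply/eqP; rewrite eq_le !W.
move=> {}Gs {}Gt; have := gG.1 (-1) _ _ _ _ Gt Gs.
rewrite scaleN1r addNr => /gG.2[_ H]; rewrite -subr_le0 addrC -mulN1r; apply: H.
have [[c Cx] _] := gG.2 _ _ Gs.
by have := CZ 0 Cx; rewrite scale0r normr0 mul0r.
Qed.

(** The value at [y] must lie above every [a - c] with [C (x - y) c] and below every [c - a] with
    [C (x + y) c], for [(x, a)] in [G]. Subadditivity makes the two families compatible, and the
    infimum of the second is taken. *)
Lemma graph_le_extend G y d : graph_le G -> G (0, 0) -> C y d ->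
  exists2 G', graph_le G' & G `<=` G' /\ exists s, G' (y, s).
Proof.
move=> gG G0 Cy.
pose U := [set u | exists x a c, [/\ G (x, a), C (x + y) c & u = c - a]].
have U0 : U !=set0 by exists (d - 0), 0, 0, d; rewrite add0r.
have lbU x a c : G (x, a) -> C (x - y) c -> lbound U (a - c).
  move=> Gx Cx _ [x' [a' [c' [Gx' Cx' ->]]]].
  have := gG.1 1 _ _ _ _ Gx Gx'; rewrite scale1r mul1r => /gG.2[_ /(_ (c + c'))].
  have := CD Cx Cx'; rewrite addrACA addNr addr0 => h /(_ h); lra.
have hU : has_inf U.
  split=> //; exists (0 - d); apply: (lbU 0 0 d) => //.
  by have := CZ (-1) Cy; rewrite normrN normr1 mul1r scaleN1r sub0r.
pose s := inf U.
exists [set p | exists x a (t : R), [/\ G (x, a), p.1 = x + t *: y & p.2 = a + t * s]].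
  split.
    move=> a x1 x2 s1 s2 [z1 [a1 [t1 [/= G1 -> ->]]]] [z2 [a2 [t2 [/= G2 -> ->]]]].
    exists (a *: z1 + z2), (a * a1 + a2), (a * t1 + t2); split.
    - exact: gG.1.
    - by rewrite /= scalerDr scalerDl scalerA addrACA.
    - by rewrite /=; ring.
  move=> _ _ [x [a [t [/= Gx -> ->]]]]; split.
    by have [[c Cx] _] := gG.2 _ _ Gx; exists (c + `|t| * d); apply: CD => //; exact: CZ.
  move=> c Cc; have [t0|t0|t0] := ltrgtP t 0.
  - have nt0 : 0 < - t by rewrite oppr_gt0.
    have := lbU ((- t)^-1 *: x) ((- t)^-1 * a) ((- t)^-1 * c) (graph_leZ _ gG Gx).
    have E : (- t)^-1 *: x - y = (- t)^-1 *: (x + t *: y).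
      by rewrite scalerDr scalerA invrN mulNr mulVf ?lt_eqF// scaleN1r.
    rewrite E; have := CZ (- t)^-1 Cc; rewrite ger0_norm ?invr_ge0 ?(ltW nt0)// => h /(_ h).
    move=> /(lb_le_inf U0); rewrite -/s -mulrBr ler_pdivrMl// => ?; lra.
  - have : s <= t^-1 * c - t^-1 * a.
      apply: (ge_inf hU.2); exists (t^-1 *: x), (t^-1 * a), (t^-1 * c); split=> //.
        exact: graph_leZ.
      have -> : t^-1 *: x + y = t^-1 *: (x + t *: y).
        by rewrite scalerDr scalerA mulVf ?gt_eqF// scale1r.
      by have := CZ t^-1 Cc; rewrite ger0_norm ?invr_ge0 ?(ltW t0).
    rewrite -mulrBr ler_pdivlMl// => ?; lra.
  - move: Cc; rewrite t0 scale0r mul0r !addr0 => Cc.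
    by have [_] := gG.2 _ _ Gx; apply.
split.
  by move=> [x a] Gx; exists x, a, 0; rewrite scale0r mul0r !addr0.
by exists s, 0, 0, 1; rewrite scale1r mul1r !add0r.
Qed.

Lemma Hahn_Banach x0 c0 : C x0 c0 ->
  exists l : V -> R,
    [/\ forall (a : R) x y c d, C x c -> C y d -> l (a *: x + y) = a * l x + l y,
        forall x c, C x c -> l x <= c & l x0 = inf [set c | C x0 c]].
Proof.
move=> Cx0; set p0 := inf _.
have hp0 : has_inf [set c | C x0 c].
  by split; [exists c0|exists 0 => c /C_ge0].
have p0_ge0 : 0 <= p0 by apply: lb_le_inf; [exists c0|move=> c /C_ge0].
(* The condition at [x0] is imposed on nonempty graphs only, so that the union of the empty chain
   qualifies. A maximal graph is then shown to be nonempty by comparison with the line through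
   [(x0, p0)]. *)
pose P G := graph_le G /\ (forall p, G p -> G (x0, p0)).
have [|G [[gG G0] maxG]] := @Zorn_bigcup (V * R)%type P.
  move=> F FP totF; split; last first.
    by move=> p [G FG Gp]; exists G => //; exact: (FP _ FG).2 Gp.
  split; last by move=> x s [G FG Gx]; exact: (FP _ FG).1.2.
  move=> a x y s t [G1 F1 Gx] [G2 F2 Gy].
  have [S|S] := totF _ _ F1 F2.
    by exists G2 => //; apply: (FP _ F2).1.1 => //; exact: S.
  by exists G1 => //; apply: (FP _ F1).1.1 => //; exact: S.
have Gx0 : G (x0, p0).
  apply: contrapT => nG.
  have Gset0 : G = set0 by apply/seteqP; split=> // p /G0.
  apply: (maxG [set p | exists t : R, p = (t *: x0, t * p0)]).
    rewrite Gset0; split=> // /(_ (1 *: x0, 1 * p0)); apply.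
    by exists 1.
  split; last by move=> _ _; exists 1; rewrite scale1r mul1r.
  split.
    move=> a x y s t [t1 [-> ->]] [t2 [-> ->]]; exists (a * t1 + t2).
    by rewrite scalerA -scalerDl mulrA -mulrDl.
  move=> _ _ [t [-> ->]]; split; first by exists (`|t| * c0); exact: CZ.
  move=> c Cc; have [t0|t0] := leP t 0.
    by rewrite (le_trans (mulr_le0_ge0 t0 p0_ge0))// (C_ge0 Cc).
  rewrite -ler_pdivlMl//; apply: (ge_inf hp0.2).
  have := CZ t^-1 Cc; rewrite scalerA mulVf ?gt_eqF// scale1r.
  by rewrite ger0_norm// invr_ge0 ltW.
have Gdom y d : C y d -> exists s, G (y, s).
  move=> Cy; have [G' gG' [GG' [s Gs]]] := graph_le_extend gG (graph_le0 gG Gx0) Cy.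
  exists s; apply: contrapT => nGs; apply: (maxG G').
    by split=> // /(_ _ Gs).
  by split=> // _ _; exact: GG'.
(* The value 0 off the domain of [G] is arbitrary; linearity is claimed only where [C] gives a
   finite bound. *)
pose l x := if pselect (exists s, G (x, s)) is left e then sval (cid e) else 0.
have lP x c : C x c -> G (x, l x).
  by rewrite /l => /Gdom Gx; case: pselect => // e; exact: (svalP (cid e)).
exists l; split.
- move=> a x y c d Cx Cy; apply: (graph_le_fun gG (lP _ _ (CD (CZ a Cx) Cy))).
  by apply: gG.1; [exact: lP Cx|exact: lP Cy].
- by move=> x c Cx; have [_] := gG.2 _ _ (lP _ _ Cx); apply.
- exact: (graph_le_fun gG (lP _ _ Cx0) Gx0).
Qed.

End hahn_banach.

(** * Reduction to bounded maps and to finitely many points *)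

Section restriction.
Context {R : realType} {n : nat}.
Local Notation H := (heis R n).

(** A bounded map equal to the identity almost everywhere for a measure carried by the box: it
    stands for the identity where a [bmap] is required. *)
Definition clip (q : R) (x : H) : H := \1_(box q) x *: x.

Lemma clip_box q x : box q x -> clip q x = x.
Proof. by move=> bx; rewrite /clip indicE mem_set// scale1r. Qed.

Lemma box_clip q x : 0 <= q -> box q (clip q x).
Proof.
move=> q0; have [bx|nbx] := pselect (box q x); first by rewrite clip_box.
by rewrite /clip indicE memNset// scale0r => i; rewrite mxE normr0.
Qed.

Lemma bmap_clip q : 0 <= q -> bmap (clip q).
Proof.
move=> q0; split; last by exists q => x; exact: box_clip.
apply: measurable_rowP => j; under eq_fun do rewrite mxE.
apply: measurable_funM; last exact: measurable_coord.
by apply: measurable_indic; exact: measurable_box.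
Qed.

Lemma bmap_cst (x : H) : bmap (fun=> x).
Proof.
split; first exact: measurable_cst.
by exists `|x| => _; apply/box_norm.
Qed.

Lemma Rintegral_clip (mu : probability H R) q (g : H -> R) : 0 <= q ->
  null_outside q mu -> measurable_fun setT g ->
  \int[mu]_x g (clip q x) = \int[mu]_x g x.
Proof.
move=> q0 nq mg; have mB := @measurable_box R (n + n + 1) q.
have mu0 : mu (~` box q) = 0%E by apply: nq => //; exact: measurableC.
rewrite /Rintegral; congr fine; apply: ae_eq_integral => //.
- apply/measurable_EFinP; apply: measurableT_comp => //; exact: (bmap_clip q0).1.
- exact/measurable_EFinP.
- exists (~` box q); split=> //; first exact: measurableC.
  by move=> x /= + bx; apply; rewrite clip_box.
Qed.

Lemma probability_null_outside (mu : probability H R) : compactly_supported mu ->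
  exists2 q, 0 <= q & null_outside q mu.
Proof.
move=> cm.
exact: (@compactly_supported_null_outside _ _ (charge_of_finite_measure mu) cm).
Qed.

End restriction.

Section discretisation.
Context {R : realType} {n : nat}.
Local Notation H := (heis R n).
Variable U : H -> set H.
Hypothesis mU : forall z, measurable (U z).

Definition pick_in (zs : seq H) (x : H) : H :=
  nth 0 zs (find (fun z => `[< U z x >]) zs).

Lemma pick_inP zs x z : z \in zs -> U z x -> U (pick_in zs x) x.
Proof.
move=> zzs Uz; apply/asboolP; rewrite /pick_in (@nth_find _ 0 (fun z => `[< U z x >]))//.
by apply/hasP; exists z => //; exact/asboolP.
Qed.

Lemma measurable_find zs k :
  measurable [set x | find (fun z => `[< U z x >]) zs = k].
Proof.
elim: zs k => [|z zs IH] k /=.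
  have [->|k0] := eqVneq k 0%N; first by rewrite (_ : [set _ | _] = setT)//; exact/seteqP.
  rewrite (_ : [set _ | _] = set0)//; apply/seteqP; split => // x /= E.
  by rewrite -E eqxx in k0.
case: k => [|k].
  rewrite (_ : [set _ | _] = U z)//; apply/seteqP; split => x /=.
    by case: asboolP.
  by move=> Uz; rewrite asboolT.
rewrite (_ : [set _ | _] = ~` U z `&` [set x | find (fun z => `[< U z x >]) zs = k]).
  by apply: measurableI; [exact: measurableC|exact: IH].
apply/seteqP; split => x /=; first by case: asboolP => // nU [].
by move=> [nU ->]; rewrite asboolF.
Qed.

(** The extra index [size zs] accounts for the points lying in no [U z], which are sent to the
    default value 0 of [nth]. *)
Lemma pick_in_sum zs (f : H -> R) x : f (pick_in zs x) =
  \sum_(k < (size zs).+1)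
    f (nth 0 zs k) * \1_[set x | find (fun z => `[< U z x >]) zs = k] x.
Proof.
have lt : (find (fun z => `[< U z x >]) zs < (size zs).+1)%N by rewrite ltnS find_size.
rewrite (bigD1 (Ordinal lt))//= big1 ?addr0 => [|k kE].
  by rewrite indicE mem_set ?mulr1.
rewrite indicE memNset ?mulr0//= => E; case/eqP: kE; exact/val_inj.
Qed.

Lemma bmeas_pick_in zs (f : H -> R) : bmeas (fun x => f (pick_in zs x)).
Proof.
under eq_fun do rewrite pick_in_sum.
apply: bmeas_sum => k; apply: bmeasM; first exact: bmeas_cst.
by apply: bmeas_indic; exact: measurable_find.
Qed.

Lemma bmap_pick_in zs : bmap (pick_in zs).
Proof.
split; first by apply: measurable_rowP => i; exact: (bmeas_pick_in zs (fun z => z 0 i)).1.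
have [_ [s Hs]] := bmeas_pick_in zs (fun z => `|z|).
exists s => x; have := Hs x; rewrite normr_id => h.
by apply/box_norm => //; exact: le_trans (normr_ge0 _) h.
Qed.

Lemma Rintegral_pick_in (mu : probability H R) zs (f : H -> R) :
  \int[mu]_x f (pick_in zs x) = \sum_(k < (size zs).+1)
    fine (mu [set x | find (fun z => `[< U z x >]) zs = k]) * f (nth 0 zs k).
Proof.
pose A k := [set x | find (fun z => `[< U z x >]) zs = k].
have bA k : bmeas (\1_(A k) : H -> R) by apply: bmeas_indic; exact: measurable_find.
under eq_Rintegral do rewrite pick_in_sum.
rewrite (Rintegral_sum measurableT); last first.
  by move=> k; apply: bmeas_integrable; apply: bmeasM (bA _); exact: bmeas_cst.
apply: eq_bigr => k _; rewrite RintegralZl//.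
  by rewrite mulrC /Rintegral integral_indic ?setIT//; exact: measurable_find.
exact: (bmeas_integrable mu (bA k)).
Qed.

End discretisation.

Lemma compact_pick (R : realType) (n : nat) (U : heis R n -> set (heis R n)) q :
  (forall z, open (U z)) -> (forall z, U z z) ->
  exists zs, forall x, box q x -> U (pick_in U zs x) x.
Proof.
move=> oU Uz; have := @box_compact R (n + n + 1) q; rewrite compact_cover.
case/(_ _ setT U) => [z _|x bx|D _ KD].
- exact: oU.
- by exists x.
have [s sE] := (finite_seqP _).1 (@finite_fset _ D).
rewrite sE in KD; exists s => x bx; have [z Dz Uzx] := KD x bx.
exact: pick_inP Uzx.
Qed.

Section cc_bound.
Context {R : realType} {n : nat}.
Local Notation H := (heis R n).
Implicit Types x y z : H.

(* An upper bound for the Carnot-Caratheodory distance, coming from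
   [hexp_connect]; it is not symmetric. *)
Definition cc_bound x y : R := let s := Num.sqrt `|vdiff x y| in
  hnorm (hdiff x y) + s + s + s + s.

Lemma cc_boundxx x : cc_bound x x = 0.
Proof.
rewrite /cc_bound /vdiff subrr hform_diag subr0 normr0 sqrtr0 !addr0.
by rewrite (_ : hdiff x x = 0) ?hnorm0//; apply/rowP => i; rewrite !mxE subrr.
Qed.

Lemma cc_bound_hnorm x y : hnorm (hdiff x y) <= cc_bound x y.
Proof. by rewrite /cc_bound; have := sqrtr_ge0 `|vdiff x y|; lra. Qed.

Lemma cc_bound_sqrt x y : Num.sqrt `|vdiff x y| <= cc_bound x y.
Proof. by rewrite /cc_bound; have := sqrtr_ge0 `|vdiff x y|; have := hnorm_ge0 (hdiff x y); lra. Qed.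

Lemma continuous_cc_bound z : continuous (fun x => cc_bound x z).
Proof.
have c1 : continuous (fun x => hnorm (hdiff x z)).
  move=> x; apply: (@continuous_comp _ _ _ (fun x => hdiff x z) (@hnorm R n)); last exact: continuous_hnorm.
  suff: continuous (fun x => hdiff x z) by apply.
  apply: continuous_mxP => k {}x.
  have -> : (fun x => hdiff x z 0 k) = (fun x => z 0 (hc k) - x 0 (hc k)).
    by apply/funext => y; rewrite mxE.
  exact: continuousB (@cst_continuous _ _ (z 0 (hc k)) x) (@coord_continuous R _ _ 0 (hc k) x).
have c2 : continuous (fun x => Num.sqrt `|vdiff x z|).
  move=> x; have cv : {for x, continuous (fun x => vdiff x z)}.
    have k1 := continuousB (@cst_continuous _ _ (z 0 tc) x) (@coord_continuous R _ _ 0 tc x).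
    exact: continuousB k1 (@continuous_hforml _ _ z x).
  apply: (@continuous_comp _ _ _ (fun x => `|vdiff x z|) (@Num.sqrt R)); last exact: sqrt_continuous.
  by apply: (@continuous_comp _ _ _ (fun x => vdiff x z) (fun t : R => `|t|)); [exact: cv|exact: norm_continuous].
move=> x; have a1 := continuousD (c1 x) (c2 x).
have a2 := continuousD a1 (c2 x).
exact: continuousD (continuousD a2 (c2 x)) (c2 x).
Qed.

End cc_bound.

Lemma Rintegral_probability_cst (R : realType) d (T : measurableType d)
  (mu : probability T R) (c : R) : \int[mu]_x c = c.
Proof.
rewrite Rintegral_cst// -[RHS]mulr1; congr (_ * _).
exact: (congr1 fine (probability_setT mu)).
Qed.

(** * The potential of a dominated linear functional *)

Section potential.
Context {R : realType} {n : nat}.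
Local Notation H := (heis R n).
Hypothesis n_ge1 : (1 <= n)%N.
Variable l : ((H -> R) -> R) -> R.
Hypothesis lL : forall (a : R) s t c d, hdiv_cost s c -> hdiv_cost t d ->
  l (fun f => a * s f + t f) = a * l s + l t.
Hypothesis l_le : forall s c, hdiv_cost s c -> l s <= c.

Implicit Types (s t : (H -> R) -> R) (x y z : H).

Let l_abs s c : hdiv_cost s c -> `|l s| <= c.
Proof.
move=> sc; rewrite ler_norml l_le// andbT lerNl.
have h0 := hdiv_costZ 0 sc; have hN := hdiv_costZ (-1) sc.
have l0 : l (fun f => 0 * s f) = 0.
  have := lL 1 h0 h0; rewrite mul1r.
  rewrite (_ : (fun f => _) = fun f => 0 * s f); last by apply/funext => f; ring.
  by move=> E; apply: (addrI (l (fun f => 0 * s f))); rewrite -E addr0.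
have := lL (-1) sc h0; rewrite l0 addr0 mulN1r => <-.
rewrite (_ : (fun f => _) = fun f => -1 * s f); last by apply/funext => f; ring.
by have := l_le hN; rewrite normrN normr1 mul1r.
Qed.

(** Here [s] and [t] are functions of arbitrary [f] and may differ when [f] is not smooth. Their
    difference vanishes on smooth functions, so it has cost 0 and [l] kills it. *)
Let l_ext s t c : hdiv_cost s c -> (forall f, smooth f -> s f = t f) -> l s = l t.
Proof.
move=> sc st; have tc := hdiv_cost_ext st sc.
have h0 : hdiv_cost (fun f => -1 * s f + t f) 0.
  have := hdiv_costZ 0 sc; rewrite normr0 mul0r; apply: hdiv_cost_ext => f sf.
  by rewrite st//; ring.
have := l_abs h0; rewrite normr_le0 (lL _ sc tc) mulN1r addrC subr_eq0.
by move=> /eqP.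
Qed.

(** The probability [mu] is arbitrary: its images under constant maps are Dirac masses. *)
Lemma point_cost (mu : probability H R) x y : hdiv_cost (fun f => f x - f y) (cc_bound x y).
Proof.
have := transport_connect mu n_ge1 (bmap_cst x) (bmap_cst y)
  (fun=> lexx _) (fun=> lexx _).
apply: hdiv_cost_ext => f _.
exact: (Rintegral_probability_cst mu (f x - f y)).
Qed.

Lemma point_hexp_cost (mu : probability H R) x Z :
  hdiv_cost (fun f => f x - f (hexp x Z)) (hnorm Z).
Proof.
have := transport_hexp mu (measurable_cst Z) (fun=> lexx (hnorm Z)) (bmap_cst x).
apply: hdiv_cost_ext => f _.
exact: (Rintegral_probability_cst mu (f x - f (hexp x Z))).
Qed.

Variable mu0 : probability H R.

Definition potential x := l (fun f => f x - f 0).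

Lemma potentialB x y : potential x - potential y = l (fun f => f x - f y).
Proof.
rewrite /potential addrC -mulN1r -(lL _ (point_cost mu0 y 0) (point_cost mu0 x 0)).
by congr l; apply/funext => f; ring.
Qed.

Lemma potential_le x y : `|potential x - potential y| <= cc_bound x y.
Proof. by rewrite potentialB; apply: l_abs; exact: point_cost. Qed.

Lemma potential_hexp x Z : `|potential (hexp x Z) - potential x| <= hnorm Z.
Proof. by rewrite distrC potentialB; apply: l_abs; exact: point_hexp_cost. Qed.

Lemma continuous_potential : continuous potential.
Proof.
move=> x; apply/continuous_distP => e e0.
have := (@continuous_distP _ _ _ _).1 (@continuous_cc_bound R n x x) e e0.
apply: filterS => y; rewrite cc_boundxx sub0r normrN => H1.
by rewrite distrC; apply: le_trans (potential_le _ _) (le_trans (ler_norm _) H1).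
Qed.

Lemma l_sum (I : Type) (s : seq I) (a : I -> R) (z : I -> H) :
  (exists c, hdiv_cost (fun f => \sum_(k <- s) a k * (f (z k) - f 0)) c) /\
  l (fun f => \sum_(k <- s) a k * (f (z k) - f 0)) = \sum_(k <- s) a k * potential (z k).
Proof.
elim: s => [|k s [[c hc] IH]].
  have h0 := hdiv_costZ 0 (point_cost mu0 0 0).
  have E : (fun f : H -> R => \sum_(k <- [::]) a k * (f (z k) - f 0)) = (fun f => 0 * (f 0 - f 0)).
    by apply/funext => f; rewrite big_nil mul0r.
  rewrite E big_nil; split; first by eexists; exact: h0.
  apply/eqP; rewrite -normr_le0; have := l_abs h0.
  by rewrite normr0 mul0r.
have E : (fun f : H -> R => \sum_(k <- k :: s) a k * (f (z k) - f 0)) =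
  (fun f => a k * (f (z k) - f 0) + \sum_(k <- s) a k * (f (z k) - f 0)).
  by apply/funext => f; rewrite big_cons.
have h1 := point_cost mu0 (z k) 0.
rewrite E big_cons; split; first by eexists; exact: hdiv_costD (hdiv_costZ (a k) h1) hc.
by rewrite (lL _ h1 hc) IH.
Qed.

Section measure.
Variables (mu : probability H R) (q : R).
Hypotheses (q0 : 0 <= q) (nq : null_outside q mu).

Lemma smooth_clip f : smooth f -> \int[mu]_x f (clip q x) = \int[mu]_x f x.
Proof.
by move=> sf; apply: Rintegral_clip => //; apply: continuous_measurable_real; exact: (sf 0%N).1.
Qed.

Lemma measure_cost : exists c, hdiv_cost (fun f => \int[mu]_x f x - f 0) c.
Proof.
have [c c0 Hc] := continuous_box_bounded q (@continuous_cc_bound R n 0).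
have le x : cc_bound (clip q x) 0 <= c := le_trans (ler_norm _) (Hc _ (box_clip x q0)).
eexists; have := transport_connect mu n_ge1 (bmap_clip q0) (bmap_cst 0)
  (fun x => le_trans (cc_bound_hnorm _ _) (le x)) (fun x => le_trans (cc_bound_sqrt _ _) (le x)).
apply: hdiv_cost_ext => f sf.
rewrite bmap_integral ?smooth_clip//; [|exact: bmap_clip|exact: bmap_cst].
by rewrite Rintegral_probability_cst.
Qed.

(** The identity is clear for finite sums of Dirac masses, by [l_sum]. The map [T] sends [mu] to
    such a sum while moving points little, which perturbs the left side by a small transport cost
    and the right side by a small amount, by [potential_le]. *)
Lemma potential_integral : l (fun f => \int[mu]_x f x - f 0) = \int[mu]_x potential x.
Proof.
have [c hc] := measure_cost.
apply/eqP; rewrite -subr_eq0 -normr_le0; apply/ler_addgt0Pr => e6 e60; rewrite add0r.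
(* Transport along five segments of length at most [e] costs [5 * e], and moving the argument of the
   potential costs one more [e]. *)
pose e := e6 / 6; have e0 : 0 < e by rewrite divr_gt0.
pose U z := [set x | cc_bound x z < e].
have oU z : open (U z).
  rewrite (_ : U z = (fun x => cc_bound x z) @^-1` [set t | t < e])//.
  by apply: open_comp; [move=> x _; exact: continuous_cc_bound|exact: open_lt].
have Uz z : U z z by rewrite /U /= cc_boundxx.
have mU z : measurable (U z) by exact: open_measurable_mx.
have [zs Hzs] := compact_pick q oU Uz.
pose T x := pick_in U zs (clip q x).
have bT : bmap T.
  have [mp [s bs]] := bmap_pick_in mU zs.
  by split; [exact: measurableT_comp mp (bmap_clip q0).1|exists s => x; exact: bs].
have le x : cc_bound (clip q x) (T x) <= e by apply/ltW/Hzs/box_clip.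
have := transport_connect mu n_ge1 (bmap_clip q0) bT
  (fun x => le_trans (cc_bound_hnorm _ _) (le x)) (fun x => le_trans (cc_bound_sqrt _ _) (le x)).
move=> hT; have := l_abs hT.
pose m (k : 'I_(size zs).+1) := fine (mu [set x | find (fun z => `[< U z x >]) zs = k]).
pose z (k : 'I_(size zs).+1) := nth 0 zs k.
have TE f : \int[mu]_x f (T x) = \sum_k m k * f (z k).
  rewrite -(Rintegral_pick_in mU mu zs f).
  rewrite -(Rintegral_clip q0 nq (g := fun x => f (pick_in U zs x)))//.
  exact: (bmeas_pick_in mU zs f).1.
have m1 : \sum_k m k = 1.
  have := TE (fun=> 1); rewrite Rintegral_probability_cst => ->.
  by apply: eq_bigr => k _; rewrite mulr1.
have [[d hs] ls] := l_sum (index_enum _) m z.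
have -> : l (fun f => \int[mu]_x (f (clip q x) - f (T x))) =
    l (fun f => \int[mu]_x f x - f 0) - \sum_k m k * potential (z k).
  rewrite -ls addrC -mulN1r -(lL _ hs hc); apply: (l_ext hT) => f sf.
  rewrite bmap_integral ?smooth_clip ?TE//; last exact: bmap_clip.
  have -> : \sum_k m k * (f (z k) - f 0) = \sum_k m k * f (z k) - f 0.
    rewrite -[X in _ - X]mul1r -m1 mulr_suml -sumrB.
    by apply: eq_bigr => k _; rewrite mulrBr.
  by ring.
rewrite -TE => h1.
have bp := bmeas_bmap continuous_potential.
have h2 : `|\int[mu]_x (potential (clip q x) - potential (T x))| <= e.
  have mB : measurable_fun setT (fun x => potential (clip q x) - potential (T x)).
    by apply: measurable_funB; [exact: (bp _ (bmap_clip q0)).1|exact: (bp _ bT).1].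
  have := Rintegral_bmeas_le mu mB (fun x => le_trans (potential_le _ _) (le x)).
  rewrite [X in _ <= X * _](_ : _ = 1) ?mul1r//.
  exact: (congr1 fine (probability_setT mu)).
have mp : measurable_fun setT potential.
  by apply: continuous_measurable_real; exact: continuous_potential.
move: h2; rewrite RintegralB//; [|exact: bmeas_integrable (bp _ (bmap_clip q0))|exact: bmeas_integrable (bp _ bT)].
rewrite Rintegral_clip//.
have e6E : e6 = e * 6 by rewrite /e; field.
move: h1; rewrite e6E !ler_norml.
move: (l _) (\int[mu]_x potential x) (\int[mu]_x potential (T x)) => A B D.
by move=> /andP[? ?] /andP[? ?]; apply/andP; split; lra.
Qed.

End measure.
End potential.

(** * Truncation to a bounded potential *)

Section clamp.
Context {R : realType}.

Definition clamp (K t : R) : R := Num.max (- K) (Num.min K t).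

Lemma clamp_le K t : 0 <= K -> `|clamp K t| <= K.
Proof.
move=> K0; rewrite /clamp ler_norml le_max lexx ge_max ge_min lexx andbT /=; lra.
Qed.

Lemma clamp_id K t : `|t| <= K -> clamp K t = t.
Proof. by rewrite ler_norml => /andP[t1 t2]; rewrite /clamp min_r// max_r. Qed.

Lemma clamp_lip K s t : 0 <= K -> `|clamp K s - clamp K t| <= `|s - t|.
Proof.
move=> K0.
have W a b : a <= b -> 0 <= clamp K b - clamp K a <= b - a.
  move=> ab; rewrite /clamp.
  have [b1|b1] := leP K b; have [a1|a1] := leP K a;
  have [?|?] := leP (- K) a; have [?|?] := leP (- K) b; have [?|?] := leP (- K) K;
  try lra.
have [st|st] := leP s t.
  have /andP[h1 h2] := W _ _ st.
  by rewrite distrC (distrC s) !ger0_norm// subr_ge0.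
have /andP[h1 h2] := W _ _ (ltW st).
by rewrite !ger0_norm// subr_ge0 ltW.
Qed.

End clamp.

Section bounded_potential.
Context {R : realType} {n : nat}.
Local Notation H := (heis R n).
Hypothesis n_ge1 : (1 <= n)%N.
Variables mu nu : probability H R.
Hypotheses (mu_compact : compactly_supported mu) (nu_compact : compactly_supported nu).

Lemma Rintegral_eq_box (la : probability H R) q u v : 0 <= q -> null_outside q la ->
  continuous u -> continuous v -> (forall x, box q x -> u x = v x) ->
  \int[la]_x u x = \int[la]_x v x.
Proof.
move=> q0 nq cu cv uv.
rewrite -(Rintegral_clip q0 nq (continuous_measurable_real cu)).
rewrite -(Rintegral_clip q0 nq (continuous_measurable_real cv)).
by apply: eq_Rintegral => x _; apply: uv; exact: box_clip.
Qed.

Lemma common_box : exists q, [/\ 0 <= q, null_outside q mu & null_outside q nu].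
Proof.
have [q1 q10 n1] := probability_null_outside mu_compact.
have [q2 q20 n2] := probability_null_outside nu_compact.
exists (q1 + q2); split; first exact: addr_ge0.
- by move=> A mA AB; apply: n1 => // x Ax bx; apply: (AB x Ax); apply: box_le bx; rewrite lerDl.
- by move=> A mA AB; apply: n2 => // x Ax bx; apply: (AB x Ax); apply: box_le bx; rewrite lerDr.
Qed.

Lemma exists_potential : exists c0 u K,
  [/\ hdiv_cost (diff_integral mu nu) c0, continuous u,
      forall x Z, `|u (hexp x Z) - u x| <= hnorm Z, forall x, `|u x| <= K
    & diff_integral mu nu u = inf [set c | hdiv_cost (diff_integral mu nu) c]].
Proof.
have [q [q0 n1 n2]] := common_box.
have [c1 h1] := measure_cost n_ge1 q0 n1.
have [c2 h2] := measure_cost n_ge1 q0 n2.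
(* Each measure is compared with the Dirac mass at 0, which cancels in the difference. *)
have dE : diff_integral mu nu = fun f =>
    -1 * (\int[nu]_x f x - f 0) + (\int[mu]_x f x - f 0).
  by apply/funext => f; rewrite /diff_integral; ring.
have h3 : hdiv_cost (diff_integral mu nu) (`|-1| * c2 + c1).
  by rewrite dE; exact: hdiv_costD (hdiv_costZ (-1) h2) h1.
have [l [lL l_le l0]] := @Hahn_Banach R ((H -> R) -> R^o) (@hdiv_cost R n)
  (fun s c => @hdiv_cost_ge0 _ _ s c) (fun s t c d => @hdiv_costD _ _ s t c d)
  (fun a s c => @hdiv_costZ _ _ a s c) _ _ h3.
have lL' (a : R) s t c d : hdiv_cost s c -> hdiv_cost t d ->
  l (fun f => a * s f + t f) = a * l s + l t by move=> hs ht; exact: lL hs ht.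
pose u := potential l.
have cu : continuous u := continuous_potential n_ge1 lL' l_le mu.
have [K K0 HK] := continuous_box_bounded q cu.
(* As [K] bounds [u] on the box carrying both measures, truncation changes neither integral, and it
   preserves the Lipschitz bound. *)
exists (`|-1| * c2 + c1), (fun x => clamp K (u x)), K.
have cv : continuous (fun x => clamp K (u x)).
  move=> x; apply/continuous_distP => e e0.
  have := (continuous_distP _ _).1 (cu x) e e0; apply: filterS => y.
  by apply: le_trans; exact: clamp_lip.
split=> //.
- move=> x Z; apply: le_trans (clamp_lip _ _ K0) _.
  exact: (potential_hexp n_ge1 lL' l_le mu).
- by move=> x; exact: clamp_le.
- rewrite -l0 /diff_integral.
  have E x : box q x -> clamp K (u x) = u x by move=> bx; rewrite clamp_id//; exact: HK.
  rewrite (Rintegral_eq_box q0 n1 cv cu E) (Rintegral_eq_box q0 n2 cv cu E).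
  rewrite [X in _ = l X]dE (lL' _ _ _ _ _ h2 h1).
  rewrite (potential_integral n_ge1 lL' l_le mu q0 n1) (potential_integral n_ge1 lL' l_le mu q0 n2).
  by rewrite mulN1r addrC.
Qed.

End bounded_potential.

(** * Weak duality *)

Section weak_duality.
Context {R : realType} {n : nat}.
Local Notation H := (heis R n).

(** Continuity suffices, because it is the gradient field that is cut off and not the function. *)
Lemma exists_cutoff r : 0 <= r -> exists chi : H -> R,
  [/\ continuous chi, forall x, 0 <= chi x <= 1, forall x, box r x -> chi x = 1
    & boxsupp (r + 1) chi].
Proof.
move=> r0; pose g (x : H) : R := r + 1 - `|x|.
have cg : continuous g.
  move=> x; exact: continuousB (@cst_continuous _ _ (r + 1) x) (@norm_continuous _ _ x).
exists (fun x => Num.max 0 (Num.min 1 (g x))); split.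
- move=> x; apply: (@continuous_max R _ (fun=> 0) (fun x => Num.min 1 (g x))).
    exact: cst_continuous.
  apply: (@continuous_min R _ (fun=> 1) g); [exact: cst_continuous|exact: cg].
- by move=> x; rewrite le_max lexx ge_max ler01 ge_min lexx.
- move=> x /(box_norm _ r0).1 xr; rewrite min_l ?max_r// /g; lra.
- move=> x; have r10 : 0 <= r + 1 by rewrite addr_ge0.
  apply: contra_neqP => nbx; have gx : g x < 0.
    rewrite subr_lt0 ltNge; apply/negP => xr; apply: nbx; exact/(box_norm _ r10).2.
  by rewrite min_r ?max_l ?(ltW gx)// (le_trans (ltW gx)).
Qed.

Lemma hpairing_le_hmass (w : hmeasure R n) v : hmeasure_compact w -> smooth v ->
  (forall x, hnorm (hgrad v x) <= 1) -> (`|hpairing w (hgrad v)|%:E <= hmass w)%E.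
Proof.
move=> cw sv gv.
have /choice[s Hs] : forall i, exists r, 0 <= r /\ null_outside r (w i).
  by move=> i; have [r r0 nr] := compactly_supported_null_outside (cw i); exists r.
pose r := \sum_i s i.
have r0 : 0 <= r by apply: sumr_ge0 => i _; exact: (Hs i).1.
have nw i : null_outside r (w i).
  apply: null_outside_le (Hs i).2; rewrite /r (bigD1 i)//= lerDl.
  by apply: sumr_ge0 => j _; exact: (Hs j).1.
have [chi [cchi chi01 chi1 bchi]] := exists_cutoff r0.
pose phi x := chi x *: hgrad v x.
have cphi i : continuous (fun x => phi x 0 i).
  have -> : (fun x => phi x 0 i) = fun x => chi x * hgrad v x 0 i.
    by apply/funext => x; rewrite mxE.
  move=> x; apply: (@continuousM R _ chi (fun x => hgrad v x 0 i) x (cchi x)).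
  exact: continuous_hgrad_coord.
have -> : hpairing w (hgrad v) = hpairing w phi.
  rewrite (hpairing_box nw)//; apply: eq_bigr => i _.
  rewrite [RHS](charge_integral_null_outside (nw i)); last exact: continuous_measurable_real.
  congr charge_integral; apply/funext => x; rewrite [phi x 0 i]mxE.
  have [bx|nbx] := pselect (box r x); first by rewrite chi1// mul1r.
  by rewrite indicE memNset// !mulr0.
apply: ereal_sup_ubound; exists phi => //; split.
- move=> e e0; exists phi; last by move=> x; rewrite subrr hnorm0 ltW.
  split; first exact: continuous_mxP.
  have /compact_support_funP : exists s, boxsupp s chi by exists (r + 1).
  move=> cK; apply: (subclosed_compact _ cK); first exact: closed_closure.
  apply: closure_subset => x /=; apply: contra_neq => chix.
  by rewrite /phi chix scale0r.
- move=> x; have /andP[h0 h1] := chi01 x; rewrite /phi hnormZ ger0_norm//.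
  by rewrite -[leRHS]mul1r; apply: ler_pM; rewrite ?hnorm_ge0.
Qed.

Lemma weak_duality (w : hmeasure R n) (mu nu : probability H R) (u : H -> R) :
  compactly_supported mu -> compactly_supported nu ->
  hmeasure_compact w -> hdiv_eq w mu nu -> HW1oo_ball R n u ->
  ((diff_integral mu nu u)%:E <= hmass w)%E.
Proof.
move=> cmu cnu cw dw bu; have cu : continuous u := bu.1.
have [q [q0 n1 n2]] := common_box cmu cnu.
(* One error [e] for each of the two measures. *)
apply/lee_addgt0Pr => e2 e20; pose e := e2 / 2.
have e0 : 0 < e by rewrite divr_gt0.
have [v [sv gv vu]] := ball_smooth_approx bu q e0.
have cv : continuous v := (sv 0%N).1.
have close (la : probability H R) : null_outside q la -> `|\int[la]_x v x - \int[la]_x u x| <= e.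
  move=> nla.
  rewrite -(Rintegral_clip q0 nla (continuous_measurable_real cu)).
  rewrite -(Rintegral_clip q0 nla (continuous_measurable_real cv)).
  have bv := bmeas_bmap cv (bmap_clip q0); have bu' := bmeas_bmap cu (bmap_clip q0).
  rewrite -RintegralB//; [|exact: bmeas_integrable|exact: bmeas_integrable].
  have mB := measurable_funB bv.1 bu'.1.
  have := Rintegral_bmeas_le la mB (fun x => vu _ (box_clip x q0)).
  rewrite [X in _ <= X * _](_ : _ = 1) ?mul1r//.
  exact: (congr1 fine (probability_setT la)).
apply: (@le_trans _ _ (`|hpairing w (hgrad v)| + e2)%:E); last first.
  by rewrite EFinD leeD2r//; exact: hpairing_le_hmass.
rewrite lee_fin; have := dw v sv; rewrite /hdiv /diff_integral.
have := close _ n1; have := close _ n2.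
have -> : e2 = e + e by rewrite /e; lra.
rewrite !ler_norml; have := ler_norm (- hpairing w (hgrad v)); rewrite normrN.
move: (hpairing _ _) => P.
move: (\int[mu]_x v x) (\int[nu]_x v x) (\int[mu]_x u x) (\int[nu]_x u x) => a b c d.
by move=> ? /andP[? ?] /andP[? ?] ?; lra.
Qed.

End weak_duality.

Theorem corollary4p6 (R : realType) (n : nat) (n_ge1 : (1 <= n)%N)
    (mu nu : probability (heis R n) R)
    (mu_compact : compactly_supported mu)
    (nu_compact : compactly_supported nu) :
  exists M : R,
    is_max [set diff_integral mu nu u | u in HW1oo_ball R n] M /\
    M%:E = ereal_inf [set hmass w |
      w in [set w : hmeasure R n | hmeasure_compact w /\ hdiv_eq w mu nu]].
Proof.
have [c0 [u [K [h0 cu ulip uK uE]]]] := exists_potential n_ge1 mu_compact nu_compact.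
have bu : HW1oo_ball R n u := smooth_approx_HW1oo cu uK (lip_smooth_approx cu ulip).
(* Every cost bounds the mass of some admissible [w], so the infimum of the masses is at most the
   infimum of the costs, which is the integral of [u]; [weak_duality] gives the converse. *)
have costP c : hdiv_cost (diff_integral mu nu) c -> exists2 w : hmeasure R n,
    hmeasure_compact w /\ hdiv_eq w mu nu & (hmass w <= c%:E)%E.
  move=> [w [r [nw dw mw]]]; exists w; last exact: mass_le_hmass.
  by split=> // i; exact: null_outside_compact (nw i).
exists (diff_integral mu nu u); split.
  split; first by exists u.
  move=> _ [v bv <-]; rewrite uE; apply: lb_le_inf; first by exists c0.
  move=> c /costP[w [cw dw] wc]; rewrite -lee_fin; apply: le_trans wc.
  exact: weak_duality.
apply/eqP; rewrite eq_le; apply/andP; split.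
  by apply: le_ereal_inf_tmp => _ [w [cw dw] <-]; exact: weak_duality.
apply/lee_addgt0Pr => e e0.
have hi : has_inf [set c | hdiv_cost (diff_integral mu nu) c].
  by split; [exists c0|exists 0 => c; exact: hdiv_cost_ge0].
have [c hc ce] := inf_adherent e0 hi.
have [w wP wc] := costP c hc.
apply: (@le_trans _ _ (hmass w)); first by apply: ereal_inf_lbound; exists w.
by apply: (le_trans wc); rewrite -EFinD lee_fin ltW// uE.
Qed.
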